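(* Let $(X_n)_{n\ge0}$ be a transient nearest neighbour random walk on the directed cover $\mathcal{T}$ of $G$ with transition data $p_G(i,j)$, $p(-i)$, whose non-zero transition probabilities are bounded away from $0$: there is $\varepsilon_0>0$ with $p(x,y)\ge\varepsilon_0$ for all $x,y\in\mathcal{T}$ with $p(x,y)>0$. Assume that the Markov chain on $G$ with transition matrix $Q=(q(i,j))_{i,j\in G}$, $q(i,j)=\frac{1-F(-j)}{1-F(-i)}\,p(i,j)\,\overline{G}_i(1)$, is positive recurrent, and that the spectral radius of $(X_n)$ is strictly smaller than $1$. Let $\pi_n$ be the distribution of $X_n$ and $h=\lim_{n\to\infty}-\frac1n\mathbb{E}[\log\pi_n(X_n)]$ the asymptotic entropy (which exists). For $x\in\mathcal{T}$ let $F(o,x)=\mathbb{P}[\exists m\in\mathbb{N}_0:\ X_m=x\mid X_0=o]$. Then $h$ equals the rate of escape with respect to the Green metric, i.e. $$h=\lim_{n\to\infty}-\frac1n\log F(o,X_n)\quad\text{almost surely.}$$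
   Context: $G$ is a countable directed graph, strongly connected, of bounded geometry (uniformly bounded vertex degrees), without multiple edges; $i_0\in G$. The directed cover $\mathcal{T}$ of $G$ rooted in $i_0$ is the rooted tree with vertices labelled by $\tau:\mathcal{T}\to G$: the root $o$ has label $i_0$, and recursively a vertex with label $i$ has exactly one direct descendant with label $j$ for each edge $(i,j)$ of $G$ and no others. $x^-$ denotes the direct ancestor of $x\neq o$. Given are transition probabilities $p_G(i,j)$ on $G$ (stochastic, with $p_G(i,j)>0$ iff there is an edge from $i$ to $j$) and backward probabilities $p(-i)\in(0,1)$, $i\in G$, such that for some $\varepsilon\in(0,1)$, $\varepsilon<p(-i)<1-\varepsilon$ for all $i$. Put $p(i,j)=(1-p(-i))p_G(i,j)$. A loop is added at the root. The random walk $(X_n)$ on $\mathcal{T}$ starts at $o$ and has transition probabilities $p(x,y)=p(\tau(x),\tau(y))$ if $y^-=x$; $p(x,x^-)=p(-\tau(x))$ for $x\ne o$; $p(o,o)=p(-i_0)$; and $0$ otherwise. For $i\in G$ and any $x\in\mathcal{T}\setminus\{o\}$ with $\tau(x)=i$ (the choice is irrelevant), $F(-i)=\mathbb{P}[\exists n:\ X_n=x^-\mid X_0=x]$ and $\overline{G}_i(1)=\sum_{n\ge0}\mathbb{P}[X_n=x,\ X_m\neq x^-\ \forall m<n\mid X_0=x]$. The spectral radius of $(X_n)$ is $1/R$, where $R$ is the radius of convergence of $G(o,o|z)=\sum_{n\ge0}\mathbb{P}[X_n=o\mid X_0=o]z^n$. The Green distance of $x$ from $o$ is $-\log F(o,x)$.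 *)

(* Defs.v *)
From HB Require Import structures.
From mathcomp Require Import all_boot all_order all_algebra.
From mathcomp Require Import all_classical all_reals all_analysis.

Set Implicit Arguments.
Unset Strict Implicit.
Unset Printing Implicit Defensive.

Import Order.TTheory GRing.Theory Num.Theory.
Import numFieldNormedType.Exports.

Local Open Scope classical_set_scope.
Local Open Scope ring_scope.

(* A directed graph without multiple edges is a relation on its vertices. *)

Definition strongly_connected (V : countType) (E : rel V) : Prop :=
  forall i j : V, exists s : seq V, path E i s /\ last i s = j.

(* In-neighbours and out-neighbours are both counted. *)
Definition bounded_geometry (V : countType) (E : rel V) : Prop :=
  exists D : nat, forall (i : V) (s : seq V),
    uniq s -> all (fun j => E i j || E j i) s -> (size s <= D)%N.

(* A vertex of the directed cover rooted in i0 is encoded by the labels met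
   after the root on the way from the root to this vertex, that is, by a finite
   path of the graph issued from i0.  The lemmas cover_parent_edge and
   cover_child show that this is the labelled tree with exactly one child of
   label j below x for each edge (label x, j), and no other vertex. *)
Definition dcover (V : countType) (E : rel V) (i0 : V) : Type :=
  {s : seq V | path E i0 s}.

HB.instance Definition _ (V : countType) (E : rel V) (i0 : V) :=
  Countable.copy (dcover E i0) {s : seq V | path E i0 s}.

Section DirectedCover.
Variables (V : countType) (E : rel V) (i0 : V).
Local Notation T := (dcover E i0).

Definition cover_root : T := exist (path E i0) [::] isT.

Definition cover_label (x : T) : V := last i0 (sval x).

(* The parent of the root is the root itself. *)
Definition cover_parent (x : T) : T :=
  exist (path E i0) (take (size (sval x)).-1 (sval x))
    (take_path (size (sval x)).-1 (svalP x)).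

Lemma cover_parent_edge (x : T) : x != cover_root ->
  E (cover_label (cover_parent x)) (cover_label x).
Proof.
case: x => s; case/lastP: s => [|s j] Hs.
  by move/negP; case; apply/eqP; apply: val_inj.
move=> _; rewrite /cover_label /cover_parent /= size_rcons /= last_rcons.
by rewrite -cats1 take_size_cat //; move: Hs; rewrite rcons_path => /andP[].
Qed.

Lemma cover_child (x : T) (j : V) : E (cover_label x) j ->
  exists! y : T,
    [/\ y != cover_root, cover_parent y = x & cover_label y = j].
Proof.
case: x => s Hs Ej.
have Hy : path E i0 (rcons s j) by rewrite rcons_path Hs.
exists (exist (path E i0) _ Hy); split.
  split; last by rewrite /cover_label /= last_rcons.
  - by apply/negP => /eqP/(congr1 sval) /=; case: (s).
  - by apply: val_inj; rewrite /= size_rcons -cats1 take_size_cat.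
case=> t Ht [nr pr lb]; apply: val_inj => /=.
move: Ht nr pr lb; case/lastP: t => [|t k] Ht nr.
  by case/negP: nr; apply/eqP; apply: val_inj.
move=> /(congr1 sval) /= pr; rewrite /cover_label /= last_rcons => <-.
by rewrite -pr size_rcons /= -(cats1 t) take_size_cat // cats1.
Qed.

Lemma cover_rooted (x : T) : iter (size (sval x)) cover_parent x = cover_root.
Proof.
have H n : sval (iter n cover_parent x) = take (size (sval x) - n) (sval x).
  elim: n => [|n IHn] /=; first by rewrite subn0 take_size.
  rewrite IHn size_takel ?leq_subr // subnS.
  by rewrite take_takel // leq_pred.
by apply: val_inj; rewrite /= H subnn take0.
Qed.

End DirectedCover.

Section MarkovChains.
Context {R : realType} {S : countType} {d : measure_display}
  {Omega : measurableType d}.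

(* P x is the law P[ . | X_0 = x ]; the third clause is the Markov property with
   one-step transition probabilities p. *)
Definition markov_chain (p : S -> S -> R) (P : S -> probability Omega R)
    (X : nat -> Omega -> S) : Prop :=
  [/\ forall (n : nat) (x : S), measurable [set w | X n w = x],
      forall x : S, P x [set w | X 0%N w = x] = 1%:E
    & forall (x : S) (n : nat) (s : nat -> S),
        P x [set w | forall k, (k <= n.+1)%N -> X k w = s k] =
        (P x [set w | forall k, (k <= n)%N -> X k w = s k] *
           (p (s n) (s n.+1))%:E)%E].

Definition transient (P : S -> probability Omega R)
    (X : nat -> Omega -> S) : Prop :=
  forall x : S, (P x [set w | exists n, (0 < n)%N /\ X n w = x] < 1)%E.

(* First visit to x at a positive time, +oo if there is none. *)
Definition return_time (X : nat -> Omega -> S) (x : S) (w : Omega) : \bar R :=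
  ereal_inf [set (n%:R)%:E | n in [set n : nat | (0 < n)%N /\ X n w = x]].

(* F(x, y) *)
Definition hitting_prob (P : S -> probability Omega R)
    (X : nat -> Omega -> S) (x y : S) : R :=
  fine (P x [set w | exists m : nat, X m w = y]).

Definition return_radius (P : S -> probability Omega R)
    (X : nat -> Omega -> S) (x : S) : \bar R :=
  ereal_sup [set r%:E | r in [set r : R | 0 <= r /\
    cvgn (series (fun n => fine (P x [set w | X n w = x]) * r ^+ n))]].

Definition spectral_radius (P : S -> probability Omega R)
    (X : nat -> Omega -> S) (x : S) : \bar R :=
  ((return_radius P X x)^-1)%E.

(* (1 / n) * E_x[- log pi_n(X_n)], where pi_n is the law of X_n under P x;
   at points outside the support of pi_n (a null event) ln 0 = 0. *)
Definition mean_entropy (P : S -> probability Omega R)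
    (X : nat -> Omega -> S) (x : S) (n : nat) : R :=
  - (n%:R)^-1 *
  fine ('E_(P x)[fun w => ln (fine (P x [set w' | X n w' = X n w]))])%E.

Definition asymptotic_entropy (P : S -> probability Omega R)
    (X : nat -> Omega -> S) (x : S) : R :=
  limn (mean_entropy P X x).

End MarkovChains.

(* Positive recurrence depends only on the transition matrix, so any
   realization of the chain may be used. *)
Definition positive_recurrent (R : realType) (S : countType)
    (q : S -> S -> R) : Prop :=
  exists (d : measure_display) (Omega : measurableType d)
    (P : S -> probability Omega R) (Y : nat -> Omega -> S),
    markov_chain q P Y /\
    forall i : S, (\int[P i]_w (return_time Y i w : \bar R) < +oo)%E.

Definition stochastic (R : realType) (S : countType) (p : S -> S -> R) : Prop :=
  (forall i j, 0 <= p i j) /\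
  (forall i, \esum_(j in [set: S]) (p i j)%:E = 1%:E).

Section CoverWalk.
Context {R : realType} {V : countType}.
Variables (E : rel V) (i0 : V) (pG : V -> V -> R) (pback : V -> R).
Local Notation T := (dcover E i0).
Local Notation o := (cover_root E i0).

Definition forward (i j : V) : R := (1 - pback i) * pG i j.

(* The last nonzero case is the loop at the root. *)
Definition cover_trans (x y : T) : R :=
  if (y != o) && (cover_parent y == x) then
    forward (cover_label x) (cover_label y)
  else if (x != o) && (y == cover_parent x) then pback (cover_label x)
  else if (x == o) && (y == o) then pback i0
  else 0.

(* Some vertex other than the root with label i. *)
Definition cover_rep (i : V) : T :=
  xget o [set x : T | x != o /\ cover_label x = i].

Context {d : measure_display} {Omega : measurableType d}.
Variables (P : T -> probability Omega R) (X : nat -> Omega -> T).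

(* F(-i) *)
Definition Fback (i : V) : R :=
  hitting_prob P X (cover_rep i) (cover_parent (cover_rep i)).

(* The restricted Green function at z = 1: expected number of visits to x,
   of label i, before the first visit to its ancestor. *)
Definition Gbar (i : V) : R :=
  let x := cover_rep i in
  fine (\sum_(0 <= n <oo)
    P x [set w | X n w = x /\
                 forall m, (m < n)%N -> X m w <> cover_parent x])%E.

Definition exit_matrix (i j : V) : R :=
  (1 - Fback j) / (1 - Fback i) * forward i j * Gbar i.

End CoverWalk.

(* Main.v *)
(* By the spectral gap, G(o, x) and F(o, x) agree up to bounded factors, and
   decomposing at the last entrance into the cone of each vertex of the path from
   o to x makes -ln G(o, x) a sum of edge costs depending on labels only, up to a
   constant.  The walk is cut at its last exit times; the probability of a
   prescribed list of (label, duration) pairs is at most a product of kernel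
   weights, which the h-transform by 1 - F(-i) turns into the chain Q.  Cutting
   this list at the visits of the label i0, the words between two visits form an
   alphabet with weights of mass at most 1, and by positive recurrence the total
   duration has finite mean.  A strong law for events indexed by words, where only
   an upper bound by product weights is known, gives convergence of the costs and
   durations along these times, hence of -(1/n) ln F(o, X_n), to a constant l.
   For the entropy, F(o, x) >= pi_n(x), while on |x| <= n one has
   F(o, x) <= 2 (pi_0 + ... + pi_(N-1))(x) with N = O(n); Gibbs' inequality then
   gives E[-ln pi_n(X_n)] = E[-ln F(o, X_n)] + O(ln n), and dominated convergence
   identifies the entropy with l. *)

Require Import Defs.
From mathcomp Require Import all_boot all_order all_algebra.
From mathcomp Require Import all_classical all_reals all_analysis.
From mathcomp Require Import measurable_realfun.
From mathcomp Require Import ring lra zify.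

Set Implicit Arguments.
Unset Strict Implicit.
Unset Printing Implicit Defensive.

Import Order.TTheory GRing.Theory Num.Theory.
Import numFieldNormedType.Exports.

Local Open Scope classical_set_scope.
Local Open Scope ring_scope.

(** * Countable families of events *)

(** A prescribed word of labels and durations makes these times deterministic, and then the
    probability that the walk follows the word factors by the ordinary Markov property. The joint
    law of the exits is never identified: the exponential and maximal inequalities behind a strong
    law are union bounds over words, and these survive when the law is replaced by a dominating
    product weight. Positive recurrence is transferred in the same spirit: the tails of the return
    time to [i0], in any realization of Q, dominate the weight of the words that avoid [i0]. The
    spectral gap supplies the uniformity: p^n(x,x) <= r^(-n) for every x, without a constant. Hence
    diagonal Green functions and return series are at most 1/(1 - 1/r), the durations of segments
    have geometric tails uniformly in the label, and the series [Gbar] is finite. The root needs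
    separate care throughout, because its loop breaks the dependence on labels alone. *)

Section CountableUnions.
Context {d : measure_display} {T : measurableType d} {R : realType}.
Variable (mu : {measure set T -> \bar R}).
Local Open Scope ereal_scope.

Lemma bigcup_count_measurable (C : countType) (A : set C) (F : C -> set T) :
  (forall c, A c -> measurable (F c)) -> measurable (\bigcup_(c in A) F c).
Proof.
move=> mF.
(* Slicing by the code of the index: each slice has at most one member, which leaves a union over
   the integers. *)
rewrite (_ : \bigcup_(c in A) F c = \bigcup_n \bigcup_(c in A `&` [set c | pickle c = n]) F c).
  apply: bigcup_measurable => n _.
  have [[c [Ac cn]]|Nc] := pselect (exists c, A c /\ pickle c = n).
    rewrite (_ : _ `&` _ = [set c]); first by rewrite bigcup_set1; exact: mF.
    apply/seteqP; split => [c' [_ /= c'n]|c' /= ->]; last by split.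
    by apply: (pcan_inj pickleK); rewrite cn c'n.
  rewrite (_ : _ `&` _ = set0) ?bigcup_set0//.
  by apply/seteqP; split => // c [Ac cn]; apply: Nc; exists c.
apply/seteqP; split => [x [c Ac Fx]|x [n _ [c [Ac _] Fx]]]; last by exists c.
by exists (pickle c) => //; exists c.
Qed.

Lemma measure_bigcup_count (C : countType) (A : set C) (F : C -> set T) :
  (forall c, A c -> measurable (F c)) -> trivIset A F ->
  mu (\bigcup_(c in A) F c) = \esum_(c in A) mu (F c).
Proof.
move=> mF tF.
pose J := [set pickle c | c in A].
pose G n := if unpickle n is Some c then F c else set0.
have -> : \bigcup_(c in A) F c = \bigcup_(n in J) G n.
  by rewrite bigcup_image; apply: eq_bigcupr => c Ac; rewrite /G pickleK.
rewrite measure_bigcup//.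
- rewrite nneseries_esum// (_ : [set x | x \in J] = J); last first.
    by apply/seteqP; split => n /=; rewrite inE.
  rewrite esum_image; last by move=> x y _ _; exact: (pcan_inj pickleK).
  by apply: eq_esum => c _; rewrite /G pickleK.
- by move=> _ [c Ac <-]; rewrite /G pickleK; exact: mF.
- move=> _ _ [c Ac <-] [c' Ac' <-]; rewrite /G !pickleK => cc'.
  by congr pickle; exact: tF.
Qed.

Lemma measure_bigcup_count_le (C : countType) (A : set C) (F : C -> set T) :
  (forall c, A c -> measurable (F c)) ->
  mu (\bigcup_(c in A) F c) <= \esum_(c in A) mu (F c).
Proof.
move=> mF.
pose J := [set pickle c | c in A].
(* [pickle_inv], unlike [unpickle], is [Some c] only at the code of [c], so no index is counted
   twice in the sum over all n. *)
pose G n := if pickle_inv n is Some c then if c \in A then F c else set0 else set0.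
have eJ : \bigcup_(c in A) F c = \bigcup_n G n.
  apply/seteqP; split => [x [c Ac Fx]|x [n _]].
    by exists (pickle c) => //; rewrite /G pickleK_inv mem_set.
  by rewrite /G; case: pickle_inv => // c; case: ifP => // /set_mem Ac Fx; exists c.
have mG n : measurable (G n).
  by rewrite /G; case: pickle_inv => // c; case: ifP => // /set_mem; exact: mF.
apply: (@le_trans _ _ (\sum_(n <oo) mu (G n))).
  apply: measure_sigma_subadditive => //; last by rewrite eJ.
  by rewrite eJ; exact: bigcup_measurable.
rewrite nneseries_esumT// (esumID J)// setTI [X in _ + X]esum1 ?adde0.
  rewrite esum_image; last by move=> x y _ _; exact: (pcan_inj pickleK).
  by apply: le_esum => c Ac; rewrite /G pickleK_inv mem_set.
move=> n [_ /= Jn]; rewrite /G; case E : pickle_inv => [c|]//.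
case: ifP => // /set_mem Ac; exfalso; apply: Jn; exists c => //.
by have := @pickle_invK C n; rewrite E.
Qed.

End CountableUnions.

Section ProbabilityCountableUnions.
Context {d : measure_display} {T : measurableType d} {R : realType}.
Variable (Q : probability T R).
Local Open Scope ereal_scope.

Lemma prob_bigcup_count (C : countType) (A : set C) (F : C -> set T) :
  (forall c, A c -> measurable (F c)) -> trivIset A F ->
  Q (\bigcup_(c in A) F c) = \esum_(c in A) Q (F c).
Proof. exact: measure_bigcup_count. Qed.

Lemma prob_bigcup_count_le (C : countType) (A : set C) (F : C -> set T) :
  (forall c, A c -> measurable (F c)) ->
  Q (\bigcup_(c in A) F c) <= \esum_(c in A) Q (F c).
Proof. exact: measure_bigcup_count_le. Qed.

Lemma prob_le (A B : set T) : measurable A -> measurable B -> A `<=` B ->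
  Q A <= Q B.
Proof. by move=> mA mB; apply: le_measure; rewrite inE. Qed.

Lemma prob_fineK (A : set T) : measurable A -> (fine (Q A))%:E = Q A.
Proof. by move=> mA; rewrite fineK// fin_num_measure. Qed.

End ProbabilityCountableUnions.

(** * Events on the path space of a Markov chain *)

(** Scaling finite partial sums gives one inequality; the other is the same inequality for the
    factor 1/c. *)
Lemma esumZl (R : realType) (I : choiceType) (A : set I) (c : R)
    (a : I -> \bar R) : 0 <= c -> (forall i, A i -> 0 <= a i)%E ->
  (\esum_(i in A) (c%:E * a i) = c%:E * \esum_(i in A) a i)%E.
Proof.
have le (k : R) (b : I -> \bar R) : 0 <= k -> (forall i, A i -> 0 <= b i)%E ->
    (\esum_(i in A) (k%:E * b i) <= k%:E * \esum_(i in A) b i)%E.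
  move=> k0 b0; apply: ge_ereal_sup => _ [X [finX XA] <-].
  have -> : (\sum_(i \in X) (k%:E * b i) = k%:E * \sum_(i \in X) b i)%E.
    rewrite !fsbig_finite//= big_seq [in RHS]big_seq ge0_sume_distrr// => i.
    by rewrite in_fset_set// inE => /XA/b0.
  by rewrite lee_wpmul2l ?lee_fin//; apply: esum_ge; exists X.
move=> c0 a0; apply/eqP; rewrite eq_le le//=.
have [->|cn0] := eqVneq c 0.
  by rewrite mul0e; apply: esum_ge0 => i _; rewrite mul0e.
have cp : 0 < c by rewrite lt_def cn0.
have -> : (\esum_(i in A) a i = \esum_(i in A) ((c^-1)%:E * (c%:E * a i)))%E.
  by apply: eq_esum => i _; rewrite muleA -EFinM mulVf// mul1e.
rewrite (le_trans (lee_wpmul2l _ (le _ _ _ _)))// ?lee_fin ?invr_ge0//.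
  by move=> i Ai; rewrite mule_ge0 ?lee_fin ?a0.
by rewrite muleA -EFinM divff// mul1e.
Qed.

Section MarkovPaths.
Context {R : realType} {S : countType} {d : measure_display}
  {Omega : measurableType d}.
Variables (p : S -> S -> R) (P : S -> probability Omega R)
  (X : nat -> Omega -> S).
Hypothesis MC : markov_chain p P X.

Definition path_ev (A : set (nat -> S)) : set Omega :=
  [set w | A (fun k => X k w)].

Definition shift_path (n : nat) (s : nat -> S) : nat -> S :=
  fun k => s (n + k)%N.

(** Stands for measurability with respect to the coordinates 0, ..., n: as the state space is
    countable, such a set of paths is a countable union of cylinders. *)
Definition depends_upto (n : nat) (A : set (nat -> S)) : Prop :=
  forall s s', (forall k, (k <= n)%N -> s k = s' k) -> A s -> A s'.

Definition cylinder (n : nat) (s : nat -> S) : set Omega :=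
  [set w | forall k, (k <= n)%N -> X k w = s k].

Lemma state_measurable n x : measurable [set w | X n w = x].
Proof. by case: MC. Qed.

Lemma cylinder_measurable n s : measurable (cylinder n s).
Proof.
rewrite (_ : cylinder n s = \bigcap_(k in [set k | (k <= n)%N]) [set w | X k w = s k]).
  by apply: bigcap_measurableType => k _; exact: state_measurable.
by apply/seteqP; split => w H k kn; exact: H.
Qed.

Lemma start_prob x y : P x [set w | X 0%N w = y] = ((x == y)%:R)%:E.
Proof.
have [_ P0 _] := MC.
have [<-|xy] := eqVneq x y; first by rewrite P0.
apply/eqP; rewrite -measure_le0.
have := probability_setC (P x) (state_measurable 0 x).
rewrite P0 subee// => <-; apply: le_measure; rewrite ?inE.
- exact: state_measurable.
- by apply: measurableC; exact: state_measurable.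
- by move=> w /= -> /esym/eqP; rewrite (negbTE xy).
Qed.

Lemma start_ae x : {ae P x, forall w, X 0%N w = x}.
Proof.
have mS := state_measurable 0 x.
apply/negligibleP; first by apply: measurableC.
by have := probability_setC (P x) mS; rewrite start_prob eqxx subee.
Qed.

Lemma cylinder_prob x n s :
  P x (cylinder n s) = ((x == s 0%N)%:R * \prod_(k < n) p (s k) (s k.+1))%:E.
Proof.
have [_ _ PS] := MC.
elim: n => [|n IH].
  rewrite big_ord0 mulr1 -start_prob; congr (P x _).
  apply/seteqP; split => w /=; first exact.
  by move=> H k; rewrite leqn0 => /eqP ->.
by rewrite {1}/cylinder PS -/(cylinder n s) IH big_ord_recr/= -EFinM mulrA.
Qed.

Lemma cylinder_split x n m s :
  P x (cylinder (n + m) s) =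
  (P x (cylinder n s) * P (s n) (cylinder m (shift_path n s)))%E.
Proof.
rewrite !cylinder_prob /shift_path addn0 eqxx mul1r -EFinM -mulrA; congr (_ * _)%:E.
rewrite big_split_ord/=; congr (_ * _); apply: eq_bigr => i _.
by rewrite addnS.
Qed.

(** Initial segments are stored as finite functions, which form a countable type and can index
    countable unions; only the values at k <= n are meaningful. *)
Definition ffun_path n (t : {ffun 'I_n.+1 -> S}) : nat -> S := fun k => t (inord k).

Lemma ffun_pathP n (t : {ffun 'I_n.+1 -> S}) (s : nat -> S) :
  (forall k, (k <= n)%N -> s k = ffun_path t k) -> t = [ffun i : 'I_n.+1 => s i].
Proof.
move=> H; apply/ffunP => i; rewrite ffunE H /ffun_path ?inord_val//.
by rewrite -ltnS.
Qed.

Lemma path_evE n A : depends_upto n A ->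
  path_ev A = \bigcup_(t in [set t : {ffun 'I_n.+1 -> S} | A (ffun_path t)])
                cylinder n (ffun_path t).
Proof.
move=> dA; apply/seteqP; split => [w Aw|w [t /= At tw]].
  exists [ffun i : 'I_n.+1 => X i w].
    apply: dA Aw => k kn; rewrite /ffun_path ffunE inordK//.
  by move=> k kn; rewrite /ffun_path ffunE inordK.
by apply: dA At => k kn; rewrite tw.
Qed.

Lemma path_ev_measurable n A : depends_upto n A -> measurable (path_ev A).
Proof.
move=> dA; rewrite (path_evE dA); apply: bigcup_count_measurable => t _.
exact: cylinder_measurable.
Qed.

Lemma trivIset_cylinder n (D : set {ffun 'I_n.+1 -> S}) (F : _ -> set Omega) :
  trivIset D (fun t => cylinder n (ffun_path t) `&` F t).
Proof.
move=> t t' _ _ [w [[tw _] [t'w _]]].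
by rewrite (ffun_pathP tw) (ffun_pathP t'w).
Qed.

(** The future event is cut into cylinders, each of which is glued to the given past and factored by
    [cylinder_split]. *)
Lemma cylinder_future x n m (s : nat -> S) B : depends_upto m B ->
  (P x (cylinder n s `&` [set w | B (shift_path n (fun k => X k w))])
   = P x (cylinder n s) * P (s n) (path_ev B))%E.
Proof.
move=> dB.
(* Time n belongs to both pieces; [D] keeps the futures that agree with the past there. *)
pose glue (t : {ffun 'I_m.+1 -> S}) k := if (k <= n)%N then s k else ffun_path t (k - n).
pose D := [set t : {ffun 'I_m.+1 -> S} | B (ffun_path t) /\ ffun_path t 0 = s n].
have glue_shift t k : D t -> shift_path n (glue t) k = ffun_path t k.
  move=> [_ t0]; rewrite /shift_path /glue; case: ifPn => [|_]; last by rewrite addKn.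
  rewrite -[leqRHS]addn0 leq_add2l leqn0 => /eqP ->.
  by rewrite addn0 t0.
have -> : cylinder n s `&` [set w | B (shift_path n (fun k => X k w))] =
    \bigcup_(t in D) cylinder (n + m) (glue t).
  apply/seteqP; split => [w [sw Bw]|w [t Dt tw]].
    exists [ffun i : 'I_m.+1 => X (n + i)%N w].
      split => /=.
        by apply: dB Bw => k km; rewrite /ffun_path ffunE inordK.
      by rewrite /ffun_path ffunE inordK// addn0 sw.
    move=> k knm; rewrite /glue; case: ifPn => [kn|]; first by rewrite sw.
    rewrite -ltnNge => nk; rewrite /ffun_path ffunE inordK.
      by rewrite subnKC// ltnW.
    by rewrite ltnS leq_subLR.
  split => [k kn|/=].
    by rewrite tw /glue ?kn// (leq_trans kn)// leq_addr.
  have [Bt _] := Dt; apply: dB Bt => k km.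
  by rewrite -(glue_shift _ _ Dt) /shift_path tw// leq_add2l.
rewrite prob_bigcup_count; last first.
- move=> t t' Dt Dt' [w [tw t'w]].
  suff H k : (k <= m)%N -> ffun_path t k = ffun_path t' k.
    by rewrite (ffun_pathP H); apply/ffunP => i; rewrite ffunE /ffun_path inord_val.
  move=> km; rewrite -(glue_shift t)// -(glue_shift t')// /shift_path.
  by rewrite -tw ?t'w// leq_add2l.
- by move=> t _; exact: cylinder_measurable.
rewrite (path_evE dB) prob_bigcup_count; last first.
- move=> t t' Dt Dt' H; apply: (@trivIset_cylinder m setT (fun _ => setT)) => //.
  by move: H; rewrite !setIT.
- by move=> t _; exact: cylinder_measurable.
rewrite -[X in (X * _)%E]prob_fineK; last exact: cylinder_measurable.
rewrite -esumZl ?fine_ge0//.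
rewrite [RHS](esumID [set t | ffun_path t 0 = s n])// => [|t _];
  last by rewrite mule_ge0 ?lee_fin ?fine_ge0.
(* Under [P (s n)] a future with another initial value has probability zero, so the restriction to
   [D] loses nothing. *)
rewrite [X in (_ + X)%E]esum1 ?adde0; last first.
  move=> t [_ /= t0]; rewrite (cylinder_prob (s n) m); case: eqVneq => [/esym//|_].
  by rewrite mul0r mule0.
apply: eq_esum => t Dt.
rewrite cylinder_split prob_fineK; last exact: cylinder_measurable.
have gn : glue t n = s n by rewrite /glue leqnn.
rewrite gn; congr (P x _ * P _ _)%E; apply/seteqP; split => w H k kn.
- by rewrite H // /glue kn.
- by rewrite H // /glue kn.
- by rewrite H // glue_shift.
- by rewrite H // glue_shift.
Qed.

(** Sum of [cylinder_future] over the pasts that lie in [A] and end at [y]. *)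
Lemma markov_property x n m y A B : depends_upto n A -> depends_upto m B ->
  (P x [set w | [/\ A (fun k => X k w), X n w = y &
                 B (shift_path n (fun k => X k w))]]
   = P x [set w | A (fun k => X k w) /\ X n w = y] * P y (path_ev B))%E.
Proof.
move=> dA dB.
pose D := [set t : {ffun 'I_n.+1 -> S} | A (ffun_path t) /\ ffun_path t n = y].
have dA' : depends_upto n [set s | A s /\ s n = y].
  by move=> s s' ss' [As sn]; split; [exact: dA As|rewrite -ss'].
have mB : measurable [set w | B (shift_path n (fun k => X k w))].
  apply: (@path_ev_measurable (n + m) [set s | B (shift_path n s)]).
  move=> s s' ss'; apply: dB => k km; apply: ss'; by rewrite leq_add2l.
have -> : [set w | [/\ A (fun k => X k w), X n w = y &
                 B (shift_path n (fun k => X k w))]] =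
    \bigcup_(t in D) (cylinder n (ffun_path t) `&`
      [set w | B (shift_path n (fun k => X k w))]).
  rewrite -setI_bigcupl -(path_evE dA'); apply/seteqP; split => w /=.
    by move=> [].
  by move=> [[]].
rewrite prob_bigcup_count; last first.
- exact: trivIset_cylinder.
- by move=> t _; apply: measurableI => //; exact: cylinder_measurable.
rewrite -/(path_ev [set s | A s /\ s n = y]) (path_evE dA').
rewrite prob_bigcup_count; last first.
- move=> t t' Dt Dt' H; apply: (@trivIset_cylinder n setT (fun _ => setT)) => //.
  by move: H; rewrite !setIT.
- by move=> t _; exact: cylinder_measurable.
rewrite muleC -[X in (X * _)%E]fineK ?fin_num_measure//; last exact: path_ev_measurable dB.
rewrite -esumZl ?fine_ge0//; apply: eq_esum => t [_ tn].
rewrite (cylinder_future _ _ _ dB) tn muleC fineK ?fin_num_measure//.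
exact: path_ev_measurable dB.
Qed.

Lemma total_prob x n (E : set Omega) : measurable E ->
  P x E = \esum_(y in [set: S]) P x (E `&` [set w | X n w = y]).
Proof.
move=> mE; rewrite -prob_bigcup_count.
- rewrite -setI_bigcupr (_ : \bigcup_(_ in _) _ = setT) ?setIT//.
  by apply/seteqP; split => // w _; exists (X n w).
- by move=> y _; apply: measurableI => //; exact: state_measurable.
- by move=> y y' _ _ [w [[_ /= <-] [_ /= <-]]].
Qed.

End MarkovPaths.

(** * Weighted words *)

Section WordSums.
Context {R : realType} {S : Type} {C : countType}.
Variables (k : S -> C -> R) (next : S -> C -> S).
Hypothesis k_ge0 : forall s c, 0 <= k s c.
Local Open Scope ereal_scope.

(* Integral of Phi over the words of length n read by the automaton from s. *)
Fixpoint word_sum (n : nat) (s : S) (Phi : seq C -> \bar R) : \bar R :=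
  if n is n'.+1 then
    \esum_(c in [set: C])
      ((k s c)%:E * word_sum n' (next s c) (fun t => Phi (c :: t)))
  else Phi [::].

Fixpoint word_weight (s : S) (t : seq C) : R :=
  if t is c :: t' then (k s c * word_weight (next s c) t')%R else 1%R.

Lemma word_weight_ge0 s t : (0 <= word_weight s t)%R.
Proof. by elim: t s => [|c t IH] s //=; rewrite mulr_ge0. Qed.

Lemma word_weight_cat s t u :
  word_weight s (t ++ u) = (word_weight s t * word_weight (foldl next s t) u)%R.
Proof. by elim: t s => [|c t IH] s /=; rewrite ?mul1r// IH mulrA. Qed.

Lemma le_word_sum n s Phi Psi :
  (forall t, size t = n -> Phi t <= Psi t) -> word_sum n s Phi <= word_sum n s Psi.
Proof.
elim: n s Phi Psi => [|n IH] s Phi Psi H /=; first exact: H.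
apply: le_esum => c _; apply: lee_wpmul2l; first by rewrite lee_fin.
by apply: IH => t tn; apply: H; rewrite /= tn.
Qed.

Lemma eq_word_sum n s Phi Psi :
  (forall t, size t = n -> Phi t = Psi t) -> word_sum n s Phi = word_sum n s Psi.
Proof. by move=> H; apply/eqP; rewrite eq_le !le_word_sum// => t /H ->. Qed.

Lemma word_sum_ge0 n s Phi : (forall t, 0 <= Phi t) -> 0 <= word_sum n s Phi.
Proof.
elim: n s Phi => [|n IH] s Phi H //=; apply: esum_ge0 => c _.
by rewrite mule_ge0 ?lee_fin// IH.
Qed.

Lemma word_sumD n s Phi Psi : (forall t, 0 <= Phi t) -> (forall t, 0 <= Psi t) ->
  word_sum n s (fun t => Phi t + Psi t) = word_sum n s Phi + word_sum n s Psi.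
Proof.
elim: n s Phi Psi => [|n IH] s Phi Psi H1 H2 //=.
rewrite -esumD.
- by apply: eq_esum => c _; rewrite IH// ge0_muleDr// word_sum_ge0.
- by move=> c _; rewrite mule_ge0 ?lee_fin ?word_sum_ge0.
- by move=> c _; rewrite mule_ge0 ?lee_fin ?word_sum_ge0.
Qed.

Lemma word_sumZ n s (a : R) Phi : (0 <= a)%R -> (forall t, 0 <= Phi t) ->
  word_sum n s (fun t => a%:E * Phi t) = a%:E * word_sum n s Phi.
Proof.
move=> a0; elim: n s Phi => [|n IH] s Phi H //=.
rewrite -esumZl//.
  by apply: eq_esum => c _; rewrite IH// muleCA.
by move=> c _; rewrite mule_ge0 ?lee_fin ?word_sum_ge0.
Qed.

Section UnionBound.
Context {d : measure_display} {Omega : measurableType d}.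
Variables (Q : probability Omega R) (D : seq C -> set Omega).
Variables (p0 : R) (s0 : S) (h : S -> R).
Hypotheses (mD : forall t, measurable (D t)) (p0_ge0 : (0 <= p0)%R)
  (h_ge0 : forall s, (0 <= h s)%R).
Hypothesis QD : forall t,
  Q (D t) <= (p0 * word_weight s0 t * h (foldl next s0 t))%:E.

Definition word_event (n : nat) (pre : seq C) (B : set (seq C)) : set Omega :=
  \bigcup_(t in [set t | size t = n /\ B t]) D (pre ++ t).

Lemma word_event_measurable n pre B : measurable (word_event n pre B).
Proof. by apply: bigcup_count_measurable => t _; exact: mD. Qed.

(** Union bound one letter at a time: words are split by their first letter, which then joins the
    prefix. The events [D] may overlap, and only the upper bound on them is used; the terminal
    factor [h] is summed at the end. *)
Lemma word_event_le n pre B :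
  Q (word_event n pre B) <=
  (p0 * word_weight s0 pre)%:E *
    word_sum n (foldl next s0 pre)
      (fun t => if t \in B then (h (foldl next (foldl next s0 pre) t))%:E else 0).
Proof.
elim: n pre B => [|n IH] pre B.
  rewrite /word_event /=; case: ifPn => [/set_mem B0|/negP B0].
    apply: (le_trans _ (QD pre)); apply: prob_le => //.
      exact: (word_event_measurable 0 pre B).
    by move=> w [t [/size0nil -> _]]; rewrite cats0.
  rewrite mule0 (_ : \bigcup_(_ in _) _ = set0) ?measure0//.
  apply/seteqP; split => // w [t [/size0nil -> B0']]; exfalso; apply: B0.
  exact: mem_set.
have -> : word_event n.+1 pre B =
    \bigcup_(c in [set: C]) word_event n (rcons pre c) [set t | B (c :: t)].
  apply/seteqP; split => [w [[|c t] [//= [tn] Bt] wD]|w [c _ [t [tn /= Bt]]]].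
    by exists c => //; exists t => //; rewrite cat_rcons.
  by rewrite cat_rcons => wD; exists (c :: t) => //=; rewrite tn.
apply: le_trans (prob_bigcup_count_le _ _) _.
  by move=> c _; exact: word_event_measurable.
rewrite /= -esumZl; last 2 first.
- by rewrite mulr_ge0// word_weight_ge0.
- move=> c _; rewrite mule_ge0 ?lee_fin//; apply: word_sum_ge0 => t.
  by case: ifP; rewrite ?lee_fin.
apply: le_esum => c _; apply: le_trans (IH _ _) _.
rewrite muleA -EFinM -cats1 word_weight_cat/= mulr1 foldl_cat/= -!mulrA.
apply: lee_wpmul2l; first by rewrite lee_fin !mulr_ge0 ?word_weight_ge0.
by apply: le_word_sum => t _; rewrite (_ : (t \in _) = (c :: t \in B)).
Qed.

End UnionBound.
End WordSums.

(** * Exponential and maximal inequalities for product weights of mass one *)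

Section IidWords.
Context {R : realType} {C : countType}.
Variable (w : C -> R).
Hypotheses (w_ge0 : forall c, 0 <= w c)
  (w_sum1 : (\esum_(c in [set: C]) (w c)%:E = 1)%E).
Local Open Scope ereal_scope.

(** The automaton with a single state turns [word_sum] into integration against the product of
    copies of w. *)
Let nx (_ : unit) (_ : C) : unit := tt.
Let k (_ : unit) : C -> R := w.
Let k_ge0 s c : (0 <= k s c)%R. Proof. exact: w_ge0. Qed.
Local Notation E n Phi := (word_sum k nx n tt Phi).
Let w_ge0E c : [set: C] c -> 0 <= (w c)%:E. Proof. by rewrite lee_fin. Qed.
Local Hint Resolve w_ge0E : core.

Lemma iid_cst n (a : \bar R) : 0 <= a -> a < +oo -> E n (fun=> a) = a.
Proof.
move=> a0 aoo; elim: n => [//|n IH] /=.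
transitivity (\esum_(c in [set: C]) ((fine a)%:E * (w c)%:E)).
  by apply: eq_esum => c _; rewrite -[nx tt c]/tt IH fineK ?ge0_fin_numE// muleC.
by rewrite esumZl ?fine_ge0// w_sum1 mule1 fineK ?ge0_fin_numE.
Qed.

(** Peels off the last letter, whereas [word_sum] recurses on the first; this is what monotonicity
    in the length requires. *)
Lemma iid_snoc n (Phi : seq C -> \bar R) :
  E n.+1 Phi = E n (fun s => \esum_(c in [set: C]) ((w c)%:E * Phi (rcons s c))).
Proof.
elim: n Phi => [//|n IH] Phi.
rewrite [LHS]/= [RHS]/=; apply: eq_esum => c _; congr (_ * _).
exact: (IH (fun t => Phi (c :: t))).
Qed.

Lemma iid_prod n (g : C -> R) (m : R) : (forall c, 0 <= g c)%R ->
  \esum_(c in [set: C]) (w c * g c)%:E <= m%:E ->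
  E n (fun s => (\prod_(c <- s) g c)%:E) <= (m ^+ n)%:E.
Proof.
move=> g0 gm.
have m0 : (0 <= m)%R.
  rewrite -lee_fin; apply: le_trans gm; apply: esum_ge0 => c _.
  by rewrite lee_fin mulr_ge0.
have P0 s : (0 <= \prod_(c <- s) g c)%R by exact: prodr_ge0.
elim: n => [|n IH] /=; first by rewrite big_nil expr0.
apply: (@le_trans _ _ (\esum_(c in [set: C]) ((m ^+ n)%:E * (w c * g c)%:E))).
  apply: le_esum => c _.
  rewrite (@eq_word_sum _ _ _ k nx k_ge0 n tt _
             (fun s => (g c)%:E * (\prod_(c <- s) g c)%:E)); last first.
    by move=> t _; rewrite big_cons EFinM.
  rewrite word_sumZ//.
  by rewrite muleA -EFinM muleC lee_wpmul2r ?lee_fin ?mulr_ge0.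
rewrite esumZl ?exprn_ge0//; last by move=> c _; rewrite lee_fin mulr_ge0.
by rewrite exprSr EFinM lee_wpmul2l// lee_fin exprn_ge0.
Qed.

Definition word_avg_gt (f : C -> R) (a : R) : set (seq C) :=
  [set s | (a *+ size s < \sum_(c <- s) f c)%R].

(** Inverting exp(-x) >= 1 - x gives 1/(1 - x), which lies below the quadratic on [0, 1/2]. *)
Lemma expR_le_quad (x : R) : (0 <= x <= 2^-1 -> expR x <= 1 + x + 2 * x ^+ 2)%R.
Proof.
move=> /andP[x0 xh].
have h1 : (1 - x <= expR (- x))%R by exact: expR_ge1Dx.
have p1 : (0 < 1 - x)%R by lra.
have : (expR x <= (1 - x)^-1)%R.
  by rewrite -[x in leLHS]opprK expRN lef_pV2// posrE// expR_gt0.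
move/le_trans; apply; rewrite -[leLHS]mul1r ler_pdivrMr//.
by nra.
Qed.

(** Markov's inequality for the exponential moment: exp(t f) has mean at most 1 + t m + 2 t^2 B^2,
    which for small t is less than 1 + t (m + e) <= exp(t (m + e)). *)
Lemma chernoff (f : C -> R) (B m e : R) :
  (forall c, 0 <= f c <= B)%R -> (0 < B)%R -> (0 < e)%R ->
  \esum_(c in [set: C]) (w c * f c)%:E <= m%:E ->
  exists2 g : R, (0 <= g < 1)%R & forall n,
    E n (fun s => if s \in word_avg_gt f (m + e) then 1 else 0) <= (g ^+ n)%:E.
Proof.
move=> fB B0 e0 fm.
have m0 : (0 <= m)%R.
  rewrite -lee_fin; apply: le_trans fm; apply: esum_ge0 => c _.
  by have /andP[? ?] := fB c; rewrite lee_fin mulr_ge0.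
(* Chosen so that t B <= 1/2, which allows the quadratic bound, and 2 t B^2 < e, which makes the
   ratio M / K smaller than 1. *)
pose t := (e / (4 * B ^+ 2 + 2 * B * e))%R.
have den0 : (0 < 4 * B ^+ 2 + 2 * B * e)%R by nra.
have t0 : (0 < t)%R by rewrite divr_gt0.
have tB : (t * B <= 2^-1)%R.
  by rewrite /t mulrAC ler_pdivrMr//; nra.
have tB2 : (2 * t * B ^+ 2 < e)%R.
  rewrite /t mulrA mulrAC ltr_pdivrMr//; nra.
pose M := (1 + t * m + 2 * t ^+ 2 * B ^+ 2)%R.
pose K := expR (t * (m + e)).
have K0 : (0 < K)%R by exact: expR_gt0.
have M0 : (0 < M)%R by rewrite /M; nra.
exists (M / K)%R.
  rewrite divr_ge0 ?ltW//= ltr_pdivrMr// mul1r.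
  by apply: lt_le_trans (expR_ge1Dx _); rewrite /M; nra.
move=> n.
have gm : \esum_(c in [set: C]) (w c * expR (t * f c))%:E <= M%:E.
  apply: (@le_trans _ _ (\esum_(c in [set: C])
    ((1 + 2 * t ^+ 2 * B ^+ 2)%:E * (w c)%:E + t%:E * (w c * f c)%:E))).
    apply: le_esum => c _; rewrite -!EFinM -EFinD lee_fin.
    have /andP[f0 fcB] := fB c.
    have h : (expR (t * f c) <= 1 + t * f c + 2 * (t * f c) ^+ 2)%R.
      apply: expR_le_quad; apply/andP; split; first by rewrite mulr_ge0// ltW.
      by apply: le_trans tB; rewrite ler_pM2l.
    have h2 : ((t * f c) ^+ 2 <= t ^+ 2 * B ^+ 2)%R.
      by rewrite exprMn ler_pM2l ?exprn_gt0// lerXn2r ?nnegrE// (le_trans f0).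
    apply: le_trans (ler_wpM2l (w_ge0 c) h) _.
    have := ler_wpM2l (w_ge0 c) h2.
    by move=> ?; lra.
  rewrite esumD; first last.
  - move=> c _; have /andP[? _] := fB c; rewrite -EFinM lee_fin.
    by apply: mulr_ge0; [exact: ltW|exact: mulr_ge0].
  - by move=> c _; rewrite -EFinM lee_fin mulr_ge0//; nra.
  rewrite (esumZl (ltW t0)) ?esumZl//; first last.
  - by move=> c _; rewrite lee_fin mulr_ge0//; have /andP[] := fB c.
  - by nra.
  rewrite w_sum1 mule1.
  apply: (@le_trans _ _ ((1 + 2 * t ^+ 2 * B ^+ 2)%:E + t%:E * m%:E)).
    by rewrite leeD2l// lee_wpmul2l// lee_fin ltW.
  by rewrite -EFinM -EFinD lee_fin /M; nra.
have := @iid_prod n (fun c => expR (t * f c)) M (fun c => expR_ge0 _) gm.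
rewrite expr_div_n => H.
apply: (@le_trans _ _ ((K ^- n)%:E * (M ^+ n)%:E)); last by rewrite -EFinM mulrC.
apply: (@le_trans _ _ ((K ^- n)%:E *
   E n (fun s => (\prod_(c <- s) expR (t * f c))%:E))); last first.
  by rewrite lee_wpmul2l// lee_fin invr_ge0 exprn_ge0// ltW.
rewrite -word_sumZ//; last 2 first.
- by rewrite invr_ge0 exprn_ge0// ltW.
- by move=> s; rewrite lee_fin prodr_ge0// => c _; exact: expR_ge0.
apply: le_word_sum => // s sn; case: ifPn => [/set_mem|_]; last first.
  rewrite -EFinM lee_fin; apply: mulr_ge0.
    by rewrite invr_ge0 exprn_ge0// ltW.
  by rewrite prodr_ge0// => c _; exact: expR_ge0.
rewrite /word_avg_gt/= sn -EFinM lee_fin => Hs.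
rewrite mulrC ler_pdivlMr ?exprn_gt0// mul1r.
rewrite (_ : (\prod_(c <- s) expR (t * f c))%R = expR (t * \sum_(c <- s) f c)); last first.
  by rewrite mulr_sumr expR_sum.
rewrite /K -expRM_natl ler_expR mulrCA ler_pM2l// mulr_natl.
exact: ltW.
Qed.

(** Maximum over all prefixes, the empty one included, of the sum of f - a. The recursion from the
    front makes the identity with the shifted word definitional. *)
Fixpoint max_excess (f : C -> R) (a : R) (s : seq C) : R :=
  if s is c :: s' then Num.max 0%R (f c - a + max_excess f a s')%R else 0%R.

Lemma max_excess_ge0 f a s : (0 <= max_excess f a s)%R.
Proof. by case: s => //= c s; rewrite le_max lexx. Qed.

Lemma max_excess_rcons f a s c : (max_excess f a s <= max_excess f a (rcons s c))%R.
Proof.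
elim: s => [|b s IH] /=; first by rewrite le_max lexx.
by rewrite le_max2// lerD2l.
Qed.

Lemma max_excess_sum f a s : (\sum_(c <- s) f c - a *+ size s <= max_excess f a s)%R.
Proof.
elim: s => [|c s IH] /=; first by rewrite big_nil mulr0n subr0.
rewrite big_cons mulrS le_max; apply/orP; right.
by move: IH; lra.
Qed.

(* Garsia's proof of the maximal inequality: on {M_{n+1} > 0} one has
   M_{n+1} = f - a + M_n o shift, and M_n <= M_{n+1}. *)
Lemma garsia n (f : C -> R) (a m : R) : (forall c, 0 <= f c)%R ->
  (0 < a)%R -> \esum_(c in [set: C]) (w c * f c)%:E <= m%:E ->
  E n (fun s => if (0 < max_excess f a s)%R then 1 else 0) <= (m / a)%:E.
Proof.
move=> f0 a0 fm.
have m0 : (0 <= m)%R.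
  rewrite -lee_fin; apply: le_trans fm; apply: esum_ge0 => c _.
  by rewrite lee_fin mulr_ge0.
pose V n := E n (fun s => (max_excess f a s)%:E).
pose b n := E n (fun s => if (0 < max_excess f a s)%R then 1 else 0).
have V0 j : 0 <= V j by apply: word_sum_ge0 => // t; rewrite lee_fin max_excess_ge0.
have b0 j : 0 <= b j by apply: word_sum_ge0 => // t; case: ifP.
have step j : V j.+1 + a%:E * b j.+1 <= m%:E + V j.
  rewrite -(@word_sumZ _ _ _ k nx k_ge0 _ _ _ _ (ltW a0)); last by move=> t; case: ifP.
  rewrite -word_sumD//; last 2 first.
  - by move=> t; rewrite lee_fin max_excess_ge0.
  - by move=> t; apply: mule_ge0; [rewrite lee_fin ltW|case: ifP].
  apply: (@le_trans _ _ (\esum_(c in [set: C]) ((w c * f c)%:E + V j * (w c)%:E))).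
    rewrite /=; apply: le_esum => c _.
    apply: (@le_trans _ _ ((w c)%:E * ((f c)%:E + V j))).
      apply: lee_wpmul2l; first by rewrite lee_fin.
      rewrite -{1}(@iid_cst j (f c)%:E) ?lee_fin ?ltry//.
      rewrite -word_sumD//; last 2 first.
      - by move=> t; rewrite lee_fin f0.
      - by move=> t; rewrite lee_fin max_excess_ge0.
      apply: le_word_sum => // t _.
      rewrite -EFinD; case: ifPn => H; rewrite ?mule1 ?mule0 -EFinD lee_fin.
        move: H; rewrite lt_max ltxx/= => H.
        by rewrite max_r; [lra|exact: ltW].
      rewrite addr0; move: H; rewrite lt_max ltxx/= -leNgt => H.
      by rewrite max_l// addr_ge0// max_excess_ge0.
    rewrite ge0_muleDr ?lee_fin//.
    by rewrite -EFinM [V j * _]muleC.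
  have [Vy|Vy] := eqVneq (V j) +oo; first by rewrite Vy addey ?leey.
  rewrite esumD; last 2 first.
  - by move=> c _; rewrite lee_fin mulr_ge0.
  - by move=> c _; rewrite mule_ge0 ?lee_fin.
  have Vf : V j \is a fin_num by rewrite ge0_fin_numE// ltey.
  rewrite -(fineK Vf) esumZl ?fine_ge0// w_sum1 mule1.
  by rewrite leeD2r.
(* A letter added at the end can only raise the maximum, and that letter has total mass one. *)
have mono j : V j <= V j.+1.
  rewrite /V iid_snoc; apply: le_word_sum => // s _.
  apply: (@le_trans _ _ (\esum_(c in [set: C]) ((max_excess f a s)%:E * (w c)%:E))).
    by rewrite esumZl ?max_excess_ge0// w_sum1 mule1.
  apply: le_esum => c _; rewrite muleC lee_wpmul2l ?lee_fin//.
  exact: max_excess_rcons.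
(* Finiteness is what allows V to be cancelled from the inequality [step]. *)
have Vfin j : V j < +oo.
  elim: j => [|j IH]; first by rewrite /V/= ltry.
  apply: (@le_lt_trans _ _ (m%:E + V j)); last by rewrite lte_add_pinfty ?ltry.
  by apply: le_trans (step j); rewrite leeDl// mule_ge0// lee_fin ltW.
case: n => [|n].
  by rewrite /= ltxx lee_fin divr_ge0// ltW.
have : a%:E * b n.+1 <= m%:E.
  have fV : V n.+1 \is a fin_num by rewrite ge0_fin_numE.
  by rewrite -(leeD2lE _ _ fV); apply: le_trans (step n) _; rewrite addeC leeD2r.
move=> H.
apply: (@le_trans _ _ ((a^-1)%:E * (a%:E * b n.+1))).
  by rewrite muleA -EFinM mulVf ?gt_eqF// mul1e.
by rewrite mulrC EFinM lee_wpmul2l// lee_fin invr_ge0 ltW.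
Qed.

End IidWords.

(** * A strong law for events indexed by words *)

Lemma nneseries_le_bound (R : realType) (u : nat -> \bar R) (M : \bar R) :
  (forall n, 0 <= u n)%E -> (forall N, \sum_(0 <= n < N) u n <= M)%E ->
  (\sum_(n <oo) u n <= M)%E.
Proof.
move=> u0 uM; apply: lime_le; first by apply: is_cvg_nneseries => n _ _.
exact: nearW.
Qed.

Lemma geometric_partial_le (R : realType) (g : R) (N : nat) : 0 <= g < 1 ->
  \sum_(0 <= n < N) g ^+ n <= (1 - g)^-1.
Proof.
move=> /andP[g0 g1].
have g1' : 0 < 1 - g by rewrite subr_gt0.
suff : \sum_(0 <= n < N) g ^+ n = (1 - g ^+ N) / (1 - g).
  by move=> ->; rewrite ler_pdivrMr// mulVf ?gt_eqF// gerBl exprn_ge0.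
elim: N => [|N IH]; first by rewrite big_geq// expr0 subrr mul0r.
by rewrite big_nat_recr//= IH exprS; field; rewrite gt_eqF.
Qed.

Lemma esum_tail (R : realType) (I : choiceType) (a : I -> \bar R) (e : R) :
  (forall i, 0 <= a i)%E -> (\esum_(i in [set: I]) a i < +oo)%E -> 0 < e ->
  exists2 X : set I, finite_set X & (\esum_(i in ~` X) a i <= e%:E)%E.
Proof.
move=> a0 afin e0.
have fS : \esum_(i in [set: I]) a i \is a fin_num.
  by rewrite ge0_fin_numE// esum_ge0.
have [_ [X [finX _] <-] HX] := ub_ereal_sup_adherent e0 fS.
exists X => //.
have := esumID X setT a (fun i _ => a0 i); rewrite !setTI => EX.
have fX : \esum_(i in X) a i \is a fin_num.
  rewrite ge0_fin_numE ?esum_ge0//; apply: le_lt_trans afin.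
  by rewrite EX leeDl// esum_ge0.
have fXC : \esum_(i in ~` X) a i \is a fin_num.
  rewrite ge0_fin_numE ?esum_ge0//; apply: le_lt_trans afin.
  by rewrite EX leeDr// esum_ge0.
move: HX; rewrite -(esum_fset finX)// -/(esum _ _) EX.
move: fX fXC; move: (esum X a) (esum (~` X) a) => [x| |] [y| |]//= _ _.
rewrite lte_fin lee_fin; lra.
Qed.

Section NegligibleSets.
Context {d : measure_display} {Omega : measurableType d} {R : realType}.
Variable (Q : probability Omega R).

(** The truncation in the strong law leaves an exceptional set of small but positive measure; this
    lets the error go to zero afterwards. *)
Lemma negligible_eps (A : set Omega) :
  (forall k : nat, exists M, [/\ measurable M, A `<=` M &
     (Q M <= (k.+1%:R^-1)%:E)%E]) -> Q.-negligible A.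
Proof.
move=> H; have [M HM] := choice H.
have mB : measurable (\bigcap_k M k).
  by apply: bigcapT_measurable => k; have [] := HM k.
exists (\bigcap_k M k); split => //; last first.
  by move=> w Aw k _; have [_ + _] := HM k; apply.
apply/eqP; rewrite -measure_le0; apply/lee_addgt0Pr => e e0; rewrite add0e.
have [k ke] : exists k : nat, (k.+1%:R)^-1 < e.
  by have [k _ /(_ k (leqnn k))] := near_infty_natSinv_lt (PosNum e0); exists k.
have [mM _ QM] := HM k.
apply: (@le_trans _ _ (Q (M k))).
  by apply: prob_le => // w; apply.
by apply: le_trans QM _; rewrite lee_fin ltW.
Qed.

Lemma negligible_bigcup_count (C : countType) (A : set C) (F : C -> set Omega) :
  (forall c, A c -> Q.-negligible (F c)) -> Q.-negligible (\bigcup_(c in A) F c).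
Proof.
move=> nF.
pose G n := if pickle_inv n is Some c then if c \in A then F c else set0 else set0.
apply: (@negligibleS _ _ _ _ (\bigcup_n G n)).
  move=> x [c Ac Fx]; exists (pickle c) => //.
  by rewrite /G pickleK_inv mem_set.
apply: negligible_bigcup => n; rewrite /G.
case: pickle_inv => [c|]; last exact: negligible_set0.
by case: ifP => [/set_mem/nF//|_]; exact: negligible_set0.
Qed.

End NegligibleSets.

(** Unordered sums are taken of nonnegative terms, so the mean is formed separately on the positive
    and the negative part of f. *)
Definition word_mean (R : realType) (C : countType) (w f : C -> R) : R :=
  fine (\esum_(c in [set: C]) (w c * ((`|f c| + f c) / 2))%:E)%E -
  fine (\esum_(c in [set: C]) (w c * ((`|f c| - f c) / 2))%:E)%E.

Section TreeSLLN.
Context {d : measure_display} {Omega : measurableType d} {R : realType}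
  {C : countType}.
Variables (Q : probability Omega R) (w : C -> R) (D : seq C -> set Omega) (p0 : R).
Hypotheses (w_ge0 : forall c, 0 <= w c) (p0_ge0 : 0 <= p0).
Hypothesis w_sum1 : (\esum_(c in [set: C]) (w c)%:E = 1)%E.
Hypothesis mD : forall t, measurable (D t).
Hypothesis QD : forall t, (Q (D t) <= (p0 * \prod_(c <- t) w c)%:E)%E.

(** A point may follow no infinite word, one or several; the statements below hold for all the words
    that it follows. *)
Definition branch (x : Omega) (c : nat -> C) := forall n, D (mkseq c n) x.

Let nx (_ : unit) (_ : C) : unit := tt.
Let k (_ : unit) : C -> R := w.
Let k_ge0 s c : 0 <= k s c. Proof. exact: w_ge0. Qed.
Local Notation E n Phi := (word_sum k nx n tt Phi).

Let ev n B := word_event D n [::] B.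

Let ev_le n B :
  (Q (ev n B) <= p0%:E * E n (fun t => if t \in B then 1 else 0))%E.
Proof.
have wt t : word_weight k nx tt t = \prod_(c <- t) w c.
  by elim: t => [|c t IH]; rewrite ?big_nil ?big_cons//= IH.
have := @word_event_le _ _ _ k nx k_ge0 _ _ Q D p0 tt (fun=> 1) mD p0_ge0 (fun=> ler01).
move=> /(_ _ n [::] B); rewrite /= mulr1; apply => t.
by rewrite wt mulr1.
Qed.

Let mev n B : measurable (ev n B).
Proof. exact: word_event_measurable. Qed.

Lemma ev_branch x c n (B : set (seq C)) : branch x c -> B (mkseq c n) -> ev n B x.
Proof. by move=> bc Bc; exists (mkseq c n) => //=; rewrite size_mkseq. Qed.

Definition avg_le (f : C -> R) (a : R) (x : Omega) := forall c, branch x c ->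
  exists n0, forall n, (n0 <= n)%N -> ~ word_avg_gt f a (mkseq c n).

(** The Chernoff bounds for words of length n are summable in n, so Borel-Cantelli applies. *)
Lemma bounded_upper (f : C -> R) (B m e : R) :
  (forall c, 0 <= f c <= B) -> 0 < B -> 0 < e ->
  (\esum_(c in [set: C]) (w c * f c)%:E <= m%:E)%E ->
  Q.-negligible [set x | ~ avg_le f (m + e) x].
Proof.
move=> fB B0 e0 fm.
have [g g01 Hg] := chernoff w_ge0 w_sum1 fB B0 e0 fm.
pose F n := ev n (word_avg_gt f (m + e)).
exists (lim_sup_set F); split.
- apply: bigcapT_measurable => i; apply: bigcup_measurable => j _; exact: mev.
- apply: lim_sup_set_cvg0 => [j|]; first exact: mev.
  apply: (@le_lt_trans _ _ (p0 * (1 - g)^-1)%:E); last by rewrite ltry.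
  apply: nneseries_le_bound => // N.
  apply: (@le_trans _ _ (\sum_(0 <= n < N) (p0 * g ^+ n)%:E)%E).
    apply: lee_sum => n _; apply: le_trans (ev_le _ _) _.
    by rewrite EFinM lee_wpmul2l.
  by rewrite sumEFin lee_fin -mulr_sumr ler_wpM2l// geometric_partial_le.
- move=> x /= H n _.
  apply: contrapT => Hn; apply: H => c bc; exists n => j nj Hj.
  by apply: Hn; exists j => //; exact: ev_branch bc Hj.
Qed.

(** Handles an unbounded remainder of small mean, for which no exponential bound is available: the
    maximal inequality controls all lengths at once. *)
Lemma small_upper (f : C -> R) (a m : R) : (forall c, 0 <= f c) -> 0 < a ->
  (\esum_(c in [set: C]) (w c * f c)%:E <= m%:E)%E ->
  exists M, [/\ measurable M, (Q M <= (p0 * (m / a))%:E)%E &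
   [set x | exists c, branch x c /\ exists n, word_avg_gt f a (mkseq c n)] `<=` M].
Proof.
move=> f0 a0 fm.
pose B : set (seq C) := [set s | 0 < max_excess f a s].
(* [D] is not assumed monotone in the word, so the events [ev j B] may fail to increase. Their
   intersections from n on do increase, and each is bounded by a single Garsia inequality. *)
pose G n := \bigcap_(j in [set j | (n <= j)%N]) ev j B.
have mG n : measurable (G n) by apply: bigcap_measurableType => j _; exact: mev.
have QG n : (Q (G n) <= (p0 * (m / a))%:E)%E.
  apply: (@le_trans _ _ (Q (ev n B))).
    by apply: prob_le => // x; apply => /=.
  apply: le_trans (ev_le _ _) _; rewrite EFinM lee_wpmul2l//.
  apply: le_trans (garsia w_ge0 w_sum1 n f0 a0 fm).
  by apply: le_word_sum => // t _; case: ifP => [/set_mem /= ->//|_]; case: ifP.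
exists (\bigcup_n G n); split.
- exact: bigcupT_measurable.
- have ndG : nondecreasing_seq G.
    move=> n n' nn'; apply/subsetPset => x Gx j /= n'j; apply: Gx => /=.
    exact: leq_trans n'j.
  have cG := @nondecreasing_cvg_mu _ _ _ Q G mG (bigcupT_measurable G mG) ndG.
  rewrite -(cvg_lim _ cG)//; apply: lime_le; first by apply/cvg_ex; eexists; exact: cG.
  exact: nearW.
- move=> x [c [bc [n cn]]]; exists n => // j /= nj; apply: (ev_branch bc).
  rewrite /B/=.
  have := max_excess_sum f a (mkseq c n); move: cn; rewrite /word_avg_gt/= => h1 h2.
  have pn : 0 < max_excess f a (mkseq c n) by lra.
  (* Once positive, the maximal excess stays positive for all longer prefixes. *)
  rewrite -(subnKC nj); elim: (j - n)%N => [|i IH]; first by rewrite addn0.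
  by rewrite addnS mkseqS; exact: lt_le_trans IH (max_excess_rcons _ _ _ _).
Qed.

Let trunc (X : set C) (f : C -> R) c : R := if c \in X then f c else 0.

Lemma trunc_bound (X : set C) (f : C -> R) : finite_set X -> (forall c, 0 <= f c) ->
  exists2 B, 0 < B & forall c, 0 <= trunc X f c <= B.
Proof.
move=> finX f0.
exists (1 + \sum_(c <- finmap.enum_fset (fset_set X)) f c).
  by rewrite ltr_pwDl// sumr_ge0.
move=> c; rewrite /trunc; case: ifPn => [cX|_]; last first.
  by rewrite lexx/= addr_ge0// sumr_ge0.
rewrite f0/= (big_rem c)/=; last by rewrite in_fset_set.
by rewrite addrCA lerDl addr_ge0// sumr_ge0.
Qed.

Lemma esum_trunc_tail (X : set C) (f : C -> R) (m e : R) : (forall c, 0 <= f c) ->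
  (\esum_(c in ~` X) (w c * f c)%:E <= e%:E)%E ->
  (\esum_(c in [set: C]) (w c * trunc (~` X) f c)%:E <= e%:E)%E.
Proof.
move=> f0; rewrite esum_mkcond => h; apply: le_trans h; apply: le_esum => c _.
by rewrite /trunc; case: ifP; rewrite ?mulr0.
Qed.

Lemma truncD (X : set C) (f : C -> R) c : trunc X f c + trunc (~` X) f c = f c.
Proof. by rewrite /trunc in_setC; case: ifP; rewrite ?addr0 ?add0r. Qed.

Lemma word_avg_gtD (f f1 f2 : C -> R) a1 a2 s : (forall c, f1 c + f2 c = f c) ->
  word_avg_gt f (a1 + a2) s -> ~ word_avg_gt f1 a1 s -> word_avg_gt f2 a2 s.
Proof.
move=> fE; rewrite /word_avg_gt/= => h1 h2.
have e : \sum_(c <- s) f c = \sum_(c <- s) f1 c + \sum_(c <- s) f2 c.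
  by rewrite -big_split/=; apply: eq_bigr => c _.
move: h1; rewrite e mulrnDl => h1; move/negP: h2; rewrite -leNgt => h2.
lra.
Qed.

(** Restriction to finitely many letters leaves a bounded function for Chernoff and a remainder of
    mean at most [del] for the maximal inequality. *)
Lemma upper_slln (f : C -> R) (m e : R) : (forall c, 0 <= f c) -> 0 < e ->
  (\esum_(c in [set: C]) (w c * f c)%:E <= m%:E)%E ->
  Q.-negligible [set x | ~ avg_le f (m + e) x].
Proof.
move=> f0 e0 fm; apply: negligible_eps => j.
have e2 : 0 < e / 2 by rewrite divr_gt0.
(* At the level e / 2 the exceptional set has measure at most p0 del / (e / 2), which is below 1 /
   (j + 1); adding 1 to p0 keeps the denominator positive. *)
pose del := (j.+1%:R^-1 * (e / 2)) / (p0 + 1).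
have del0 : 0 < del.
  by apply: divr_gt0; [apply: mulr_gt0 => //; rewrite invr_gt0|exact: ltr_wpDl].
have wf0 c : (0 <= (w c * f c)%:E)%E by rewrite lee_fin mulr_ge0.
have [X finX HX] := esum_tail wf0 (le_lt_trans fm (ltry _)) del0.
have [B B0 fB] := trunc_bound finX f0.
have f1m : (\esum_(c in [set: C]) (w c * trunc X f c)%:E <= m%:E)%E.
  apply: le_trans fm; apply: le_esum => c _; rewrite lee_fin ler_wpM2l//.
  by rewrite /trunc; case: ifP.
have [N [mN QN HN]] := bounded_upper fB B0 e2 f1m.
have f20 c : 0 <= trunc (~` X) f c by rewrite /trunc; case: ifP.
have [M [mM QM HM]] := small_upper f20 e2 (esum_trunc_tail del f0 HX).
exists (N `|` M); split.
- exact: measurableU.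
- move=> x /= nx0; rewrite -implyNp => Nx; apply: HM.
  apply: contrapT => HM'; apply: nx0 => c bc.
  have : avg_le (trunc X f) (m + e / 2) x by apply: contrapT => /HN.
  move=> /(_ c bc) [n0 Hn0]; exists n0 => n nn0 Hn; apply: HM'; exists c; split => //.
  exists n; apply: (word_avg_gtD (truncD X f) _ (Hn0 n nn0)).
  by rewrite -addrA -splitr.
- have QU : (Q (N `|` M) <= Q N + Q M)%E := measureU2 Q mN mM.
  apply: le_trans QU _; rewrite QN add0e; apply: le_trans QM _.
  rewrite lee_fin /del.
  rewrite (_ : _ / (e / 2) = j.+1%:R^-1 / (p0 + 1)); last first.
    by rewrite mulrAC mulfK// gt_eqF.
  rewrite mulrCA -[leRHS]mulr1 ler_wpM2l ?invr_ge0//.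
  by rewrite ler_pdivrMr ?ltr_wpDl// mul1r lerDl.
Qed.

Definition avg_cvg (f : C -> R) (m : R) (x : Omega) := forall c, branch x c ->
  (n%:R^-1 * \sum_(j < n) f (c j)) @[n --> \oo] --> m.

(** The upper bound is applied to B minus a finite truncation of f, which is nonnegative. Truncation
    only lowers f, and it costs at most e / 2 of the mean. *)
Lemma lower_slln (f : C -> R) (m e : R) : (forall c, 0 <= f c) -> 0 < e ->
  (\esum_(c in [set: C]) (w c * f c)%:E = m%:E)%E ->
  Q.-negligible [set x | ~ avg_le (fun c => - f c) (e - m) x].
Proof.
move=> f0 e0 fm.
have e2 : 0 < e / 2 by rewrite divr_gt0.
have wf0 c : (0 <= (w c * f c)%:E)%E by rewrite lee_fin mulr_ge0.
have [X finX HX] : exists2 X : set C, finite_set X &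
    (\esum_(i in ~` X) (w i * f i)%:E <= (e / 2)%:E)%E.
  by apply: esum_tail; rewrite ?fm ?ltry.
have [B B0 fB] := trunc_bound finX f0.
pose g c := B - trunc X f c.
have g0 c : 0 <= g c by rewrite /g subr_ge0; have /andP[] := fB c.
have gm : (\esum_(c in [set: C]) (w c * g c)%:E <= (B - m + e / 2)%:E)%E.
  have w0 c : [set: C] c -> (0 <= (w c)%:E)%E by rewrite lee_fin.
  have : (\esum_(c in [set: C]) (w c * g c)%:E +
          \esum_(c in [set: C]) (w c * trunc X f c)%:E = B%:E)%E.
    rewrite -esumD; last 2 first.
    - by move=> c _; rewrite lee_fin mulr_ge0.
    - by move=> c _; rewrite lee_fin mulr_ge0//; have /andP[] := fB c.
    rewrite -[RHS]mule1 -w_sum1 -esumZl//; last by rewrite ltW.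
    by apply: eq_esum => c _; rewrite -EFinD -EFinM /g; congr EFin; ring.
  have : (\esum_(c in [set: C]) (w c * trunc X f c)%:E +
          \esum_(c in [set: C]) (w c * trunc (~` X) f c)%:E = m%:E)%E.
    rewrite -esumD -?fm; last 2 first.
    - by move=> c _; rewrite lee_fin mulr_ge0//; have /andP[] := fB c.
    - by move=> c _; rewrite lee_fin mulr_ge0// /trunc; case: ifP.
    by apply: eq_esum => c _; rewrite -EFinD -mulrDr truncD.
  have := esum_trunc_tail (e / 2) f0 HX.
  have p1 : (0 <= \esum_(c in [set: C]) (w c * trunc X f c)%:E)%E.
    by apply: esum_ge0 => c _; rewrite lee_fin mulr_ge0//; have /andP[] := fB c.
  have p2 : (0 <= \esum_(c in [set: C]) (w c * trunc (~` X) f c)%:E)%E.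
    by apply: esum_ge0 => c _; rewrite lee_fin mulr_ge0// /trunc; case: ifP.
  have p3 : (0 <= \esum_(c in [set: C]) (w c * g c)%:E)%E.
    by apply: esum_ge0 => c _; rewrite lee_fin mulr_ge0.
  move: p1 p2 p3.
  set x := esum _ _; set y := esum _ _; set z := esum _ _.
  move: x y z => [x| |] [y| |] [z| |]//=; rewrite -?EFinD ?lee_fin//.
  by move=> _ _ _ h [h2] [h3]; lra.
apply: negligibleS (upper_slln g0 e2 gm) => x /=; apply: contra_not => H c bc.
have [n0 Hn0] := H c bc; exists n0 => n nn0 Hn; apply: (Hn0 n nn0).
move: Hn; rewrite /word_avg_gt/= size_mkseq => Hn.
have h1 : \sum_(c <- mkseq c n) g c = B *+ n - \sum_(c <- mkseq c n) trunc X f c.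
  by rewrite big_split/= sumrN big_const_seq iter_addr_0 count_predT size_mkseq.
have h2 : \sum_(c <- mkseq c n) trunc X f c <= \sum_(c <- mkseq c n) f c.
  by apply: ler_sum => c' _; rewrite /trunc; case: ifP.
move: Hn; rewrite h1 sumrN.
have -> : (B - m + e / 2 + e / 2) *+ n = B *+ n + (e - m) *+ n.
  by rewrite -mulrnDl; congr (_ *+ _); lra.
lra.
Qed.

Lemma slln_ge0 (f : C -> R) (m : R) : (forall c, 0 <= f c) ->
  (\esum_(c in [set: C]) (w c * f c)%:E = m%:E)%E ->
  Q.-negligible [set x | ~ avg_cvg f m x].
Proof.
move=> f0 fm.
pose e (i : nat) : R := i.+1%:R^-1.
have e0 i : 0 < e i by rewrite invr_gt0.
pose U i := [set x | ~ avg_le f (m + e i) x].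
pose L i := [set x | ~ avg_le (fun c => - f c) (e i - m) x].
apply: (@negligibleS _ _ _ _ (\bigcup_i (U i `|` L i))); last first.
  apply: negligible_bigcup => i; apply: negligibleU.
    by apply: upper_slln; rewrite ?fm.
  by apply: lower_slln.
move=> x /= H; apply: contrapT => H'; apply: H => c bc.
have HU i : avg_le f (m + e i) x.
  by apply: contrapT => h; apply: H'; exists i => //; left.
have HL i : avg_le (fun c => - f c) (e i - m) x.
  by apply: contrapT => h; apply: H'; exists i => //; right.
apply/cvgrPdist_le => eps eps0.
have [i ie] : exists i : nat, e i < eps.
  by have [i _ /(_ i (leqnn i))] := near_infty_natSinv_lt (PosNum eps0); exists i.
have [n1 Hn1] := HU i c bc; have [n2 Hn2] := HL i c bc.
near=> n.
have n_gt0 : (0 < n)%N by near: n; exists 1%N.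
have nR : 0 < n%:R :> R by rewrite ltr0n.
have S g : \sum_(x <- mkseq c n) g x = \sum_(j < n) g (c j) :> R.
  by rewrite /mkseq big_map -(big_mkord xpredT (fun j => g (c j))) /index_iota subn0.
have h1 : n%:R^-1 * \sum_(j < n) f (c j) <= m + e i.
  have /negP : ~ word_avg_gt f (m + e i) (mkseq c n).
    by apply: Hn1; near: n; exists n1.
  rewrite /word_avg_gt/= -leNgt size_mkseq S => h.
  by rewrite mulrC ler_pdivrMr// mulr_natr.
have h2 : m - e i <= n%:R^-1 * \sum_(j < n) f (c j).
  have /negP : ~ word_avg_gt (fun c => - f c) (e i - m) (mkseq c n).
    by apply: Hn2; near: n; exists n2.
  rewrite /word_avg_gt/= -leNgt size_mkseq S sumrN => h.
  rewrite mulrC ler_pdivlMr// mulr_natr -lerN2 -mulNrn opprB.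
  exact: h.
rewrite ler_norml; apply/andP; split; lra.
Unshelve. all: by end_near.
Qed.

Lemma slln (f : C -> R) : (\esum_(c in [set: C]) (w c * `|f c|)%:E < +oo)%E ->
  Q.-negligible [set x | ~ avg_cvg f (word_mean w f) x].
Proof.
move=> fin.
have part (g : C -> R) : (forall c, 0 <= g c <= `|f c|) ->
    Q.-negligible [set x | ~ avg_cvg g (fine (\esum_(c in [set: C]) (w c * g c)%:E)%E) x].
  move=> g0; apply: slln_ge0 => [c|]; first by have /andP[] := g0 c.
  rewrite fineK// ge0_fin_numE; last first.
    by apply: esum_ge0 => c _; rewrite lee_fin mulr_ge0//; have /andP[] := g0 c.
  apply: le_lt_trans fin; apply: le_esum => c _.
  by rewrite lee_fin ler_wpM2l//; have /andP[] := g0 c.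
pose fp c := (`|f c| + f c) / 2; pose fn c := (`|f c| - f c) / 2.
have hp c : 0 <= fp c <= `|f c|.
  by rewrite /fp; have := ler_norm (f c); have := ler_norm (- f c); rewrite normrN; lra.
have hn c : 0 <= fn c <= `|f c|.
  by rewrite /fn; have := ler_norm (f c); have := ler_norm (- f c); rewrite normrN; lra.
apply: negligibleS (negligibleU (part fp hp) (part fn hn)) => x /=.
move=> H; rewrite -implyNp => /contrapT Hx Hy; apply: H => c bc.
rewrite (_ : (fun n => _) = (fun n => n%:R^-1 * \sum_(j < n) fp (c j)) \-
    (fun n => n%:R^-1 * \sum_(j < n) fn (c j))).
  exact: cvgB (Hx c bc) (Hy c bc).
apply/funext => n /=.
rewrite -mulrBr -sumrB; congr (_ * _); apply: eq_bigr => j _.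
by rewrite /fp /fn; lra.
Qed.

End TreeSLLN.

Arguments branch {d Omega C} D x c.
Arguments avg_cvg {d Omega R C} D f m x.

(* Only the mass of w matters for existence of the limit: rescaling w to a
   probability keeps the hypothesis on D. *)
Lemma subprob_slln (R : realType) (C : countType) (w f : C -> R) :
  (forall c, 0 <= w c) -> (\esum_(c in [set: C]) (w c)%:E <= 1)%E ->
  (\esum_(c in [set: C]) (w c * `|f c|)%:E < +oo)%E ->
  exists m : R, forall (d : measure_display) (Omega : measurableType d)
    (Q : probability Omega R) (D : seq C -> set Omega) (p0 : R),
  0 <= p0 -> (forall t, measurable (D t)) ->
  (forall t, (Q (D t) <= (p0 * \prod_(c <- t) w c)%:E)%E) ->
  Q.-negligible [set x | ~ avg_cvg D f m x].
Proof.
move=> w0 w1 fin.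
have w0E c : [set: C] c -> (0 <= (w c)%:E)%E by rewrite lee_fin.
pose W := fine (\esum_(c in [set: C]) (w c)%:E).
have WE : (\esum_(c in [set: C]) (w c)%:E = W%:E)%E.
  by rewrite fineK// ge0_fin_numE ?esum_ge0//; apply: le_lt_trans w1 (ltry _).
have W1 : W <= 1 by rewrite -lee_fin -WE.
have W0 : 0 <= W by rewrite -lee_fin -WE esum_ge0.
have [WZ|Wn0] := eqVneq W 0.
  (* All weights vanish, so every one-letter event is null and almost no point has a branch; any
     limit would do. *)
  exists 0 => d Omega Q D p0 p00 mD QD.
  apply: (@negligibleS _ _ _ _ (\bigcup_(c in [set: C]) D [:: c])).
    move=> x /= H; apply: contrapT => H'; apply: H => c bc.
    by exfalso; apply: H'; exists (c 0%N) => //; exact: (bc 1%N).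
  apply: negligible_bigcup_count => c _; apply/negligibleP => //.
  have wc0 : w c = 0.
    apply/eqP; rewrite eq_le w0 andbT -lee_fin -WZ -WE.
    apply: esum_ge; exists [set c]; first by split.
    by rewrite fsbig_set1.
  by apply/eqP; rewrite -measure_le0; apply: le_trans (QD _) _; rewrite big_seq1 wc0 mulr0.
have Wp : 0 < W by rewrite lt_def Wn0.
(* The limit is fixed by w and f before the events are given, so that one value will serve for all
   initial words. *)
exists (word_mean (fun c => w c / W) f) => d Omega Q D p0 p00 mD QD.
apply: (@slln _ _ _ _ Q (fun c => w c / W) D p0) => //.
- by move=> c; rewrite divr_ge0.
- transitivity (\esum_(c in [set: C]) ((W^-1)%:E * (w c)%:E))%E.
    by apply: eq_esum => c _; rewrite mulrC EFinM.
  by rewrite esumZl ?invr_ge0// WE -EFinM mulVf.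
- move=> t; apply: le_trans (QD t) _; rewrite lee_fin ler_wpM2l//.
  apply: ler_prod => c _; rewrite w0/= ler_pdivlMr// ler_piMr//.
- apply: (@le_lt_trans _ _ ((W^-1)%:E * \esum_(c in [set: C]) (w c * `|f c|)%:E)%E).
    rewrite -esumZl ?invr_ge0//; last by move=> c _; rewrite lee_fin mulr_ge0.
    by apply: le_esum => c _; rewrite -EFinM mulrAC mulrC.
  have ffin : \esum_(c in [set: C]) (w c * `|f c|)%:E \is a fin_num.
    by rewrite ge0_fin_numE//; apply: esum_ge0 => c _; rewrite lee_fin mulr_ge0.
  by rewrite -(fineK ffin) -EFinM ltry.
Qed.

(** * The directed cover *)

Section TreeCombinatorics.
Context {V : countType} {E : rel V} {i0 : V}.
Local Notation T := (dcover E i0).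
Local Notation o := (cover_root E i0).
Implicit Types (x y : T) (v : seq V).

Definition depth x : nat := size (sval x).

Definition in_cone x y : bool := prefix (sval x) (sval y).

(** [insubd] falls back to x when v is not a path from the label of x. *)
Definition graft x v : T := insubd (x : {s | path E i0 s}) (sval x ++ v).

Definition child x (j : V) : T := graft x [:: j].

Lemma sval_graft x v : path E (cover_label x) v -> sval (graft x v) = sval x ++ v.
Proof.
move=> pv; rewrite /graft -[LHS]/(val (insubd (x : {s | path E i0 s}) (sval x ++ v))).
by rewrite val_insubd cat_path (svalP x) pv.
Qed.

Lemma dcover_inj x y : sval x = sval y -> x = y.
Proof. exact: val_inj. Qed.

Lemma depth_root : depth o = 0%N. Proof. by []. Qed.

Lemma depth_eq0 x : (depth x == 0)%N = (x == o).
Proof.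
apply/idP/eqP => [/eqP/size0nil h|->//].
exact: dcover_inj.
Qed.

Lemma in_cone_refl x : in_cone x x. Proof. exact: prefix_refl. Qed.

Lemma in_cone_trans y x z : in_cone x y -> in_cone y z -> in_cone x z.
Proof. exact: prefix_trans. Qed.

Lemma in_cone_root y : in_cone o y. Proof. exact: prefix0s. Qed.

Lemma in_cone_depth x y : in_cone x y -> (depth x <= depth y)%N.
Proof. by move=> /size_prefix. Qed.

Lemma sval_child x j : E (cover_label x) j -> sval (child x j) = rcons (sval x) j.
Proof. by move=> h; rewrite sval_graft ?cats1//= h. Qed.

Lemma depth_child x j : E (cover_label x) j -> depth (child x j) = (depth x).+1.
Proof. by move=> h; rewrite /depth sval_child// size_rcons. Qed.

Lemma label_child x j : E (cover_label x) j -> cover_label (child x j) = j.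
Proof. by move=> h; rewrite /cover_label sval_child// last_rcons. Qed.

Lemma child_neq_root x j : E (cover_label x) j -> child x j != o.
Proof. by move=> h; rewrite -depth_eq0 depth_child. Qed.

Lemma parent_child x j : E (cover_label x) j -> cover_parent (child x j) = x.
Proof.
move=> h; apply: dcover_inj; rewrite /cover_parent/= sval_child// size_rcons/=.
by rewrite -cats1 take_size_cat.
Qed.

Lemma sval_parent x : x != o -> rcons (sval (cover_parent x)) (cover_label x) = sval x.
Proof.
rewrite -depth_eq0 /depth /cover_label; case: x => s /= ps.
case/lastP: s ps => [//|s j] ps _ /=.
by rewrite size_rcons/= last_rcons -[X in take _ X]cats1 take_size_cat.
Qed.

Lemma child_parent x : x != o -> child (cover_parent x) (cover_label x) = x.
Proof.
move=> xo; apply: dcover_inj; rewrite sval_child ?sval_parent//.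
exact: cover_parent_edge.
Qed.

Lemma in_cone_child x j : E (cover_label x) j -> in_cone x (child x j).
Proof. by move=> h; rewrite /in_cone sval_child// -cats1 prefix_prefix. Qed.

Lemma depth_parent x : x != o -> (depth (cover_parent x)).+1 = depth x.
Proof. by move=> xo; rewrite /depth -(sval_parent xo) size_rcons. Qed.

Lemma cover_ind (Q : T -> Prop) : Q o ->
  (forall x j, E (cover_label x) j -> Q x -> Q (child x j)) -> forall x, Q x.
Proof.
move=> Q0 QS x; have [n] := ubnP (depth x); elim: n x => // n IH x xn.
have [->//|xo] := eqVneq x o.
rewrite -(child_parent xo); apply: QS; first exact: cover_parent_edge.
by apply: IH; move: xn; rewrite -(depth_parent xo).
Qed.

Definition adjacent x y : Prop :=
  (exists2 j, E (cover_label x) j & y = child x j) \/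
  (exists2 j, E (cover_label y) j & x = child y j) \/ (x = o /\ y = o).

Lemma adjacent_depth x y : adjacent x y ->
  (depth y <= (depth x).+1)%N /\ (depth x <= (depth y).+1)%N.
Proof.
by case=> [[j h ->]|[[j h ->]|[-> ->]]]; rewrite ?depth_child//; split; lia.
Qed.

(** In a tree, the only edge into a cone joins the parent of its apex to the apex. *)
Lemma enter_cone c x y : adjacent x y -> ~~ in_cone c x -> in_cone c y ->
  y = c /\ exists2 j, E (cover_label x) j & c = child x j.
Proof.
case=> [[j h ->]|[[j h ->]|[-> ->]]]; last by move=> /negP.
- rewrite /in_cone sval_child// => ncx /prefixP[v]; case/lastP: v => [|v l] e.
    rewrite cats0 in e.
    have ec : child x j = c by apply: dcover_inj; rewrite sval_child.
    by split=> //; exists j.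
  move/negP: ncx; case; move: e; rewrite -rcons_cat => /rcons_inj[-> _].
  exact: prefix_prefix.
- move=> /negP ncx cy; exfalso; apply: ncx; apply: in_cone_trans cy _.
  exact: in_cone_child.
Qed.

Lemma leave_cone c x y : adjacent x y -> in_cone c x -> ~~ in_cone c y ->
  x = c /\ exists2 j, E (cover_label y) j & c = child y j.
Proof.
move=> axy cx ncy; apply: enter_cone ncy cx.
case: axy => [h|[h|[-> ->]]]; [by right; left|by left|by right; right].
Qed.

End TreeCombinatorics.

(** Collects the standing assumptions on the walk, with one eps below both the backward
    probabilities and all positive transitions. The spectral gap and the recurrence of Q enter later
    as separate hypotheses. *)
Record cover_walk (R : realType) (V : countType) (E : rel V) (i0 : V)
    (pG : V -> V -> R) (pback : V -> R)
    (d : measure_display) (Omega : measurableType d)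
    (P : dcover E i0 -> probability Omega R) (X : nat -> Omega -> dcover E i0)
    (eps : R) : Prop := CoverWalk {
  cw_stoch : stochastic pG;
  cw_edge : forall i j : V, (0 < pG i j) = E i j;
  cw_back : forall i, eps <= pback i <= 1;
  cw_mc : markov_chain (cover_trans pG pback) P X;
  cw_eps : 0 < eps <= 1;
  cw_trans : forall x y : dcover E i0, 0 < cover_trans pG pback x y ->
       eps <= cover_trans pG pback x y;
  cw_back1 : forall i, pback i < 1 }.

Section CoverWalkBasics.
Context {R : realType} {V : countType} {E : rel V} {i0 : V}
  {pG : V -> V -> R} {pback : V -> R}
  {d : measure_display} {Omega : measurableType d}
  {P : dcover E i0 -> probability Omega R} {X : nat -> Omega -> dcover E i0}
  {eps : R} (H : cover_walk pG pback P X eps).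
Local Notation T := (dcover E i0).
Local Notation o := (cover_root E i0).
Local Notation p := (@cover_trans R V E i0 pG pback).
Local Notation fw := (forward pG pback).
Implicit Types (x y : T).

Lemma eps_gt0 : 0 < eps. Proof. by have /andP[] := cw_eps H. Qed.
Lemma eps_le1 : eps <= 1. Proof. by have /andP[] := cw_eps H. Qed.
Hint Resolve eps_gt0 eps_le1 : core.

Lemma pG_ge0 i j : 0 <= pG i j. Proof. by have [h _] := cw_stoch H; exact: h. Qed.

Lemma pG_le1 i j : pG i j <= 1.
Proof.
have [_ /(_ i) h] := cw_stoch H.
rewrite -lee_fin -h; apply: esum_ge; exists [set j]; first by split.
by rewrite fsbig_set1.
Qed.

Lemma forward_ge0 i j : 0 <= fw i j.
Proof.
by rewrite /forward mulr_ge0 ?pG_ge0// subr_ge0; have /andP[] := cw_back H i.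
Qed.

Lemma forward_le1 i j : fw i j <= 1.
Proof.
have h : 0 <= pback i <= 1.
  by have /andP[h ->] := cw_back H i; rewrite (le_trans _ h)// ltW.
rewrite /forward mulr_ile1 ?pG_ge0 ?pG_le1//; lra.
Qed.

Lemma forward_gt0 i j : (0 < fw i j) = E i j.
Proof.
by rewrite /forward pmulr_rgt0 ?(cw_edge H)// subr_gt0 (cw_back1 H).
Qed.

Lemma cover_trans_child x j : E (cover_label x) j -> p x (child x j) = fw (cover_label x) j.
Proof.
by move=> h; rewrite /cover_trans child_neq_root// parent_child// eqxx/= label_child.
Qed.

Lemma cover_trans_parent x : x != o -> p x (cover_parent x) = pback (cover_label x).
Proof.
move=> xo; rewrite /cover_trans xo eqxx/= andbC.
case: eqP => //= e; case: eqVneq => //= h.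
have := depth_parent xo; have := depth_parent h; rewrite e; lia.
Qed.

Lemma cover_trans_adjacent x y : p x y != 0 -> adjacent x y.
Proof.
rewrite /cover_trans; case: ifPn => [/andP[yo /eqP <-] _|_].
  left; exists (cover_label y); first exact: cover_parent_edge.
  by rewrite child_parent.
case: ifPn => [/andP[xo /eqP ->] _|_].
  right; left; exists (cover_label x); first exact: cover_parent_edge.
  by rewrite child_parent.
by case: ifPn => [/andP[/eqP -> /eqP ->] _|_]; [right; right|rewrite eqxx].
Qed.

Lemma forward_ge_eps x j : E (cover_label x) j -> eps <= fw (cover_label x) j.
Proof.
move=> h; rewrite -cover_trans_child//; apply: (cw_trans H).
by rewrite cover_trans_child// forward_gt0.
Qed.

Definition adjacent_path (s : nat -> T) := forall k, adjacent (s k) (s k.+1).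

(** Every cylinder with a non-adjacent step has a zero factor, and there are countably many
    cylinders. *)
Lemma bad_step_null x n :
  P x [set w | ~ adjacent (X n w) (X n.+1 w)] = 0%E.
Proof.
have MC := cw_mc H.
pose A := [set s : nat -> T | ~ adjacent (s n) (s n.+1)].
have dA : depends_upto n.+1 A.
  by move=> s s' ss'; rewrite /A/= !ss'.
rewrite -[X in P x X]/(path_ev X A) (path_evE X dA) prob_bigcup_count.
- apply: esum1 => t /= At; rewrite (cylinder_prob MC) big_ord_recr/=.
  have [e|/cover_trans_adjacent//] := eqVneq (p (ffun_path t n) (ffun_path t n.+1)) 0.
  by rewrite e !mulr0.
- by move=> t _; exact: cylinder_measurable MC _ _.
- move=> t t' _ _ h; apply: (@trivIset_cylinder _ _ _ X n.+1 setT (fun _ => setT)) => //.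
  by move: h; rewrite !setIT.
Qed.

Lemma ae_adjacent x : {ae P x, forall w, adjacent_path (fun k => X k w)}.
Proof.
rewrite /almost_everywhere.
apply: (@negligibleS _ _ _ _ (\bigcup_n [set w | ~ adjacent (X n w) (X n.+1 w)])).
  move=> w /= h; apply: contrapT => h'; apply: h => n; apply: contrapT => hn.
  by apply: h'; exists n.
apply: negligible_bigcup => n; apply/negligibleP; last exact: bad_step_null.
apply: (@path_ev_measurable _ _ _ _ _ _ _ (cw_mc H) n.+1
          [set s : nat -> T | ~ adjacent (s n) (s n.+1)]).
by move=> s s' ss'; rewrite /= !ss'.
Qed.

End CoverWalkBasics.

(** * Spectral gap and return probabilities *)

Lemma bernoulli_inequality (R : realType) (b : R) n : 1 <= b ->
  1 + n%:R * (b - 1) <= b ^+ n.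
Proof.
move=> b1; elim: n => [|n IH]; first by rewrite mul0r addr0 expr0.
rewrite exprS; have b0 : 0 <= b by lra.
apply: le_trans (ler_wpM2l b0 IH); rewrite -natr1.
have n0 : 0 <= n%:R :> R by [].
have := mulr_ge0 n0 (sqr_ge0 (b - 1)); nra.
Qed.

Lemma expr_unbounded (R : realType) (b m : R) : 1 < b -> exists n : nat, m < b ^+ n.
Proof.
move=> b1; have b10 : 0 < b - 1 by rewrite subr_gt0.
exists (Num.bound `|m / (b - 1)|).
apply: lt_le_trans (bernoulli_inequality _ (ltW b1)).
have := archi_boundP (normr_ge0 (m / (b - 1))).
move=> /(le_lt_trans (ler_norm _)); rewrite ltr_pdivrMr//; lra.
Qed.

Lemma esum_nat_recl (R : realType) (f : nat -> \bar R) :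
  (forall n, 0 <= f n)%E ->
  (\esum_(n in [set: nat]) f n = f 0%N + \esum_(n in [set: nat]) f n.+1)%E.
Proof.
move=> f0; rewrite -!nneseries_esumT// (@nneseries_recl _ xpredT)//.
rewrite -nneseries_addn//; congr (_ + _)%E.
by apply: eq_eseriesr => n _; rewrite addn1.
Qed.

Lemma esum_ord (R : realType) (n : nat) (f : nat -> R) :
  (forall k, 0 <= f k) ->
  (\esum_(k in `I_n) (f k)%:E = (\sum_(k < n) f k)%:E)%E.
Proof.
move=> f0; rewrite esum_fset ?finite_II//; last by move=> k _; rewrite lee_fin.
rewrite -sumEFin -(big_mkord xpredT (fun k => (f k)%:E)).
rewrite [RHS]fsbig_seq ?iota_uniq//.
by apply: eq_fsbigl; rewrite -Iiota /index_iota subn0.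
Qed.

(** Cauchy product: the pairs (k, m) are reindexed by their sum and their first entry. *)
Lemma esum_conv (R : realType) (a b : nat -> R) :
  (forall n, 0 <= a n) -> (forall n, 0 <= b n) ->
  (\esum_(n in [set: nat]) (b n)%:E < +oo)%E ->
  (\esum_(n in [set: nat]) (\sum_(k < n.+1) a k * b (n - k)%N)%:E =
   (\esum_(n in [set: nat]) (a n)%:E) * (\esum_(n in [set: nat]) (b n)%:E))%E.
Proof.
move=> a0 b0 bfin.
have S0 : (0 <= \esum_(n in [set: nat]) (b n)%:E)%E.
  by apply: esum_ge0 => n _; rewrite lee_fin.
have bE : (\esum_(n in [set: nat]) (b n)%:E)%E = (fine (\esum_(n in [set: nat]) (b n)%:E))%:E.
  by rewrite fineK// ge0_fin_numE.
transitivity (\esum_(k in [set: nat] `*`` (fun=> [set: nat])) (a k.1 * b k.2)%:E)%E.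
  transitivity (\esum_(n in [set: nat]) \esum_(k in `I_n.+1) (a k * b (n - k)%N)%:E)%E.
    apply: eq_esum => n _; rewrite (esum_ord n.+1 (f := fun k => a k * b (n - k)%N))//.
    by move=> k; rewrite mulr_ge0.
  rewrite esum_esum; last by move=> n k _ _; rewrite lee_fin mulr_ge0.
  rewrite (reindex_esum ([set: nat] `*`` (fun=> [set: nat])) _ (fun km => ((km.1 + km.2)%N, km.1))).
    by apply: eq_esum => -[k m] _ /=; rewrite addKn.
  split => /=.
  - by move=> [k m] _; split => //=; rewrite ltnS leq_addr.
  - by move=> [k m] [k' m'] _ _ /= [+ kk']; rewrite kk' => /addnI ->.
  - move=> [n k] [_ /= kn]; exists (k, n - k)%N => //=.
    by rewrite subnKC.
rewrite -(esum_esum (a := fun k m => (a k * b m)%:E)); last first.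
  by move=> k m _ _; rewrite lee_fin mulr_ge0.
rewrite bE muleC -esumZl ?fine_ge0//; last by move=> n _; rewrite lee_fin.
apply: eq_esum => k _; rewrite muleC -bE -esumZl//; last by move=> m _; rewrite lee_fin.
Qed.

Lemma esum_geometric_le (R : realType) (u : nat -> R) (c g : R) : 0 <= c ->
  0 <= g < 1 -> (forall n, 0 <= u n <= c * g ^+ n) ->
  (\esum_(n in [set: nat]) (u n)%:E <= (c * (1 - g)^-1)%:E)%E.
Proof.
move=> c0 g01 hu; rewrite -nneseries_esumT; last first.
  by move=> n; rewrite lee_fin; have /andP[] := hu n.
apply: nneseries_le_bound => [n|N]; first by rewrite lee_fin; have /andP[] := hu n.
rewrite sumEFin lee_fin; apply: (@le_trans _ _ (\sum_(0 <= n < N) c * g ^+ n)).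
  by apply: ler_sum => n _; have /andP[] := hu n.
by rewrite -mulr_sumr ler_wpM2l// geometric_partial_le.
Qed.

Section GreenFunction.
Context {R : realType} {V : countType} {E : rel V} {i0 : V}
  {pG : V -> V -> R} {pback : V -> R}
  {d : measure_display} {Omega : measurableType d}
  {P : dcover E i0 -> probability Omega R} {X : nat -> Omega -> dcover E i0}
  {eps : R} (H : cover_walk pG pback P X eps).
Local Notation T := (dcover E i0).
Local Notation o := (cover_root E i0).
Local Notation p := (@cover_trans R V E i0 pG pback).
Local Notation fw := (forward pG pback).
Local Notation MC := (cw_mc H).
Let pchild (x : T) j : E (cover_label x) j -> p x (child x j) = fw (cover_label x) j.
Proof. exact: cover_trans_child. Qed.
Implicit Types (x y z : T).

(** Allows events to be compared only along trajectories from x with adjacent steps, the others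
    forming a null set. *)
Lemma prob_good_le x (A B : set Omega) : measurable A -> measurable B ->
  (forall w, X 0%N w = x -> adjacent_path (fun k => X k w) -> A w -> B w) ->
  (P x A <= P x B)%E.
Proof.
move=> mA mB AB.
have [N [mN PN HN]] := ae_adjacent H x.
pose S := [set w | X 0%N w = x].
have mS : measurable S := state_measurable MC 0 x.
have PS : P x (~` S) = 0%E.
  by rewrite probability_setC// (start_prob MC) eqxx subee.
have le1 : (P x A <= P x (B `|` (N `|` ~` S)))%E.
  apply: prob_le => //; first by do 2 apply: measurableU => //; exact: measurableC.
  move=> w Aw; have [Sw|nSw] := pselect (S w); last by right; right.
  have [adj|nadj] := pselect (adjacent_path (fun k => X k w)).
    by left; exact: AB.
  by right; left; apply: HN.
apply: le_trans le1 _.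
have le2 : (P x (B `|` (N `|` ~` S)) <= P x B + P x (N `|` ~` S))%E.
  by apply: measureU2 => //; apply: measurableU => //; exact: measurableC.
have le3 : (P x (N `|` ~` S) <= P x N + P x (~` S))%E.
  by apply: measureU2 => //; exact: measurableC.
apply: le_trans le2 _; rewrite -[leRHS]adde0 leeD2l//.
by apply: le_trans le3 _; rewrite PS adde0 PN.
Qed.

Lemma prob_good_eq x (A B : set Omega) : measurable A -> measurable B ->
  (forall w, X 0%N w = x -> adjacent_path (fun k => X k w) -> (A w <-> B w)) ->
  P x A = P x B.
Proof.
move=> mA mB AB; apply/eqP; rewrite eq_le; apply/andP; split;
  by apply: prob_good_le => // w xw adj; case: (AB w xw adj).
Qed.

Definition tp x (n : nat) y : R := fine (P x [set w | X n w = y]).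

Lemma tpE x n y : P x [set w | X n w = y] = (tp x n y)%:E.
Proof. by rewrite /tp prob_fineK//; exact: state_measurable MC n y. Qed.

Lemma tp_ge0 x n y : 0 <= tp x n y. Proof. exact: fine_ge0. Qed.

Lemma tp_le1 x n y : tp x n y <= 1.
Proof. by rewrite -lee_fin -tpE; apply: probability_le1; exact: state_measurable MC n y. Qed.

Lemma tp_add x n y m z : tp x n y * tp y m z <= tp x (n + m) z.
Proof.
rewrite -lee_fin EFinM -!tpE.
have h := markov_property MC x (n := n) (m := m) y (A := setT) (B := [set s | s m = z]).
rewrite -[P y _]/(P y (path_ev X [set s | s m = z])).
rewrite (_ : [set w | X n w = y] = [set w | setT (fun k => X k w) /\ X n w = y]); last first.
  by apply/seteqP; split => w //=; case.
rewrite -h//; last by move=> s s' ss' /=; rewrite ss'.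
have mA : measurable [set w | X n w = y] by exact: state_measurable MC n y.
have mB : measurable [set w | X (n + m)%N w = z] by exact: state_measurable MC (n + m)%N z.
apply: prob_le => //; last by move=> w [_ _].
rewrite (_ : [set _ | _] = [set w | X n w = y] `&` [set w | X (n + m)%N w = z]).
  exact: measurableI.
by apply/seteqP; split => w /= [].
Qed.

Lemma tp0 x y : tp x 0 y = (x == y)%:R.
Proof. by rewrite /tp (start_prob MC). Qed.

Lemma tp1 x y : tp x 1 y = p x y.
Proof.
apply: EFin_inj; rewrite -tpE.
pose s k := if k is 0%N then x else y.
have := cylinder_prob MC x 1 s; rewrite eqxx mul1r big_ord1/= => <-.
apply: prob_good_eq; [exact: state_measurable MC 1 y|exact: (cylinder_measurable MC)|].
move=> w xw _; split => [yw [|[|k]]//|]; exact: (fun h => h 1%N isT).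
Qed.

Lemma tp_from_root x : eps ^+ depth x <= tp o (depth x) x.
Proof.
elim/(@cover_ind V E i0): x => [|x j Ej IH]; first by rewrite tp0 eqxx expr0.
rewrite depth_child// -addn1 exprD; apply: le_trans (tp_add _ _ x _ _).
apply: ler_pM => //; first by rewrite exprn_ge0// ltW// (eps_gt0 H).
  by rewrite expr1 ltW// (eps_gt0 H).
by rewrite tp1 expr1 (pchild Ej) (forward_ge_eps H).
Qed.

Lemma tp_to_root x : eps ^+ depth x <= tp x (depth x) o.
Proof.
elim/(@cover_ind V E i0): x => [|x j Ej IH]; first by rewrite tp0 eqxx expr0.
rewrite depth_child// -add1n exprD; apply: le_trans (tp_add _ _ x _ _).
apply: ler_pM => //; [|by rewrite exprn_ge0// ltW// (eps_gt0 H)|].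
  by rewrite expr1 ltW// (eps_gt0 H).
have := @cover_trans_parent R V E i0 pG pback _ (child_neq_root Ej).
rewrite parent_child// => pE.
by rewrite tp1 expr1 pE; have /andP[] := cw_back H (cover_label (child x j)).
Qed.

(** The return series converges at some r > 1, and its terms are then bounded. *)
Lemma spectral_radius_bound : (spectral_radius P X o < 1)%E ->
  exists r M : R, 1 < r /\ forall n, tp o n o * r ^+ n <= M.
Proof.
rewrite /spectral_radius => h.
have {}h : (1 < return_radius P X o)%E.
  rewrite ltNge; apply: contraTN h => h1; rewrite -leNgt.
  (* The value 0 belongs to the set, since 0^n = 0 for n > 0; this excludes a negative radius before
     inverting. *)
  have h0 : (0 <= return_radius P X o)%E.
    apply: ereal_sup_ubound; exists 0 => //; split => //.
    apply: (is_cvg_near_cst (fine (P o [set w | X 0%N w = o]))).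
    exists 1%N => // -[//|n] _ /=.
    rewrite /series/= big_nat_recl// expr0 mulr1.
    by rewrite big1 ?addr0// => k _; rewrite expr0n mulr0.
  move: h0 h1; case: (return_radius P X o) => [s| |]//.
  rewrite inver !lee_fin => s0 s1; case: eqVneq => [_|sn0]; first by rewrite leey.
  by rewrite lee_fin invf_ge1// lt_def sn0.
have [_ [r [r0 cr] <-] r1] := ereal_sup_gt h.
have [M [_ HM]] := cvg_seq_bounded (cvgP _ (cvg_series_cvg_0 cr)).
exists r, (M + 1); split; first by rewrite -lte_fin.
move=> n; have := HM (M + 1); rewrite ltrDl ltr01 => /(_ isT n I) /=.
exact: le_trans (ler_norm _).
Qed.

Variables (r M : R).
Hypotheses (r_gt1 : 1 < r) (rM : forall n, tp o n o * r ^+ n <= M).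

Let r_gt0 : 0 < r. Proof. exact: lt_trans r_gt1. Qed.

(** If p^n(x,x) r^n = q > 1, then l repetitions of the loop, joined to the root at both ends, give a
    return to o whose probability times the matching power of r is at least c q^l, against the bound
    M. Since l is free, all constants disappear and the estimate is uniform in x. *)
Lemma tp_diag x n : tp x n x <= r^-1 ^+ n.
Proof.
rewrite exprVn leNgt; apply/negP => h.
pose q := tp x n x * r ^+ n.
have rn : 0 < r ^+ n by rewrite exprn_gt0.
have q1 : 1 < q by move: h; rewrite -[r ^- n]mul1r ltr_pdivrMr.
pose k := depth x.
have pw l : tp x n x ^+ l <= tp x (l * n) x.
  elim: l => [|l IH]; first by rewrite mul0n tp0 eqxx expr0.
  rewrite exprS mulSn; apply: le_trans (tp_add _ _ x _ _).
  by rewrite ler_wpM2l// tp_ge0.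
pose c := eps ^+ k * eps ^+ k.
have ek : 0 < eps ^+ k by rewrite exprn_gt0// (eps_gt0 H).
have c0 : 0 < c by rewrite mulr_gt0.
have hb l : c * q ^+ l <= M.
  apply: le_trans (rM (k + (l * n) + k)%N).
  have h1 : c * tp x n x ^+ l <= tp o (k + l * n + k) o.
    apply: le_trans (tp_add _ _ x _ _).
    rewrite /c mulrAC; apply: ler_pM; [|exact: ltW| |exact: tp_to_root].
      by rewrite mulr_ge0 ?(ltW ek)// exprn_ge0// tp_ge0.
    apply: le_trans (tp_add _ _ x _ _).
    by apply: ler_pM; [exact: ltW|by rewrite exprn_ge0// tp_ge0|exact: tp_from_root|exact: pw].
  rewrite /q exprMn mulrA; apply: ler_pM => //.
  - by rewrite mulr_ge0 ?(ltW c0)// exprn_ge0// tp_ge0.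
  - by rewrite !exprn_ge0// ltW.
  - by rewrite -exprM mulnC ler_weXn2l ?(ltW r_gt1)//; lia.
have [l Hl] := expr_unbounded (M / c) q1.
have := hb l; apply/negP; rewrite -ltNge.
by rewrite mulrC -ltr_pdivrMr.
Qed.

Let ri01 : 0 <= r^-1 < 1.
Proof. by rewrite invr_ge0 ltW//= invf_lt1. Qed.

Definition green_bound : R := (1 - r^-1)^-1.
Local Notation K := green_bound.

Lemma green_bound_ge1 : 1 <= K.
Proof.
have /andP[h0 h1] := ri01.
by rewrite /K -[leLHS]invr1 lef_pV2 ?posrE ?ltr01 ?subr_gt0// gerBl.
Qed.

(** Going on from x to the root in |x| steps keeps at least the fraction eps^|x| of the probability
    and completes a return to o. *)
Lemma tp_root_le x n : tp o n x <= (eps ^- depth x) * r^-1 ^+ n.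
Proof.
have ek : 0 < eps ^+ depth x by rewrite exprn_gt0// (eps_gt0 H).
rewrite mulrC ler_pdivlMr//.
apply: le_trans (ler_wpM2l (tp_ge0 _ _ _) (tp_to_root x)) _.
apply: le_trans (tp_add _ _ x _ _) _; apply: le_trans (tp_diag _ _) _.
have /andP[h0 h1] := ri01.
by rewrite exprD ler_piMr ?exprn_ge0// exprn_ile1// ltW.
Qed.

Lemma diag_sum_le x : (\esum_(n in [set: nat]) (tp x n x)%:E <= K%:E)%E.
Proof.
rewrite -[K]mul1r; apply: esum_geometric_le => // n.
by rewrite tp_ge0 mul1r tp_diag.
Qed.

(** Returns to x inside its own cone. For x other than the root their probabilities depend on the
    label alone, since the walk never sees the rest of the tree. *)
Definition ret_path x n : set (nat -> T) :=
  [set s | (forall m, (m <= n)%N -> in_cone x (s m)) /\ s n = x].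

Definition ret_prob x n : R := fine (P x (path_ev X (ret_path x n))).

Lemma ret_path_depends x n : depends_upto n (ret_path x n).
Proof. by move=> s s' ss' [h1 h2]; split => [m mn|]; rewrite -ss'//; exact: h1. Qed.

Lemma ret_measurable x n : measurable (path_ev X (ret_path x n)).
Proof. exact: (path_ev_measurable MC (@ret_path_depends x n)). Qed.

Lemma ret_probE x n : P x (path_ev X (ret_path x n)) = (ret_prob x n)%:E.
Proof. by rewrite /ret_prob prob_fineK//; exact: ret_measurable. Qed.

Lemma ret_prob_ge0 x n : 0 <= ret_prob x n. Proof. exact: fine_ge0. Qed.

Lemma ret_prob_le x n : ret_prob x n <= r^-1 ^+ n.
Proof.
apply: le_trans (tp_diag x n); rewrite -lee_fin -ret_probE -tpE.
by apply: prob_le; [exact: ret_measurable|exact: state_measurable MC n x|move=> w []].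
Qed.

Lemma ret_prob0 x : ret_prob x 0 = 1.
Proof.
apply: EFin_inj; rewrite -ret_probE -[RHS]/((true)%:R%:E) -(eqxx x) -(start_prob MC).
congr (P x _); apply/seteqP; split => w /=; first by case.
by move=> h; split => // m; rewrite leqn0 => /eqP ->; rewrite h in_cone_refl.
Qed.

Definition ret_sum x : R := fine (\esum_(n in [set: nat]) (ret_prob x n)%:E).

Lemma ret_sumE x : (\esum_(n in [set: nat]) (ret_prob x n)%:E)%E = (ret_sum x)%:E.
Proof.
rewrite /ret_sum fineK// ge0_fin_numE; last first.
  by apply: esum_ge0 => n _; rewrite lee_fin ret_prob_ge0.
apply: (@le_lt_trans _ _ K%:E); last by rewrite ltry.
rewrite -[K]mul1r; apply: esum_geometric_le => // n.
by rewrite ret_prob_ge0 mul1r ret_prob_le.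
Qed.

Lemma ret_sum_le x : ret_sum x <= K.
Proof.
rewrite -lee_fin -ret_sumE -[K]mul1r; apply: esum_geometric_le => // n.
by rewrite ret_prob_ge0 mul1r ret_prob_le.
Qed.

Lemma ret_sum_ge1 x : 1 <= ret_sum x.
Proof.
rewrite -lee_fin -ret_sumE; apply: esum_ge; exists [set 0%N]; first by split.
by rewrite fsbig_set1 ret_prob0.
Qed.

(* Decomposition at the last entrance into the cone of c. *)
Lemma last_exit x j n (c := child x j) : E (cover_label x) j ->
  tp o n.+1 c = \sum_(k < n.+1) (tp o k x * fw (cover_label x) j) * ret_prob c (n - k).
Proof.
move=> Ej.
(* On [F k] the last step from outside the cone to its apex is made between the times k and k +
   1. *)
pose F (k : nat) := [set w | [/\ X k w = x, X k.+1 w = c &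
   (forall m, (m <= n - k)%N -> in_cone c (X (k.+1 + m)%N w)) /\ X (k.+1 + (n - k))%N w = c]].
have FE (k : nat) : (k < n.+1)%N -> P o (F k) =
    ((tp o k x * fw (cover_label x) j) * ret_prob c (n - k))%:E.
  move=> kn; pose B := [set s : nat -> T | s 1%N = c /\ ret_path c (n - k) (shift_path 1 s)].
  have dB : depends_upto (1 + (n - k))%N B.
    move=> s s' ss' [h1 [h2 h3]]; split; first by rewrite -ss'.
    split => [m mn|]; rewrite /shift_path -ss' ?leq_add2l//; exact: h2.
  have h := markov_property MC o (n := k) (m := (1 + (n - k))%N) x (A := setT) (B := B).
  have -> : F k = [set w | [/\ setT (fun k => X k w), X k w = x &
      B (shift_path k (fun k => X k w))]].
    apply/seteqP; split => w /= [].
      move=> h1 h2 [h3 h4]; split => //; split; first by rewrite /shift_path addn1.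
      by split => [m mn|]; rewrite /shift_path addnA addn1//; exact: h3.
    move=> _ h1 [h2 [h3 h4]]; split => //.
      by rewrite -h2 /shift_path addn1.
    split=> [m mn|].
      by have := h3 m mn; rewrite /shift_path addnA addn1.
    by have := h4; rewrite /shift_path addnA addn1.
  rewrite h//.
  rewrite (_ : [set w | _ /\ X k w = x] = [set w | X k w = x]); last first.
    by apply/seteqP; split => w //=; case.
  rewrite tpE -mulrA EFinM; congr (_ * _)%E.
  have h2 := markov_property MC x (n := 1%N) (m := (n - k)%N) c (A := setT)
    (B := ret_path c (n - k)).
  rewrite EFinM -ret_probE -(pchild Ej) -tp1 -tpE.
  rewrite (_ : [set w | X 1 w = c] = [set w | setT (fun k => X k w) /\ X 1 w = c]); last first.
    by apply/seteqP; split => w //=; case.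
  rewrite -h2//; last exact: ret_path_depends.
  by congr (P x _); apply/seteqP; split => w /= [].
have mF k : (k < n.+1)%N -> measurable (F k).
  move=> kn.
  apply: (@path_ev_measurable _ _ _ _ _ _ _ MC n.+1 [set s : nat -> T |
    [/\ s k = x, s k.+1 = c & (forall m, (m <= n - k)%N -> in_cone c (s (k.+1 + m)%N)) /\
        s (k.+1 + (n - k))%N = c]]).
  move=> s s' ss' [h1 h2 [h3 h4]]; split.
  - by rewrite -ss'// ltnW.
  - by rewrite -ss'.
  - split => [m mn|]; rewrite -ss' ?h3//; lia.
apply: EFin_inj; rewrite -tpE.
transitivity (P o (\bigcup_(k in `I_n.+1) F k)).
  apply: prob_good_eq; [exact: state_measurable MC _ _| |].
    by apply: bigcup_count_measurable => k /= kn; exact: mF.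
  move=> w ow adj; split => [cw|[k kn [_ _ [_ h]]]]; last first.
    by rewrite /= -[n in n.+1](subnKC (kn : (k <= n)%N)) -addSn.
  have co : ~~ in_cone c (X 0%N w).
    rewrite ow; apply/negP => /in_cone_depth.
    by rewrite depth_child// depth_root.
  (* The last time outside the cone; the following step must lead from the parent x to the apex
     c. *)
  pose Pk k := (k <= n.+1)%N && ~~ in_cone c (X k w).
  have Pex : exists k, Pk k by exists 0%N.
  have Pub k : Pk k -> (k <= n.+1)%N by case/andP.
  case: (ex_maxnP Pex Pub) => k /andP[kn nck] kmax.
  have kn1 : (k < n.+1)%N.
    rewrite ltn_neqAle kn andbT; apply: contraNneq nck => ->.
    by rewrite cw in_cone_refl.
  have inc m : (k < m <= n.+1)%N -> in_cone c (X m w).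
    move=> /andP[km mn]; apply: contraLR km => ncm; rewrite -leqNgt.
    by apply: kmax; rewrite /Pk mn.
  have ink1 : in_cone c (X k.+1 w) by apply: inc; rewrite ltnSn.
  have [ec [j' Ej' ec']] := enter_cone (adj k) nck ink1.
  exists k => //; split => //=.
  - by rewrite -(parent_child Ej') -ec' parent_child.
  - split => [m mn|]; first by apply: inc; lia.
    by rewrite addSn subnKC.
rewrite prob_bigcup_count.
- rewrite -(esum_ord n.+1 (f := fun k => tp o k x * fw (cover_label x) j * ret_prob c (n - k)%N)).
    by apply: eq_esum => k /= kn; rewrite FE.
  move=> k; apply: mulr_ge0; last exact: ret_prob_ge0.
  by apply: mulr_ge0; [exact: tp_ge0|exact: (forward_ge0 H)].
- by move=> k kn; exact: mF.
- move=> k k' /= kn k'n [w [[h1 h2 [h3 _]] [h1' h2' [h3' _]]]].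
  (* With two entrance times, the walk would be at x, outside the cone, after the earlier one had
     placed it in the cone for good. *)
  have ncx : ~~ in_cone c x.
    by apply/negP => /in_cone_depth; rewrite depth_child// ltnn.
  have [kk'|kk'|//] := ltngtP k k'.
    have := h3 (k' - k.+1)%N; rewrite subnKC// h1' (negbTE ncx).
    by move=> /(_ ltac:(lia)).
  have := h3' (k - k'.+1)%N; rewrite subnKC// h1 (negbTE ncx).
  by move=> /(_ ltac:(lia)).
Qed.
End GreenFunction.

Arguments tp {R V E i0 d Omega} P X x n y.
Arguments ret_prob {R V E i0 d Omega} P X x n.
Arguments ret_sum {R V E i0 d Omega} P X x.

(** * Green function and its cost along a path *)

Section ConeIsomorphism.
Context {R : realType} {V : countType} {E : rel V} {i0 : V}
  {pG : V -> V -> R} {pback : V -> R}.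
Local Notation T := (dcover E i0).
Local Notation o := (cover_root E i0).
Local Notation p := (@cover_trans R V E i0 pG pback).
Local Notation fw := (forward pG pback).
Implicit Types (x y z : T) (v : seq V).

Definition rel_path x y : seq V := drop (depth x) (sval y).

Lemma sval_cone x y : in_cone x y -> sval y = sval x ++ rel_path x y.
Proof. by move=> /prefixP[v e]; rewrite /rel_path e drop_size_cat. Qed.

Lemma rel_path_path x y : in_cone x y -> path E (cover_label x) (rel_path x y).
Proof. by move=> /sval_cone e; have := svalP y; rewrite e cat_path => /andP[]. Qed.

Lemma graft_rel_path x y : in_cone x y -> graft x (rel_path x y) = y.
Proof.
move=> h; apply: dcover_inj; rewrite sval_graft ?rel_path_path//.
by rewrite -sval_cone.
Qed.

Lemma rel_path_graft x v : path E (cover_label x) v -> rel_path x (graft x v) = v.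
Proof. by move=> pv; rewrite /rel_path sval_graft// drop_size_cat. Qed.

Lemma in_cone_graft x v : path E (cover_label x) v -> in_cone x (graft x v).
Proof. by move=> pv; rewrite /in_cone sval_graft// prefix_prefix. Qed.

Lemma label_graft x v : path E (cover_label x) v ->
  cover_label (graft x v) = last (cover_label x) v.
Proof. by move=> pv; rewrite /cover_label sval_graft// last_cat. Qed.

Lemma graft_neq_root x v : path E (cover_label x) v -> x != o -> graft x v != o.
Proof.
move=> pv; apply: contraNneq => e; have := in_cone_depth (in_cone_graft pv).
by rewrite e depth_root leqn0 depth_eq0.
Qed.

Lemma graft_inj x v v' : path E (cover_label x) v -> path E (cover_label x) v' ->
  graft x v = graft x v' -> v = v'.
Proof. by move=> pv pv' e; rewrite -(rel_path_graft pv) e rel_path_graft. Qed.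

Lemma graft_nil x : graft x [::] = x.
Proof. by apply: dcover_inj; rewrite sval_graft// cats0. Qed.

Lemma graft_rcons x v j : path E (cover_label x) (rcons v j) ->
  graft x (rcons v j) = child (graft x v) j.
Proof.
rewrite rcons_path => /andP[pv Ej]; apply: dcover_inj.
rewrite sval_child ?label_graft// !sval_graft ?rcons_path ?pv//.
by rewrite rcons_cat.
Qed.

Lemma parent_graft_rcons x v j : path E (cover_label x) (rcons v j) ->
  cover_parent (graft x (rcons v j)) = graft x v.
Proof.
move=> pvj; rewrite graft_rcons//; move: pvj; rewrite rcons_path => /andP[pv Ej].
by rewrite parent_child// label_graft.
Qed.

Lemma parent_notin_cone x : x != o -> ~~ in_cone x (cover_parent x).
Proof. by move=> xo; apply/negP => /in_cone_depth; rewrite -(depth_parent xo) ltnn. Qed.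

(** Transitions in terms of positions relative to the apex. The root and its loop lie outside the
    cone of a non-root vertex, so the place in the tree enters only through the label i. *)
Definition cone_trans (i : V) (v v' : seq V) : R :=
  if (v' != [::]) && (take (size v').-1 v' == v) then fw (last i v) (last i v')
  else if (v != [::]) && (v' == take (size v).-1 v) then pback (last i v)
  else 0.

Lemma parent_graft_eq x v v' : x != o -> path E (cover_label x) v ->
  path E (cover_label x) v' ->
  (cover_parent (graft x v') == graft x v) =
  (v' != [::]) && (take (size v').-1 v' == v).
Proof.
move=> xo pv; case/lastP: v' => [|v' j] pv'.
  rewrite graft_nil/=; apply: contraTF (in_cone_graft pv) => /eqP <-.
  exact: parent_notin_cone.
have -> : (rcons v' j != [::]) by case: (v').
rewrite parent_graft_rcons// size_rcons/= -cats1 take_size_cat//.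
move: pv'; rewrite rcons_path => /andP[pv' _].
by apply/eqP/eqP => [/graft_inj ->|->].
Qed.

Lemma cover_trans_cone x v v' : x != o -> path E (cover_label x) v ->
  path E (cover_label x) v' ->
  p (graft x v) (graft x v') = cone_trans (cover_label x) v v'.
Proof.
move=> xo pv pv'; rewrite /cover_trans !graft_neq_root//= !label_graft//.
rewrite parent_graft_eq// [graft x v' == _]eq_sym parent_graft_eq//.
by rewrite (negbTE (graft_neq_root pv xo)) /= /cone_trans [_ == v']eq_sym.
Qed.

Context {d : measure_display} {Omega : measurableType d}
  {P : dcover E i0 -> probability Omega R} {X : nat -> Omega -> dcover E i0}
  {eps : R} (H : cover_walk pG pback P X eps).
Local Notation MC := (cw_mc H).

Definition cone_event x (n : nat) (D : set (nat -> seq V)) : set (nat -> T) :=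
  [set s | (forall m, (m <= n)%N -> in_cone x (s m)) /\
           D (fun m => rel_path x (s m))].

Definition local_upto (n : nat) (D : set (nat -> seq V)) : Prop :=
  forall s s', (forall m, (m <= n)%N -> s m = s' m) -> D s -> D s'.

Lemma cone_event_depends x n D : local_upto n D -> depends_upto n (cone_event x n D).
Proof.
move=> lD s s' ss' [h1 h2]; split => [m mn|]; first by rewrite -ss'// h1.
by apply: lD h2 => m mn; rewrite ss'.
Qed.

(** Cylinders inside the cone of x are carried to the cone of x' by grafting relative paths, with
    equal weights. One inequality is enough, by symmetry. *)
Let cone_prob_le x x' n D : x != o -> x' != o ->
  cover_label x = cover_label x' -> local_upto n D ->
  (P x (path_ev X (cone_event x n D)) <= P x' (path_ev X (cone_event x' n D)))%E.
Proof.
move=> xo x'o xx' lD.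
pose tr (t : {ffun 'I_n.+1 -> T}) k := graft x' (rel_path x (ffun_path t k)).
have dD y := @cone_event_depends y n D lD.
rewrite (path_evE X (dD x)) prob_bigcup_count; last 2 first.
- by move=> t _; exact: cylinder_measurable MC _ _.
- move=> t t' _ _ h; apply: (@trivIset_cylinder _ _ _ X n setT (fun _ => setT)) => //.
  by move: h; rewrite !setIT.
have pr (t : {ffun 'I_n.+1 -> T}) k : cone_event x n D (ffun_path t) -> (k <= n)%N ->
    path E (cover_label x) (rel_path x (ffun_path t k)).
  by move=> [h _] kn; apply: rel_path_path; exact: h.
have -> : (\esum_(t in [set t : {ffun 'I_n.+1 -> T} | cone_event x n D (ffun_path t)])
    P x (cylinder X n (ffun_path t)) =
   \esum_(t in [set t : {ffun 'I_n.+1 -> T} | cone_event x n D (ffun_path t)])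
    P x' (cylinder X n (tr t)))%E.
  apply: eq_esum => t /= At; rewrite !(cylinder_prob MC); congr (_ * _)%:E.
    have [h _] := At.
    (* The Kronecker factors at time 0 agree: either trajectory starts at its apex exactly when the
       initial relative path is empty. *)
    congr (_%:R); congr nat_of_bool; rewrite /tr; apply/eqP/eqP => e.
      by rewrite -e -{2}(graft_nil x) rel_path_graft// graft_nil.
    have := pr t 0%N At isT; rewrite xx' => p0.
    have := rel_path_graft p0; rewrite -e.
    rewrite [in LHS]/rel_path drop_size => e0.
    by rewrite -(graft_rel_path (h 0%N isT)) -e0 graft_nil.
  apply: eq_bigr => k _; have kn := ltn_ord k.
  have [h _] := At.
  rewrite -{1}(graft_rel_path (h k (ltnW kn))) -{1}(graft_rel_path (h k.+1 kn)).
  have p1 := pr t k At (ltnW kn); have p2 := pr t k.+1 At kn.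
  by rewrite /tr !cover_trans_cone// -?xx'.
rewrite -prob_bigcup_count; last 2 first.
- by move=> t _; exact: cylinder_measurable MC _ _.
- move=> t t' /= At At' [w [h h']].
  suff e k : (k <= n)%N -> ffun_path t k = ffun_path t' k.
    by rewrite (ffun_pathP e); apply/ffunP => i; rewrite ffunE /ffun_path inord_val.
  move=> kn; have [c _] := At; have [c' _] := At'.
  rewrite -(graft_rel_path (c k kn)) -(graft_rel_path (c' k kn)); congr graft.
  apply: (@graft_inj x'); rewrite -?xx'; try exact: pr.
  have := h k kn; have := h' k kn; rewrite /tr => -> //.
apply: prob_le.
- by apply: bigcup_count_measurable => t _; exact: cylinder_measurable MC _ _.
- exact: (path_ev_measurable MC (dD x')).
- move=> w [t At tw]; apply: (dD x') (fun k => tr t k) _ _ _.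
    by move=> k kn; rewrite tw.
  have [c DA] := At.
  split => [m mn|]; first by apply: in_cone_graft; rewrite -xx'; exact: pr.
  apply: lD DA => m mn; rewrite /tr rel_path_graft// -xx'; exact: pr.
Qed.

Lemma cone_prob_label x x' n D : x != o -> x' != o ->
  cover_label x = cover_label x' -> local_upto n D ->
  P x (path_ev X (cone_event x n D)) = P x' (path_ev X (cone_event x' n D)).
Proof.
by move=> xo x'o xx' lD; apply/eqP; rewrite eq_le !cone_prob_le.
Qed.

Lemma ret_prob_label x x' n : x != o -> x' != o ->
  cover_label x = cover_label x' ->
  ret_prob P X x n = ret_prob P X x' n.
Proof.
move=> xo x'o xx'.
have e y : ret_path y n = cone_event y n [set t | t n = [::]].
  apply/seteqP; split => s [h1 h2]; split => //.
    by rewrite /= h2 -{2}(graft_nil y) rel_path_graft.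
  by rewrite -(graft_rel_path (h1 n (leqnn n))) [rel_path _ _]h2 graft_nil.
rewrite /ret_prob !e; congr fine; apply: cone_prob_label => //.
by move=> s s' ss' /= h; rewrite -ss'.
Qed.

Definition stay_path x n : set (nat -> T) :=
  [set s | forall m, (m <= n)%N -> in_cone x (s m)].

Lemma stay_path_depends x n : depends_upto n (stay_path x n).
Proof. by move=> s s' ss' h m mn; rewrite -ss'// h. Qed.

Lemma stay_prob_label x x' n : x != o -> x' != o ->
  cover_label x = cover_label x' ->
  P x (path_ev X (stay_path x n)) = P x' (path_ev X (stay_path x' n)).
Proof.
move=> xo x'o xx'.
have e y : stay_path y n = cone_event y n setT.
  by apply/seteqP; split => s; [move=> h; split|case].
by rewrite !e; exact: cone_prob_label.
Qed.

End ConeIsomorphism.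

(** * Green function, hitting probabilities and edge costs *)

Section GreenEstimates.
Context {R : realType} {V : countType} {E : rel V} {i0 : V}
  {pG : V -> V -> R} {pback : V -> R}
  {d : measure_display} {Omega : measurableType d}
  {P : dcover E i0 -> probability Omega R} {X : nat -> Omega -> dcover E i0}
  {eps : R} (H : cover_walk pG pback P X eps).
Local Notation T := (dcover E i0).
Local Notation o := (cover_root E i0).
Local Notation p := (@cover_trans R V E i0 pG pback).
Local Notation fw := (forward pG pback).
Local Notation MC := (cw_mc H).
Local Notation tp := (tp P X).
Implicit Types (x y z : T).

Variables (r M : R).
Hypotheses (r_gt1 : 1 < r) (rM : forall n, tp o n o * r ^+ n <= M).
Local Notation K := (green_bound r).

Definition first_hit_prob y k : R :=
  fine (P o [set w | (forall m, (m < k)%N -> X m w <> y) /\ X k w = y]).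

Lemma first_hit_depends y k :
  depends_upto k [set s : nat -> T | (forall m, (m < k)%N -> s m <> y)].
Proof. by move=> s s' ss' h m mk; rewrite -(ss' m (ltnW mk)); exact: h. Qed.

Lemma first_hit_measurable y k :
  measurable [set w | (forall m, (m < k)%N -> X m w <> y) /\ X k w = y].
Proof.
apply: (@path_ev_measurable _ _ _ _ _ _ _ MC k
  [set s : nat -> T | (forall m, (m < k)%N -> s m <> y) /\ s k = y]).
by move=> s s' ss' [h1 h2]; split; [exact: first_hit_depends h1|rewrite -ss'].
Qed.

Lemma first_hit_probE y k :
  P o [set w | (forall m, (m < k)%N -> X m w <> y) /\ X k w = y] =
  (first_hit_prob y k)%:E.
Proof. by rewrite /first_hit_prob prob_fineK//; exact: first_hit_measurable. Qed.

Lemma trivIset_first_hit y :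
  trivIset setT (fun k => [set w | (forall m, (m < k)%N -> X m w <> y) /\ X k w = y]).
Proof.
move=> k k' _ _ [w [[h1 h2] [h1' h2']]].
by have [kk'|kk'|//] := ltngtP k k'; [case: (h1' _ kk')|case: (h1 _ kk')].
Qed.

Lemma first_hit_decomp y n :
  tp o n y = \sum_(k < n.+1) first_hit_prob y k * tp y (n - k) y.
Proof.
pose F k := [set w | [/\ forall m, (m < k)%N -> X m w <> y, X k w = y & X n w = y]].
have FE k : (k < n.+1)%N -> P o (F k) = (first_hit_prob y k * tp y (n - k) y)%:E.
  move=> kn.
  have := markov_property MC o (n := k) (m := n - k) y (@first_hit_depends y k)
    (B := [set s | s (n - k)%N = y]).
  rewrite EFinM -first_hit_probE -(tpE H) => <-.
    congr (P o _); apply/seteqP; split => w /= [h1 h2 h3]; split => //;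
      move: h3; rewrite /shift_path subnKC//.
  by move=> s s' ss' /=; rewrite ss'.
have mF k : measurable (F k).
  apply: (@path_ev_measurable _ _ _ _ _ _ _ MC (k + n)
    [set s : nat -> T | [/\ (forall m, (m < k)%N -> s m <> y), s k = y & s n = y]]).
  move=> s s' ss' [h1 h2 h3]; split.
  - move=> m mk; rewrite -(ss' m (leq_trans (ltnW mk) (leq_addr _ _))); exact: h1.
  - by rewrite -ss'// leq_addr.
  - by rewrite -ss'// leq_addl.
apply: EFin_inj; rewrite -(tpE H).
have -> : [set w | X n w = y] = \bigcup_(k in `I_n.+1) F k.
  apply/seteqP; split => [w yw|w [k _ []]//].
  have ex : exists k, X k w == y by exists n; apply/eqP.
  case: (ex_minnP ex) => k /eqP ky kmin; exists k.
    by rewrite /= ltnS; apply: kmin; apply/eqP.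
  split => // m mk /eqP my; move: mk; rewrite ltnNge => /negP; apply; exact: kmin.
rewrite prob_bigcup_count.
- rewrite -(esum_ord n.+1 (f := fun k => first_hit_prob y k * tp y (n - k)%N y)).
    by apply: eq_esum => k /= kn; rewrite FE.
  by move=> k; rewrite mulr_ge0 ?fine_ge0.
- by move=> k _; exact: mF.
- move=> k k' _ _ [w [[h1 h2 _] [h1' h2' _]]].
  by apply: (@trivIset_first_hit y k k' I I); exists w.
Qed.

Definition green x : R := fine (\esum_(n in [set: nat]) (tp o n x)%:E).

Lemma greenE x : (\esum_(n in [set: nat]) (tp o n x)%:E = (green x)%:E)%E.
Proof.
rewrite /green fineK// ge0_fin_numE; last first.
  by apply: esum_ge0 => n _; rewrite lee_fin tp_ge0.
apply: (@le_lt_trans _ _ (eps ^- depth x * (1 - r^-1)^-1)%:E); last by rewrite ltry.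
apply: esum_geometric_le => [||n].
- by rewrite invr_ge0 exprn_ge0// ltW// (eps_gt0 H).
- have rp : 0 < r := lt_trans ltr01 r_gt1.
  by rewrite invr_ge0 (ltW rp) invf_lt1.
- by rewrite tp_ge0/= (tp_root_le H r_gt1 rM).
Qed.

Local Notation F x := (hitting_prob P X o x).

Lemma hit_measurable y : measurable [set w | exists m : nat, X m w = y].
Proof.
rewrite (_ : [set w | _] = \bigcup_m [set w | X m w = y]).
  by apply: bigcupT_measurable => m; exact: state_measurable MC m y.
by apply/seteqP; split => w /= [m]; exists m.
Qed.

Lemma hittingE y : P o [set w | exists m : nat, X m w = y] = (F y)%:E.
Proof. by rewrite /hitting_prob prob_fineK//; exact: hit_measurable. Qed.

Lemma hitting_le_green y : F y <= green y.
Proof.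
rewrite -lee_fin -hittingE -greenE.
rewrite (_ : [set w | _] = \bigcup_(m in [set: nat]) [set w | X m w = y]); last first.
  by apply/seteqP; split => w /= [m]; exists m.
apply: le_trans (prob_bigcup_count_le _ _) _.
  by move=> m _; exact: state_measurable MC m y.
by apply: le_esum => m _; rewrite (tpE H).
Qed.

Lemma hitting_first_hit y :
  (\esum_(k in [set: nat]) (first_hit_prob y k)%:E = (F y)%:E)%E.
Proof.
rewrite -hittingE.
rewrite (_ : [set w | _] = \bigcup_(k in [set: nat])
    [set w | (forall m, (m < k)%N -> X m w <> y) /\ X k w = y]); last first.
  apply/seteqP; split => w /= [k]; last by move=> _ [_ h]; exists k.
  move=> ky; have ex : exists k, X k w == y by exists k; apply/eqP.
  case: (ex_minnP ex) => m /eqP my mmin; exists m => //; split => // l lm /eqP ly.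
  by move: lm; rewrite ltnNge => /negP; apply; exact: mmin.
rewrite prob_bigcup_count.
- by apply: eq_esum => k _; rewrite first_hit_probE.
- by move=> k _; exact: first_hit_measurable.
- exact: trivIset_first_hit.
Qed.

(** G(o,y) = F(o,y) G(y,y) by decomposition at the first visit, and the spectral gap bounds the last
    factor by K. *)
Lemma green_le_hitting y : green y <= F y * K.
Proof.
rewrite -lee_fin -greenE EFinM.
have dle := diag_sum_le H r_gt1 rM y.
have -> : (\esum_(n in [set: nat]) (tp o n y)%:E = \esum_(n in [set: nat])
    (\sum_(k < n.+1) first_hit_prob y k * tp y (n - k) y)%:E)%E.
  by apply: eq_esum => n _; rewrite first_hit_decomp.
rewrite (esum_conv (a := first_hit_prob y) (b := fun n => tp y n y)).
- rewrite hitting_first_hit; apply: lee_wpmul2l => //.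
  by rewrite lee_fin fine_ge0.
- by move=> n; exact: fine_ge0.
- by move=> n; exact: tp_ge0.
- exact: le_lt_trans dle (ltry _).
Qed.

Lemma hitting_ge y : eps ^+ depth y <= F y.
Proof.
apply: le_trans (tp_from_root H y) _.
rewrite -lee_fin -(tpE H) -hittingE; apply: prob_le.
- exact: state_measurable MC _ _.
- exact: hit_measurable.
- by move=> w h; exists (depth y).
Qed.

Lemma hitting_gt0 y : 0 < F y.
Proof. by apply: lt_le_trans (hitting_ge y); rewrite exprn_gt0// (eps_gt0 H). Qed.

Lemma hitting_le1 y : F y <= 1.
Proof. by rewrite -lee_fin -hittingE; apply: probability_le1; exact: hit_measurable. Qed.

Lemma green_gt0 y : 0 < green y.
Proof. exact: lt_le_trans (hitting_gt0 y) (hitting_le_green y). Qed.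

(** The Green function at the apex, for z = 1, of the walk killed on leaving the cone of a vertex of
    label i. *)
Definition label_ret_sum (i : V) : R := ret_sum P X (cover_rep E i0 i).

Lemma cover_repP x : x != o ->
  cover_rep E i0 (cover_label x) != o /\
  cover_label (cover_rep E i0 (cover_label x)) = cover_label x.
Proof. by move=> xo; rewrite /cover_rep; case: xgetP => [y _ []//|/(_ x) []]. Qed.

Lemma ret_sum_label x : x != o -> ret_sum P X x = label_ret_sum (cover_label x).
Proof.
move=> xo; have [h1 h2] := cover_repP xo.
rewrite /label_ret_sum /ret_sum; congr fine; apply: eq_esum => n _.
by rewrite (ret_prob_label H n xo h1).
Qed.

(** Summed over time, the decomposition at the last entrance is a convolution; the term of time 0
    vanishes because the child is not the root. *)
Lemma green_child x j : E (cover_label x) j ->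
  green (child x j) = green x * (fw (cover_label x) j * label_ret_sum j).
Proof.
move=> Ej; apply: EFin_inj; rewrite -greenE.
have co := child_neq_root Ej.
have -> : (\esum_(n in [set: nat]) (tp o n (child x j))%:E =
  \esum_(n in [set: nat]) (\sum_(k < n.+1) (tp o k x * fw (cover_label x) j) *
     ret_prob P X (child x j) (n - k))%:E)%E.
  rewrite esum_nat_recl; last by move=> n; rewrite lee_fin tp_ge0.
  rewrite (tp0 H) eq_sym (negbTE co) add0e.
  by apply: eq_esum => n _; rewrite (last_exit H r_gt1).
rewrite (esum_conv (a := fun k => tp o k x * fw (cover_label x) j)
  (b := fun n => ret_prob P X (child x j) n)).
- rewrite (ret_sumE H r_gt1 rM) ret_sum_label// label_child//.
  rewrite mulrA [in RHS]EFinM; congr (_ * _)%E.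
  rewrite mulrC EFinM -greenE -esumZl ?(forward_ge0 H)//.
    by apply: eq_esum => k _; rewrite mulrC EFinM.
  by move=> k _; rewrite lee_fin tp_ge0.
- by move=> n; rewrite mulr_ge0 ?tp_ge0 ?(forward_ge0 H).
- by move=> n; exact: ret_prob_ge0.
- by rewrite (ret_sumE H r_gt1 rM) ltry.
Qed.

(* By [green_child], -ln G(o, x) is the sum of these costs along the path to x,
   up to the constant -ln G(o, o). *)
Definition edge_cost (i j : V) : R := - ln (fw i j * label_ret_sum j).

Fixpoint path_cost (i : V) (s : seq V) : R :=
  if s is j :: s' then edge_cost i j + path_cost j s' else 0.

Lemma path_cost_cat i s s' :
  path_cost i (s ++ s') = path_cost i s + path_cost (last i s) s'.
Proof. by elim: s i => [|j s IH] i /=; rewrite ?add0r// IH addrA. Qed.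

Definition green_cost x : R := path_cost i0 (sval x).

Lemma green_cost_child x j : E (cover_label x) j ->
  green_cost (child x j) = green_cost x + edge_cost (cover_label x) j.
Proof.
by move=> Ej; rewrite /green_cost sval_child// -cats1 path_cost_cat/= addr0.
Qed.

Lemma label_ret_sum_bounds x j : E (cover_label x) j -> 1 <= label_ret_sum j <= K.
Proof.
move=> Ej; rewrite -{1 2}(label_child Ej) -ret_sum_label ?child_neq_root//.
by rewrite (ret_sum_ge1 H r_gt1 rM) (ret_sum_le H r_gt1 rM).
Qed.

Lemma edge_weight_gt0 x j : E (cover_label x) j ->
  0 < fw (cover_label x) j * label_ret_sum j.
Proof.
move=> Ej; have /andP[h _] := label_ret_sum_bounds Ej.
by rewrite mulr_gt0 ?(forward_gt0 H)// (lt_le_trans _ h).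
Qed.

Lemma ln_green x : - ln (green x) = - ln (green o) + green_cost x.
Proof.
elim/(@cover_ind V E i0): x => [|x j Ej IH]; first by rewrite /green_cost addr0.
rewrite green_child// lnM ?posrE ?green_gt0 ?edge_weight_gt0//.
by rewrite opprD IH green_cost_child// addrA.
Qed.

Lemma ln_hitting_cost : exists C, forall x, `|- ln (F x) - green_cost x| <= C.
Proof.
exists (`|ln (green o)| + ln K) => x.
have K1 := green_bound_ge1 r_gt1.
have K0 : 0 < K by exact: lt_le_trans K1.
have h1 : - ln (green x) <= - ln (F x).
  by rewrite lerN2 ler_ln ?posrE ?hitting_gt0 ?green_gt0// hitting_le_green.
have h2 : - ln (F x) <= - ln (green x) + ln K.
  rewrite lerNl opprD opprK lerBlDr -lnM ?posrE ?hitting_gt0//.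
  by rewrite ler_ln ?posrE ?green_gt0 ?mulr_gt0 ?hitting_gt0// green_le_hitting.
have lK : 0 <= ln K by rewrite ln_ge0.
move: h1 h2; rewrite ln_green ler_norml.
have := ler_norm (ln (green o)); have := ler_norm (- ln (green o)); rewrite normrN.
by move=> *; apply/andP; split; lra.
Qed.

(** Forward probabilities lie in [eps, 1] and return series in [1, K]. An edge cost has no fixed
    sign, so both logarithms contribute. *)
Definition cost_bound : R := - ln eps + ln K.

Lemma cost_bound_ge0 : 0 <= cost_bound.
Proof.
have K1 := green_bound_ge1 r_gt1.
rewrite /cost_bound addr_ge0 ?ln_ge0// oppr_ge0 ln_le0//; exact: eps_le1 H.
Qed.

Lemma edge_cost_bound x j : E (cover_label x) j ->
  `|edge_cost (cover_label x) j| <= cost_bound.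
Proof.
move=> Ej; have /andP[h1 h2] := label_ret_sum_bounds Ej.
have e0 := eps_gt0 H.
have f1 := forward_le1 H (cover_label x) j.
have f0 := forward_ge_eps H Ej.
have fp : 0 < fw (cover_label x) j by exact: lt_le_trans f0.
have gp : 0 < label_ret_sum j by exact: lt_le_trans h1.
rewrite /edge_cost normrN lnM ?posrE//.
have a1 : ln eps <= ln (fw (cover_label x) j) by rewrite ler_ln ?posrE.
have a2 : ln (fw (cover_label x) j) <= 0 by rewrite ln_le0.
have a3 : 0 <= ln (label_ret_sum j) by rewrite ln_ge0.
have a4 : ln (label_ret_sum j) <= ln K.
  by rewrite ler_ln ?posrE// (lt_le_trans gp h2).
rewrite /cost_bound ler_norml; apply/andP; split; lra.
Qed.

(** Needed to interpolate the cost between the block times at which the strong law applies. *)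
Lemma green_cost_lipschitz x y : adjacent x y ->
  `|green_cost y - green_cost x| <= cost_bound.
Proof.
case=> [[j Ej ->]|[[j Ej ->]|[-> ->]]].
- by rewrite green_cost_child// addrAC subrr add0r edge_cost_bound.
- by rewrite green_cost_child// opprD addrA subrr add0r normrN edge_cost_bound.
- by rewrite subrr normr0 cost_bound_ge0.
Qed.

End GreenEstimates.

Arguments first_hit_prob {R V E i0 d Omega} P X y k.
Arguments green {R V E i0 d Omega} P X x.
Arguments label_ret_sum {R V E i0 d Omega} P X i.
Arguments edge_cost {R V E i0} pG pback {d Omega} P X i j.
Arguments path_cost {R V E i0} pG pback {d Omega} P X i s.
Arguments green_cost {R V E i0} pG pback {d Omega} P X x.
Arguments cost_bound {R} eps r.

(** * Avoidance probabilities and mean return times *)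

Section FirstStep.
Context {R : realType} {S : countType} {d : measure_display}
  {Omega : measurableType d}.
Variables (p : S -> S -> R) (P : S -> probability Omega R)
  (X : nat -> Omega -> S).
Hypothesis MC : markov_chain p P X.

Lemma prob_start x (A : set Omega) : measurable A ->
  P x A = P x (A `&` [set w | X 0%N w = x]).
Proof.
move=> mA; have mS := state_measurable MC 0 x.
apply/eqP; rewrite eq_le; apply/andP; split; last first.
  by apply: prob_le => //; exact: measurableI.
have h : (P x A <= P x ((A `&` [set w | X 0%N w = x]) `|` ~` [set w | X 0%N w = x]))%E.
  apply: prob_le => //.
    by apply: measurableU; [exact: measurableI|exact: measurableC].
  by move=> w Aw; have [h|h] := pselect (X 0%N w = x); [left|right].
apply: le_trans h _.
have h : (P x ((A `&` [set w | X 0%N w = x]) `|` ~` [set w | X 0%N w = x]) <=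
   P x (A `&` [set w | X 0%N w = x]) + P x (~` [set w | X 0%N w = x]))%E.
  by apply: measureU2; [exact: measurableI|exact: measurableC].
apply: le_trans h _.
by rewrite probability_setC// (start_prob MC) eqxx subee// adde0.
Qed.

Lemma step_prob x y : P x [set w | X 1%N w = y] = (p x y)%:E.
Proof.
pose s k := if k is 0%N then x else y.
have := cylinder_prob MC x 1 s; rewrite eqxx mul1r big_ord1/= => <-.
rewrite prob_start; last exact: state_measurable MC 1 y.
congr (P x _); apply/seteqP; split => w /=.
  by move=> [h1 h2] [|[|]].
by move=> h; split; [exact: (h 1%N isT)|exact: (h 0%N isT)].
Qed.

(** Row sums equal to one follow from the existence of a realization; for Q this yields
    stochasticity without computing with [Gbar]. *)
Lemma step_sum x : (\esum_(y in [set: S]) (p x y)%:E = 1)%E.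
Proof.
rewrite -(probability_setT (P x)) (total_prob MC x 1 measurableT).
by apply: eq_esum => y _; rewrite setTI step_prob.
Qed.

Variable a : S.

(** Time 0 is exempt, so that the start at [a] itself describes the tail of the return time. *)
Definition avoid_path (m : nat) : set (nat -> S) :=
  [set s | forall l, (0 < l <= m)%N -> s l <> a].

Lemma avoid_path_depends m : depends_upto m (avoid_path m).
Proof. by move=> s s' ss' h l /andP[l0 lm]; rewrite -ss'//; apply: h; rewrite l0. Qed.

Definition avoid_prob (m : nat) (x : S) : R := fine (P x (path_ev X (avoid_path m))).

Lemma avoid_measurable m : measurable (path_ev X (avoid_path m)).
Proof. exact: (path_ev_measurable MC (@avoid_path_depends m)). Qed.

Lemma avoid_probE m x : P x (path_ev X (avoid_path m)) = (avoid_prob m x)%:E.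
Proof. by rewrite /avoid_prob prob_fineK//; exact: avoid_measurable. Qed.

Lemma avoid_prob_ge0 m x : 0 <= avoid_prob m x. Proof. exact: fine_ge0. Qed.

Lemma avoid_prob0 x : avoid_prob 0 x = 1.
Proof.
apply: EFin_inj; rewrite -avoid_probE -(probability_setT (P x)).
by congr (P x _); apply/seteqP; split => // w _ l /andP[]; case: l.
Qed.

Lemma avoid_prob_step m x :
  (\esum_(y in [set y | y <> a]) (p x y * avoid_prob m y)%:E <= (avoid_prob m.+1 x)%:E)%E.
Proof.
have dA := @avoid_path_depends m.
have -> : (\esum_(y in [set y | y <> a]) (p x y * avoid_prob m y)%:E =
  \esum_(y in [set y | y <> a]) P x [set w | [/\ setT (fun k => X k w), X 1%N w = y &
     avoid_path m (shift_path 1 (fun k => X k w))]])%E.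
  apply: eq_esum => y _; rewrite (markov_property MC _ _ _ dA)//.
  rewrite EFinM avoid_probE -step_prob; congr (_ * _)%E; congr (P x _).
  by apply/seteqP; split => w //= [].
have mF y : measurable [set w | [/\ setT (fun k => X k w), X 1%N w = y &
     avoid_path m (shift_path 1 (fun k => X k w))]].
  apply: (@path_ev_measurable _ _ _ _ _ _ _ MC m.+1 [set s : nat -> S |
    [/\ setT s, s 1%N = y & avoid_path m (shift_path 1 s)]]).
  move=> s s' ss' [_ h1 h2]; split => //; first by rewrite -ss'.
  by apply: dA h2 => k km; rewrite /shift_path ss'// add1n ltnS.
rewrite -prob_bigcup_count; last 2 first.
- by move=> y _; exact: mF.
- by move=> y y' _ _ [w [[_ <- _] [_ <- _]]].
rewrite -avoid_probE; apply: prob_le; [|exact: avoid_measurable|].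
  by apply: bigcup_count_measurable => y _; exact: mF.
move=> w [y ya [_ y1 h]] [|[|l]]//.
  by move=> _; rewrite y1.
by move=> lm; exact: (h l.+1 lm).
Qed.

(** Tail-sum formula: the return time is the sum over m of the indicators of no return up to time
    m. *)
Lemma avoid_prob_sum M :
  ((\sum_(m < M) avoid_prob m a)%:E <= \int[P a]_w return_time X a w)%E.
Proof.
pose f m : Omega -> \bar R := EFin \o \1_(path_ev X (avoid_path m)).
have mf m : measurable_fun [set: Omega] (f m).
  by apply/measurable_EFinP; apply: measurable_indic; exact: avoid_measurable.
have -> : ((\sum_(m < M) avoid_prob m a)%:E = \int[P a]_w \sum_(m < M) f m w)%E.
  rewrite ge0_integral_sum//; last by move=> m w _; rewrite lee_fin.
  rewrite -sumEFin; apply: eq_bigr => m _.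
  by rewrite -avoid_probE -[X in P a X]setIT -integral_indic//; exact: avoid_measurable.
have f1 m w : (forall l, (0 < l <= m)%N -> X l w <> a) -> f m w = 1%E.
  by move=> h; rewrite /f/= indicE mem_set.
have f0 m w n : (0 < n <= m)%N -> X n w = a -> f m w = 0%E.
  by move=> nm na; rewrite /f/= indicE memNset// => h; exact: h nm na.
have f_ge0 m w : (0 <= f m w)%E by rewrite lee_fin.
have rtE : return_time X a = (fun w => \sum_(m <oo) f m w)%E :> (Omega -> \bar R).
  apply/funext => w; apply/eqP; rewrite eq_le; apply/andP; split.
    have [[n [n0 na]]|no] := pselect (exists n, (0 < n)%N /\ X n w = a).
      have ex : exists n, (0 < n)%N && (X n w == a) by exists n; rewrite n0; apply/eqP.
      case: (ex_minnP ex) => k /andP[k0 /eqP ka] kmin.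
      apply: (@le_trans _ _ (k%:R)%:E); first by apply: ereal_inf_lbound; exists k.
      apply: (@le_trans _ _ (\sum_(0 <= m < k) f m w)%E); last exact: nneseries_lim_ge.
      rewrite (eq_big_nat _ _ (F2 := fun=> 1%E)) => [|m /andP[_ mk]]; last first.
        apply: f1 => l /andP[l0 lm] /eqP la.
        by have := kmin l; rewrite l0 la => /(_ isT); rewrite leqNgt (leq_ltn_trans lm mk).
      by rewrite sumEFin big_const_nat subn0 iter_addr_0.
    (* Without a return the infimum of the empty set is +oo, and all indicators equal 1. *)
    rewrite [leRHS](_ : _ = +oo%E) ?leey//; apply: eq_infty => y.
    pose N := Num.bound `|y|.
    apply: (@le_trans _ _ (N%:R)%:E).
      rewrite lee_fin; apply: le_trans (ler_norm _) _.
      by apply: ltW; apply: archi_boundP.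
    apply: (@le_trans _ _ (\sum_(0 <= m < N) f m w)%E); last exact: nneseries_lim_ge.
    rewrite (eq_big_nat _ _ (F2 := fun=> 1%E)) => [|m _]; last first.
      by apply: f1 => l /andP[l0 _] la; apply: no; exists l.
    by rewrite sumEFin big_const_nat subn0 iter_addr_0.
  apply: nneseries_le_bound => // M'; apply: le_ereal_inf_tmp => _ [n [n0 na] <-].
  have [nM|Mn] := leqP n M'.
    rewrite (big_cat_nat (n := n))//= [X in (_ + X)%E](_ : _ = 0%E) ?adde0; last first.
      rewrite big_nat; apply: big1 => m /andP[nm _].
      by apply: (f0 _ _ n) => //; rewrite n0.
    apply: (@le_trans _ _ (\sum_(0 <= m < n) 1%E)%E).
      by apply: lee_sum => m _; rewrite lee_fin indicE lern1 leq_b1.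
    by rewrite sumEFin big_const_nat subn0 iter_addr_0.
  apply: (@le_trans _ _ (\sum_(0 <= m < M') 1%E)%E).
    by apply: lee_sum => m _; rewrite lee_fin indicE lern1 leq_b1.
  by rewrite sumEFin big_const_nat subn0 iter_addr_0 lee_fin ler_nat ltnW.
rewrite rtE; apply: ge0_le_integral => //.
- by move=> w _; apply: sume_ge0 => m _.
- exact: emeasurable_sum.
- exact: ge0_emeasurable_sum.
- move=> w _; rewrite -(big_mkord xpredT (fun m => f m w)); exact: nneseries_lim_ge.
Qed.

End FirstStep.

(** * Last exit times *)

Section SegmentProbabilities.
Context {R : realType} {V : countType} {E : rel V} {i0 : V}
  {pG : V -> V -> R} {pback : V -> R}
  {d : measure_display} {Omega : measurableType d}
  {P : dcover E i0 -> probability Omega R} {X : nat -> Omega -> dcover E i0}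
  {eps : R} (H : cover_walk pG pback P X eps).
Local Notation T := (dcover E i0).
Local Notation o := (cover_root E i0).
Local Notation p := (@cover_trans R V E i0 pG pback).
Local Notation fw := (forward pG pback).
Local Notation MC := (cw_mc H).
Local Notation esc i := (1 - Fback P X i).
Implicit Types (x y z : T) (us : seq (V * nat)).

(* A pair (j, n) encodes an excursion of n - 1 steps in the current cone,
   followed by the step to the child of label j. *)
Fixpoint segments (M : nat) x us (s : nat -> T) : Prop :=
  if us is u :: us' then
    [/\ (0 < u.2)%N /\ E (cover_label x) u.1, ret_path x u.2.-1 s,
        s u.2 = child x u.1 &
        segments M (child x u.1) us' (shift_path u.2 s)]
  else stay_path x M s.

Definition total_time us : nat := sumn [seq u.2 | u <- us].

Definition end_vertex x us : T := foldl (fun y u => child y u.1) x us.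

Lemma segments_depends M x us : depends_upto (total_time us + M) (segments M x us).
Proof.
elim: us x => [|u us IH] x /=; first exact: stay_path_depends.
move=> s s' ss' [h1 h2 h3 h4].
have le1 k : (k <= u.2)%N -> s k = s' k.
  by move=> ku; apply: ss'; rewrite /total_time/= -addnA (leq_trans ku)// leq_addr.
split => //.
- apply: ret_path_depends h2 => k ku; apply: le1.
  by rewrite (leq_trans ku)// leq_pred.
- by rewrite -le1.
- apply: IH h4 => k ku; rewrite /shift_path; apply: ss'.
  by rewrite /total_time/= -addnA leq_add2l.
Qed.

(* None stands for the root, where the loop changes the law of the time. *)
Definition vstate x : option V := if x == o then None else Some (cover_label x).

Definition state_label (st : option V) : V := odflt i0 st.

Definition state_vertex (st : option V) : T :=
  if st is Some i then cover_rep E i0 i else o.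

(** Weight of one segment: n - 1 steps back to the apex inside the cone, then a forward step. The
    test excludes duration 0, which the predecessor would confuse with duration 1. *)
Definition seg_kernel (st : option V) (u : V * nat) : R :=
  if (0 < u.2)%N then
    ret_prob P X (state_vertex st) u.2.-1 * fw (state_label st) u.1 else 0.

Definition seg_next (st : option V) (u : V * nat) : option V := Some u.1.

Lemma seg_kernel_ge0 st u : 0 <= seg_kernel st u.
Proof.
rewrite /seg_kernel; case: ifP => // _.
by rewrite mulr_ge0 ?ret_prob_ge0 ?(forward_ge0 H).
Qed.

Lemma vstate_child x j : E (cover_label x) j -> vstate (child x j) = Some j.
Proof. by move=> Ej; rewrite /vstate (negbTE (child_neq_root Ej)) label_child. Qed.

Lemma state_label_vstate x : state_label (vstate x) = cover_label x.
Proof. by rewrite /vstate; case: eqVneq => [->|]. Qed.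

Lemma ret_prob_vstate x n : ret_prob P X x n = ret_prob P X (state_vertex (vstate x)) n.
Proof.
rewrite /vstate; case: eqVneq => [->//|xo] /=.
have [h1 h2] := cover_repP xo; exact: (ret_prob_label H).
Qed.

Lemma segment_step_prob x j n (A : set (nat -> T)) m : (0 < n)%N ->
  E (cover_label x) j -> depends_upto m A ->
  P x (path_ev X [set s | [/\ ret_path x n.-1 s, s n = child x j & A (shift_path n s)]]) =
  ((ret_prob P X x n.-1 * fw (cover_label x) j)%:E * P (child x j) (path_ev X A))%E.
Proof.
case: n => // n _ Ej dA /=.
have dR : depends_upto n.+1 (ret_path x n).
  by move=> s s' ss'; apply: ret_path_depends => k kn; apply: ss'; rewrite ltnW.
have -> := markov_property MC x (n := n.+1) (m := m) (child x j) dR dA.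
congr (_ * _)%E.
have d1 : depends_upto 1 [set s : nat -> T | s 1%N = child x j].
  by move=> s s' ss' /=; rewrite ss'.
have h := markov_property MC x x (@ret_path_depends _ _ _ x n) d1.
have e1 : [set w | ret_path x n (fun k => X k w) /\ X n w = x] = path_ev X (ret_path x n).
  by apply/seteqP; split => w; [case|move=> h1; split => //; case: h1].
have e2 : path_ev X [set s : nat -> T | s 1%N = child x j] = [set w | X 1%N w = child x j].
  by [].
rewrite e1 e2 (step_prob MC) cover_trans_child// (ret_probE H) -EFinM in h.
rewrite -h; congr (P x _); apply/seteqP; split => w /=.
  by move=> [h1 h2]; split => //; [case: h1|rewrite /shift_path addn1].
by move=> [h1 _ h2]; split => //; move: h2; rewrite /shift_path addn1.
Qed.

(** Iterates the factorization of a single segment; what remains is the probability of staying M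
    steps in the last cone. *)
Lemma segments_prob_le M x us :
  (P x (path_ev X (segments M x us)) <=
   (word_weight seg_kernel seg_next (vstate x) us)%:E *
   P (end_vertex x us) (path_ev X (stay_path (end_vertex x us) M)))%E.
Proof.
elim: us x => [|u us IH] x; first by rewrite mul1e.
have [/andP[u0 Eu]|nu] := boolP ((0 < u.2)%N && E (cover_label x) u.1); last first.
  rewrite (_ : path_ev X _ = set0) ?measure0.
    by rewrite mule_ge0// lee_fin (word_weight_ge0 seg_next seg_kernel_ge0).
  by apply/seteqP; split => // w [[h1 h2] _ _ _]; move: nu; rewrite h1 h2.
have -> : path_ev X (segments M x (u :: us)) = path_ev X [set s |
    [/\ ret_path x u.2.-1 s, s u.2 = child x u.1 &
     segments M (child x u.1) us (shift_path u.2 s)]].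
  by apply/seteqP; split => w [] //= [].
rewrite (segment_step_prob u0 Eu (@segments_depends M (child x u.1) us)).
rewrite /= -[seg_next _ _]/(Some u.1) -(vstate_child Eu).
rewrite [seg_kernel (vstate x) u]/seg_kernel u0 state_label_vstate -ret_prob_vstate.
rewrite [(_ * word_weight _ _ _ _)%:E]EFinM -muleA.
apply: lee_wpmul2l; last exact: IH.
by rewrite lee_fin mulr_ge0 ?ret_prob_ge0 ?(forward_ge0 H).
Qed.

Lemma end_state x us : (forall M s, segments M x us s ->
   vstate (end_vertex x us) = foldl seg_next (vstate x) us).
Proof.
elim: us x => [//|u us IH] x M s /= [[_ Eu] _ _ h].
by rewrite (IH _ _ _ h) vstate_child.
Qed.

Lemma Fback_le1 i : Fback P X i <= 1.
Proof.
rewrite /Fback /hitting_prob -lee_fin prob_fineK.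
  by apply: probability_le1; exact: (hit_measurable H).
exact: (hit_measurable H).
Qed.

(** Lets M tend to infinity: the probability of staying decreases to that of never leaving the cone,
    and a trajectory that never leaves the cone never meets the parent, whence the bound 1 -
    F(-i). *)
Lemma le_esc x (v W : R) : x != o -> 0 <= W ->
  (forall M, (v%:E <= W%:E * P x (path_ev X (stay_path x M)))%E) ->
  v <= W * esc (cover_label x).
Proof.
move=> xo W0 h.
have [yo yx] := cover_repP xo; set y := cover_rep E i0 (cover_label x) in yo yx *.
have mS M : measurable (path_ev X (stay_path y M)).
  exact: (path_ev_measurable MC (@stay_path_depends _ _ _ y M)).
pose Sinf := \bigcap_M path_ev X (stay_path y M).
have mI : measurable Sinf by exact: bigcapT_measurable.
have cv : P y (path_ev X (stay_path y M)) @[M --> \oo] --> P y Sinf.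
  apply: nonincreasing_cvg_mu => //.
    by rewrite (le_lt_trans (probability_le1 _ _))// ltry.
  move=> m n mn; apply/subsetPset => w hw k km; apply: hw.
  exact: leq_trans mn.
have Ple : (P y Sinf <= (esc (cover_label x))%:E)%E.
  rewrite EFinB /Fback /hitting_prob prob_fineK; last exact: (hit_measurable H).
  rewrite -probability_setC; last exact: (hit_measurable H).
  apply: prob_le => //; first by apply: measurableC; exact: (hit_measurable H).
  move=> w Sw [m hm]; have := Sw m I m (leqnn m); rewrite /= hm.
  exact/negP/parent_notin_cone.
rewrite -lee_fin EFinM.
apply: (@le_trans _ _ (W%:E * P y Sinf)%E); last by rewrite lee_wpmul2l.
have cv2 : (W%:E * P y (path_ev X (stay_path y M)))%E @[M --> \oo] --> (W%:E * P y Sinf)%E.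
  exact: cvgeZl.
rewrite -(cvg_lim _ cv2)//; apply: lime_ge; first by apply/cvg_ex; eexists; exact: cv2.
by apply: nearW => M; have := h M; rewrite (stay_prob_label H M xo yo).
Qed.

(** All horizons M together force the walk to remain in the last cone forever, so each letter ends
    at a true last exit. *)
Definition exit_event us : set Omega :=
  [set w | forall M, segments M o us (fun k => X k w)].

Lemma exit_event_measurable us : measurable (exit_event us).
Proof.
rewrite (_ : exit_event us = \bigcap_M path_ev X (segments M o us)).
  apply: bigcapT_measurable => M.
  exact: (path_ev_measurable MC (@segments_depends M o us)).
by apply/seteqP; split => [w h M _|w h M]; [exact: h|exact: (h M I)].
Qed.

Definition state_esc (st : option V) : R := if st is Some i then esc i else 1.

Lemma state_esc_ge0 st : 0 <= state_esc st.
Proof. by case: st => [i|] //=; rewrite subr_ge0 Fback_le1. Qed.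

(** The escape probability of the final cone is kept because it is the function h of the h-transform
    from the kernel to Q. *)
Lemma exit_event_prob us :
  (P o (exit_event us) <= (1 * word_weight seg_kernel seg_next None us *
     state_esc (foldl seg_next None us))%:E)%E.
Proof.
have [us0|usn] := eqVneq us [::].
  by rewrite us0 /= !mulr1 probability_le1//; exact: exit_event_measurable.
have W0 := word_weight_ge0 seg_next seg_kernel_ge0 None us.
have [[w hw]|no] := pselect (exists w, exit_event us w); last first.
  rewrite (_ : exit_event us = set0) ?measure0; last first.
    by apply/seteqP; split => // w hw; apply: no; exists w.
  by rewrite lee_fin !mulr_ge0 ?state_esc_ge0.
have := end_state (hw 0%N); rewrite {2}/vstate eqxx => es.
have xo : end_vertex o us != o.
  apply: contraNneq usn => eo; move: es; rewrite eo /vstate eqxx.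
  by case/lastP: (us) => // us' u; rewrite foldl_rcons.
move: es; rewrite {1}/vstate (negbTE xo) => <-; rewrite mul1r /=.
rewrite -[P o _]prob_fineK; last exact: exit_event_measurable.
rewrite lee_fin; apply: le_esc => // M.
rewrite prob_fineK; last exact: exit_event_measurable.
have := segments_prob_le M o us; rewrite {1}/vstate eqxx; apply: le_trans.
apply: prob_le; first exact: exit_event_measurable.
  exact: (path_ev_measurable MC (@segments_depends M o us)).
by move=> w'; apply.
Qed.

End SegmentProbabilities.

Arguments seg_kernel {R V} E i0 pG pback {d Omega} P X st u.
Arguments exit_event {V E i0 d Omega} X us.
Arguments state_label {V} i0 st.
Arguments state_esc {R V E i0 d Omega} P X st.

(** * Recurrence of the label i0 *)

(** Write (1 + g) / 2 = b g with b > 1; Bernoulli's inequality for b^n absorbs the linear factor. *)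
Lemma linear_geometric (R : realType) (g : R) : 0 < g < 1 ->
  exists c, 0 <= c /\ forall n, n.+1%:R * g ^+ n <= c * ((1 + g) / 2) ^+ n.
Proof.
move=> /andP[g0 g1].
pose b : R := (1 + g) / (2 * g).
have b1 : 1 < b by rewrite /b ltr_pdivlMr ?mulr_gt0//; lra.
have bm : 0 < b - 1 by lra.
exists (1 + (b - 1)^-1); split; first by rewrite addr_ge0// invr_ge0 ltW.
move=> n.
have -> : (1 + g) / 2 = b * g by rewrite /b; field; rewrite gt_eqF.
rewrite exprMn mulrA; apply: ler_wpM2r; first by rewrite exprn_ge0// ltW.
have c0 : 0 <= 1 + (b - 1)^-1 by rewrite addr_ge0// invr_ge0 ltW.
apply: le_trans (ler_wpM2l c0 (bernoulli_inequality n (ltW b1))).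
rewrite -natr1.
have n0 : 0 <= n%:R :> R by [].
have ib : (b - 1)^-1 * (b - 1) = 1 by rewrite mulVf// gt_eqF.
have ip : 0 <= (b - 1)^-1 by rewrite invr_ge0 ltW.
have -> : (1 + (b - 1)^-1) * (1 + n%:R * (b - 1)) =
  1 + n%:R * (b - 1) + (b - 1)^-1 + n%:R * ((b - 1)^-1 * (b - 1)) by ring.
rewrite ib mulr1.
have := mulr_ge0 n0 (ltW bm); lra.
Qed.

Section Recurrence.
Context {R : realType} {V : countType} {E : rel V} {i0 : V}
  {pG : V -> V -> R} {pback : V -> R}
  {d : measure_display} {Omega : measurableType d}
  {P : dcover E i0 -> probability Omega R} {X : nat -> Omega -> dcover E i0}
  {eps : R} (H : cover_walk pG pback P X eps).
Local Notation T := (dcover E i0).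
Local Notation o := (cover_root E i0).
Local Notation p := (@cover_trans R V E i0 pG pback).
Local Notation fw := (forward pG pback).
Local Notation MC := (cw_mc H).
Local Notation esc i := (1 - Fback P X i).
Local Notation kernel := (seg_kernel E i0 pG pback P X).
Local Notation next := (@seg_next V).
Local Notation tp := (tp P X).
Implicit Types (x y z : T) (us : seq (V * nat)).

Variables (r M : R).
Hypotheses (r_gt1 : 1 < r) (rM : forall n, tp o n o * r ^+ n <= M).
Local Notation K := (green_bound r).
Local Notation q := (exit_matrix pG pback P X).

(* rho m i bounds the probability that the chain with matrix q started at i
   avoids i0 at the times 1, ..., m. *)
Variables (rho : nat -> V -> R) (Rb : R).
Hypotheses (labels_rep : forall i, exists x : T, x != o /\ cover_label x = i)
  (q_sum : forall i, (\esum_(j in [set: V]) (q i j)%:E = 1)%E)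
  (rho_ge0 : forall m i, 0 <= rho m i)
  (rho0 : forall i, rho 0 i = 1)
  (rho_step : forall m i, (\esum_(j in [set j | j <> i0]) (q i j * rho m j)%:E <=
      (rho m.+1 i)%:E)%E)
  (rho_sum : forall N, \sum_(m < N) rho m i0 <= Rb).

Let kernel_ge0 := seg_kernel_ge0 H.

Lemma rep_neq_root i : cover_rep E i0 i != o.
Proof. by have [x [xo <-]] := labels_rep i; have [] := cover_repP xo. Qed.

Lemma esc_ge0 i : 0 <= esc i.
Proof. by rewrite subr_ge0 (Fback_le1 H). Qed.

(** If 1 - F(-i) vanished, the convention 1/0 = 0 would make row i of Q zero, against its sum
    one. *)
Lemma esc_gt0 i : 0 < esc i.
Proof.
rewrite lt_def esc_ge0 andbT; apply/eqP => e.
have := q_sum i; rewrite esum1.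
  by move=> /eqP; rewrite eqe eq_sym oner_eq0.
by move=> j _; rewrite /exit_matrix e invr0 mulr0 !mul0r.
Qed.

Lemma Gbar_ge0 i : 0 <= Gbar P X i.
Proof. by rewrite /Gbar fine_ge0// nneseries_ge0. Qed.

(** A walk inside the cone of x does not meet the parent of x. The spectral gap makes the series of
    [Gbar] finite, so [fine] preserves its value. *)
Lemma label_ret_sum_le_Gbar i : label_ret_sum P X i <= Gbar P X i.
Proof.
have xo := rep_neq_root i.
rewrite /label_ret_sum /Gbar; set x := cover_rep E i0 i in xo *.
pose A n := [set w | X n w = x /\ forall m, (m < n)%N -> X m w <> cover_parent x].
have mA n : measurable (A n).
  apply: (@path_ev_measurable _ _ _ _ _ _ _ MC n
    [set s : nat -> T | s n = x /\ forall m, (m < n)%N -> s m <> cover_parent x]).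
  move=> s s' ss' [h1 h2]; split; first by rewrite -ss'.
  by move=> m mn; rewrite -(ss' m (ltnW mn)); exact: h2.
have Ale n : (P x (A n) <= (r^-1 ^+ n)%:E)%E.
  apply: (@le_trans _ _ (tp x n x)%:E); last by rewrite lee_fin (tp_diag H r_gt1 rM).
  rewrite -(tpE H); apply: prob_le => //; first exact: state_measurable MC n x.
  by move=> w [].
rewrite -lee_fin -(ret_sumE H r_gt1 rM) nneseries_esumT// fineK; last first.
  rewrite ge0_fin_numE; last by apply: esum_ge0 => n _.
  apply: (@le_lt_trans _ _ (1 * (1 - r^-1)^-1)%:E); last by rewrite ltry.
  rewrite (eq_esum (b := fun n => (fine (P x (A n)))%:E)); last first.
    by move=> n _; rewrite prob_fineK.
  apply: esum_geometric_le => // [|n].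
    have rp : 0 < r := lt_trans ltr01 r_gt1.
    by rewrite invr_ge0 (ltW rp) invf_lt1.
  by rewrite fine_ge0//= mul1r -lee_fin prob_fineK.
apply: le_esum => n _; rewrite -(ret_probE H); apply: prob_le.
- exact: (ret_measurable H).
- exact: (mA n).
move=> w [h1 h2]; split => // m mn e.
by have := h1 m (ltnW mn); rewrite e (negbTE (parent_notin_cone xo)).
Qed.

Lemma Gbar_ge1 i : 1 <= Gbar P X i.
Proof.
exact: le_trans (ret_sum_ge1 H r_gt1 rM _) (label_ret_sum_le_Gbar i).
Qed.

(** At the root the loop invalidates the comparison with [Gbar i0]; as [Gbar] is at least 1, the
    factor K restores it. *)
Definition state_const (st : option V) : R := if st is Some _ then 1 else K.

Lemma state_const_ge0 st : 0 <= state_const st.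
Proof.
case: st => [i|] //=; exact: le_trans ler01 (green_bound_ge1 r_gt1).
Qed.

Lemma state_ret_sum_le st :
  ret_sum P X (state_vertex st) <= state_const st * Gbar P X (state_label i0 st).
Proof.
case: st => [i|] /=; first by rewrite mul1r; exact: label_ret_sum_le_Gbar.
apply: le_trans (ret_sum_le H r_gt1 rM o) _.
rewrite ler_peMr ?Gbar_ge1//; exact: le_trans ler01 (green_bound_ge1 r_gt1).
Qed.

Lemma exit_matrix_ge0 i j : 0 <= q i j.
Proof.
have h1 := esc_ge0 j; have h2 : 0 <= (esc i)^-1 by rewrite invr_ge0 esc_ge0.
apply: mulr_ge0; last exact: Gbar_ge0.
by apply: mulr_ge0; [exact: mulr_ge0|exact: (forward_ge0 H)].
Qed.

(** The h-transform with h = 1 - F(-i), cleared of its denominator. *)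
Lemma exit_matrixE i j : esc i * q i j = Gbar P X i * fw i j * esc j.
Proof.
have e : esc i / esc i = 1 by rewrite divff// gt_eqF// esc_gt0.
rewrite /exit_matrix.
have -> : esc i * (esc j / esc i * fw i j * Gbar P X i) =
  (esc i / esc i) * (Gbar P X i * fw i j * esc j) by ring.
by rewrite e mul1r.
Qed.

Lemma kernel_sum st (phi : V -> R) : (forall j, 0 <= phi j) ->
  (\esum_(u in [set: V * nat]) (kernel st u * phi u.1)%:E =
   \esum_(j in [set: V])
     (ret_sum P X (state_vertex st) * fw (state_label i0 st) j * phi j)%:E)%E.
Proof.
move=> phi0.
have -> : [set: V * nat] = [set: V] `*`` (fun=> [set: nat]) by apply/seteqP.
rewrite -(esum_esum (a := fun j n => (kernel st (j, n) * phi j)%:E)); last first.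
  by move=> j n _ _; rewrite lee_fin mulr_ge0.
apply: eq_esum => j _.
rewrite esum_nat_recl; last by move=> n; rewrite lee_fin mulr_ge0.
rewrite [kernel st (j, 0%N)]/seg_kernel/= mul0r add0e.
have c0 : 0 <= fw (state_label i0 st) j * phi j by rewrite mulr_ge0 ?(forward_ge0 H).
rewrite -mulrA mulrC EFinM -(ret_sumE H r_gt1 rM) -esumZl//.
  by apply: eq_esum => n _; rewrite /seg_kernel/= -EFinM; congr EFin; ring.
by move=> n _; rewrite lee_fin ret_prob_ge0.
Qed.

(** Durations have geometric tails uniformly in the state, so weighting by the duration costs only a
    constant. *)
Lemma kernel_time_sum : exists C1, 0 <= C1 /\ forall st (phi : V -> R),
  (forall j, 0 <= phi j) ->
  (\esum_(u in [set: V * nat]) (kernel st u * (u.2)%:R * phi u.1)%:E <=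
   \esum_(j in [set: V]) (C1 * fw (state_label i0 st) j * phi j)%:E)%E.
Proof.
have rp : 0 < r := lt_trans ltr01 r_gt1.
have ri : 0 < r^-1 < 1 by rewrite invr_gt0 rp invf_lt1.
have [c [c0 hc]] := linear_geometric ri.
pose g := (1 + r^-1) / 2.
have g01 : 0 <= g < 1 by move: ri; rewrite /g; lra.
exists (c * (1 - g)^-1); split.
  by rewrite mulr_ge0// invr_ge0; move: g01; lra.
move=> st phi phi0.
have -> : [set: V * nat] = [set: V] `*`` (fun=> [set: nat]) by apply/seteqP.
rewrite -(esum_esum (a := fun j n => (kernel st (j, n) * n%:R * phi j)%:E)); last first.
  by move=> j n _ _; rewrite lee_fin !mulr_ge0.
apply: le_esum => j _.
rewrite esum_nat_recl; last by move=> n; rewrite lee_fin !mulr_ge0.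
rewrite [kernel st (j, 0%N)]/seg_kernel/= !mul0r add0e.
have a0 : 0 <= fw (state_label i0 st) j * phi j by rewrite mulr_ge0 ?(forward_ge0 H).
rewrite -mulrA mulrC EFinM.
apply: (@le_trans _ _ ((fw (state_label i0 st) j * phi j)%:E *
   \esum_(n in [set: nat]) (n.+1%:R * ret_prob P X (state_vertex st) n)%:E)%E).
  rewrite -esumZl//; last by move=> n _; rewrite lee_fin mulr_ge0// ret_prob_ge0.
  apply: le_esum => n _; rewrite /seg_kernel/= -EFinM lee_fin le_eqVlt.
  by apply/orP; left; apply/eqP; ring.
apply: lee_wpmul2l; first by rewrite lee_fin.
apply: esum_geometric_le => // n; rewrite mulr_ge0 ?ret_prob_ge0//=.
by apply: le_trans (hc n); rewrite ler_wpM2l// (ret_prob_le H r_gt1 rM).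
Qed.

(** Summing out the duration leaves the return series times the forward probability; comparison with
    [Gbar] then gives one step of Q conjugated by the escape probability. *)
Lemma kernel_esc_le st (phi : V -> R) : (forall j, 0 <= phi j) ->
  (\esum_(u in [set: V * nat]) (kernel st u * (esc u.1 * phi u.1))%:E <=
   (state_const st * esc (state_label i0 st))%:E *
     \esum_(j in [set: V]) (q (state_label i0 st) j * phi j)%:E)%E.
Proof.
move=> phi0.
rewrite (kernel_sum st (phi := fun j => esc j * phi j)); last first.
  by move=> j; rewrite mulr_ge0 ?esc_ge0.
rewrite -esumZl; last 2 first.
- by rewrite mulr_ge0 ?state_const_ge0 ?esc_ge0.
- by move=> j _; rewrite lee_fin mulr_ge0 ?exit_matrix_ge0.
apply: le_esum => j _; rewrite -EFinM lee_fin.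
have -> : state_const st * esc (state_label i0 st) * (q (state_label i0 st) j * phi j) =
   state_const st * (esc (state_label i0 st) * q (state_label i0 st) j) * phi j by ring.
rewrite exit_matrixE.
set f := fw _ _; set e := esc j; set A := ret_sum _ _ _; set c := state_const _.
have -> : A * f * (e * phi j) = A * (f * (e * phi j)) by ring.
have -> : c * (Gbar P X (state_label i0 st) * f * e) * phi j =
  c * Gbar P X (state_label i0 st) * (f * (e * phi j)) by ring.
apply: ler_wpM2r; last exact: state_ret_sum_le.
apply: mulr_ge0; first exact: (forward_ge0 H).
by apply: mulr_ge0 => //; exact: esc_ge0.
Qed.

Definition avoiding : set (seq (V * nat)) := [set t | all (fun u => u.1 != i0) t].

Local Notation hsum m st := (word_sum kernel next m st
  (fun t => if t \in avoiding then (state_esc P X (foldl next st t))%:E else 0%E)).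

Lemma avoiding_cons u t : (u :: t \in avoiding) = (u.1 != i0) && (t \in avoiding).
Proof.
by apply/idP/andP => [/set_mem /= /andP[h1 h2]|[h1 /set_mem h2]];
  [split => //; exact: mem_set|apply: mem_set; rewrite /avoiding/= h1].
Qed.

(** Induction on the length: each letter is one step of Q to a label other than [i0], handled by
    [rho_step]. From the root the first letter costs K, and the bound starts at length 1 because
    [state_esc] at the root is 1. *)
Lemma avoiding_sum_le m :
  (forall i, (hsum m (Some i) <= (esc i * rho m i)%:E)%E) /\
  (hsum m.+1 None <= (K * esc i0 * rho m.+1 i0)%:E)%E.
Proof.
have step m' st : (forall i, (hsum m' (Some i) <= (esc i * rho m' i)%:E)%E) ->
   (hsum m'.+1 st <= (state_const st * esc (state_label i0 st) *
     rho m'.+1 (state_label i0 st))%:E)%E.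
  move=> IH /=.
  pose phi j := if j != i0 then rho m' j else 0.
  have phi0 j : 0 <= phi j by rewrite /phi; case: ifP.
  apply: (@le_trans _ _ (\esum_(u in [set: V * nat]) (kernel st u * (esc u.1 * phi u.1))%:E)%E).
    apply: le_esum => u _; rewrite EFinM lee_wpmul2l ?lee_fin//.
    rewrite /phi; case: ifPn => ui0.
      apply: le_trans (IH u.1); apply: le_word_sum => // t _.
      by rewrite avoiding_cons ui0.
    rewrite mulr0 (@eq_word_sum _ _ _ _ _ kernel_ge0 _ _ _ (fun=> 0%:E * 0)%E).
      rewrite word_sumZ// mul0e//.
    by move=> t _; rewrite avoiding_cons (negbTE ui0) mul0e.
  apply: le_trans (kernel_esc_le st phi0) _.
  rewrite [leRHS]EFinM lee_wpmul2l//.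
    by rewrite lee_fin mulr_ge0 ?state_const_ge0 ?esc_ge0.
  apply: le_trans (rho_step m' (state_label i0 st)).
  rewrite [leRHS]esum_mkcond; apply: le_esum => j _; rewrite /phi.
  case: ifPn => [ji0|_]; first by rewrite ifT// inE; exact/eqP.
  by rewrite mulr0; case: ifP; rewrite // lee_fin mulr_ge0 ?exit_matrix_ge0.
have A : forall m', forall i, (hsum m' (Some i) <= (esc i * rho m' i)%:E)%E.
  elim=> [|m' IH] i; last by have := step m' (Some i) IH; rewrite /= mul1r.
  by rewrite /= mem_set// rho0 mulr1.
by split; [exact: A|exact: (step m None (A m))].
Qed.

Lemma rho_small (e : R) : 0 < e -> exists m, rho m.+1 i0 < e.
Proof.
move=> e0; apply: contrapT => no.
have lb m : e <= rho m.+1 i0 by rewrite leNgt; apply/negP => h; apply: no; exists m.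
pose N := Num.bound `|Rb / e|.
have hN : Rb / e < N%:R.
  by apply: le_lt_trans (ler_norm _) (archi_boundP _); exact: normr_ge0.
have := rho_sum N.+1; rewrite big_ord_recl.
apply/negP; rewrite -ltNge; apply: ltr_wpDl => //.
apply: (@lt_le_trans _ _ (\sum_(m < N) e)).
  by rewrite sumr_const card_ord -mulr_natr mulrC -ltr_pdivrMr.
by apply: ler_sum => m _; exact: lb.
Qed.

(** After a prefix ending at [i0], the probability that the next m + 1 exit labels all avoid [i0] is
    at most a constant times rho (m + 1) at [i0], which is arbitrarily small for suitable m. The
    root counts as a vertex of label [i0]. *)
Lemma no_later_visit_null us : state_label i0 (foldl next None us) = i0 ->
  (P o).-negligible [set w | forall m, word_event (exit_event X) m us avoiding w].
Proof.
set st := foldl next None us => sti0.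
have W0 := word_weight_ge0 next kernel_ge0 None us.
set W := word_weight kernel next None us in W0.
have bnd m : (P o (word_event (exit_event X) m.+1 us avoiding) <=
    (W * (K * esc i0) * rho m.+1 i0)%:E)%E.
  have := @word_event_le _ _ _ kernel next kernel_ge0 _ _ (P o) (exit_event X) 1 None
    (state_esc P X) (exit_event_measurable H) ler01 (state_esc_ge0 H)
    (exit_event_prob H) m.+1 us avoiding.
  rewrite mul1r => /le_trans; apply; rewrite -/W -/st -mulrA EFinM.
  apply: lee_wpmul2l; first by rewrite lee_fin.
  have [h1 h2] := avoiding_sum_le m; have [h3 _] := avoiding_sum_le m.+1.
  move: sti0; case: (st) => [i|] /= sti0; last exact: h2.
  rewrite sti0; apply: le_trans (h3 i0) _; rewrite lee_fin.
  rewrite -mulrA ler_peMl ?(green_bound_ge1 r_gt1)//.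
  by rewrite mulr_ge0 ?esc_ge0.
apply: negligible_eps => k.
pose B := W * (K * esc i0).
have B0 : 0 <= B.
  rewrite !mulr_ge0 ?esc_ge0//; exact: le_trans ler01 (green_bound_ge1 r_gt1).
have [m hm] : exists m, rho m.+1 i0 < (k.+1%:R^-1) / (B + 1).
  by apply: rho_small; rewrite divr_gt0 ?invr_gt0// ltr_wpDl.
exists (word_event (exit_event X) m.+1 us avoiding); split.
- exact: (word_event_measurable (exit_event_measurable H)).
- by move=> w; apply.
- apply: le_trans (bnd m) _; rewrite lee_fin -/B.
  apply: le_trans (ler_wpM2l B0 (ltW hm)) _.
  rewrite mulrCA -[leRHS]mulr1 ler_wpM2l ?invr_ge0//.
  by rewrite ler_pdivrMr ?ltr_wpDl// mul1r lerDl.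
Qed.

(** Borel-Cantelli, from the finiteness of G(o, x). *)
Lemma finite_visits_ae x : {ae P o, forall w, exists n0, forall n, (n0 <= n)%N -> X n w <> x}.
Proof.
pose F n := [set w | X n w = x].
have mF n : measurable (F n) by exact: state_measurable MC n x.
exists (lim_sup_set F); split.
- by apply: bigcapT_measurable => i; apply: bigcup_measurable => j _; exact: mF.
- apply: lim_sup_set_cvg0 => //.
  rewrite nneseries_esumT// (eq_esum (b := fun n => (tp o n x)%:E)).
    by rewrite (greenE H r_gt1 rM) ltry.
  by move=> n _; exact: (tpE H).
- move=> w /= h n _; apply: contrapT => h'; apply: h; exists n => m nm.
  by move=> e; apply: h'; exists m.
Qed.

End Recurrence.

(** * Exit sequence of a single trajectory *)

Section ExitSequence.
Context {V : countType} {E : rel V} {i0 : V}.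
Local Notation T := (dcover E i0).
Local Notation o := (cover_root E i0).

(** Purely deterministic: the next exit time is one more than the last visit to the current apex. *)
Lemma exit_sequence (s : nat -> T) : s 0%N = o -> adjacent_path s ->
  (forall x, exists n0, forall n, (n0 <= n)%N -> s n <> x) ->
  exists u : nat -> V * nat, forall k M, segments M o (mkseq u k) s.
Proof.
move=> s0 adj fin.
pose inv e := forall m, (e <= m)%N -> in_cone (s e) (s m).
pose step e e' := [/\ (e < e')%N, s e'.-1 = s e,
  exists2 j, E (cover_label (s e)) j & s e' = child (s e) j & inv e'].
have ex_step e : exists e', inv e -> step e e'.
  have [ie|nie] := pselect (inv e); last by exists 0%N.
  have [n0 hn0] := fin (s e).
  pose Q n := (e <= n)%N && (s n == s e).
  have Qex : exists n, Q n by exists e; rewrite /Q leqnn eqxx.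
  have Qub n : Q n -> (n <= n0)%N.
    move=> /andP[_ /eqP h]; rewrite leqNgt; apply/negP => /ltnW /hn0; exact.
  case: (ex_maxnP Qex Qub) => n /andP[en /eqP sn] nmax.
  have after m : (n < m)%N -> s m <> s e.
    move=> nm e'; have : Q m by rewrite /Q (leq_trans en (ltnW nm)) e' eqxx.
    by move/nmax; rewrite leqNgt nm.
  exists n.+1 => _; rewrite /step /= ltnS en.
  have ic m : (n < m)%N -> in_cone (s e) (s m).
    by move=> nm; apply: ie; exact: leq_trans en (ltnW nm).
  (* After the last visit the step must go to a child: the parent lies outside the cone, and the
     loop at the root would be another visit. *)
  have [j Ej sj] : exists2 j, E (cover_label (s e)) j & s n.+1 = child (s e) j.
    have := adj n; rewrite sn; case=> [//|[[j Ej cj]|[h1 h2]]].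
      exfalso; have := in_cone_depth (ic n.+1 (ltnSn n)).
      by rewrite {1}cj depth_child// ltnn.
    by exfalso; apply: (after n.+1 (ltnSn n)); rewrite h1 h2.
  split => //; first by exists j.
  move=> m nm; rewrite -(subnKC nm); elim: (m - n.+1)%N => [|l IH].
    by rewrite addn0 in_cone_refl.
  (* Leaving the cone of the child would lead back to [s e], which is no longer visited. *)
  rewrite addnS; apply: contrapT => /negP ncone.
  have [h1 [j' Ej' h2]] := leave_cone (adj (n.+1 + l)%N) IH ncone.
  apply: (after (n.+1 + l).+1); first by rewrite ltnS (leq_trans _ (leq_addr _ _)).
  by rewrite -(parent_child Ej') -h2 sj parent_child.
have [f hf] := choice ex_step.
pose e n := iter n f 0%N.
have inv_e n : inv (e n).
  elim: n => [|n IH]; first by move=> m _; rewrite /e/= s0 in_cone_root.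
  by have [] := hf _ IH.
have step_e n : step (e n) (e n.+1) by apply: hf; exact: inv_e.
pose u k := (cover_label (s (e k.+1)), (e k.+1 - e k)%N).
have key k l M : segments M (s (e l)) [seq u i | i <- iota l k] (shift_path (e l) s).
  elim: k l => [|k IH] l; first by move=> m _; apply: inv_e; exact: leq_addr.
  have [lt sp [j Ej sj] _] := step_e l.
  have uj : (u l).1 = j by rewrite /u/= sj label_child.
  have ut : (e l + (u l).2 = e l.+1)%N by rewrite /u/= subnKC// ltnW.
  have up : (0 < (u l).2)%N by rewrite /u/= subn_gt0.
  suff : [/\ (0 < (u l).2)%N /\ E (cover_label (s (e l))) (u l).1,
      ret_path (s (e l)) (u l).2.-1 (shift_path (e l) s),
      shift_path (e l) s (u l).2 = child (s (e l)) (u l).1 &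
      segments M (child (s (e l)) (u l).1) [seq u i | i <- iota l.+1 k]
        (shift_path (u l).2 (shift_path (e l) s))] by [].
  rewrite uj; split => //.
  - split => [m _|]; first by apply: inv_e; exact: leq_addr.
    by rewrite -[RHS]sp /shift_path -ut; congr s; rewrite -subn1 addnBA// subn1.
  - by rewrite /shift_path ut.
  - rewrite -sj; have := IH l.+1.
    rewrite (_ : shift_path (e l.+1) s = shift_path (u l).2 (shift_path (e l) s))//.
    by apply/funext => m; rewrite /shift_path addnA ut.
exists u => k M; have := key k 0%N M.
by rewrite /e/= s0 (_ : shift_path 0 s = s)//; apply/funext.
Qed.

End ExitSequence.

(** * Blocks between visits of i0 *)

Section WordSeries.
Context {R : realType} {S : Type} {C : countType}.
Variables (k : S -> C -> R) (next : S -> C -> S).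
Hypothesis k_ge0 : forall s c, 0 <= k s c.
Local Open Scope ereal_scope.

(** Words of all lengths below N at once: the truncation allows induction on N where the full series
    is not yet known to be finite. *)
Definition word_series (N : nat) (s : S) (Phi : seq C -> \bar R) : \bar R :=
  \sum_(0 <= n < N) word_sum k next n s Phi.

Lemma word_series_rec N s (Phi : seq C -> \bar R) : (forall t, 0 <= Phi t) ->
  word_series N.+1 s Phi = Phi [::] + \esum_(c in [set: C])
    ((k s c)%:E * word_series N (next s c) (fun t => Phi (c :: t))).
Proof.
move=> Phi0; rewrite /word_series big_nat_recl//=; congr (_ + _).
rewrite -esum_sum.
  apply: eq_esum => c _; rewrite ge0_sume_distrr// => n _.
  exact: word_sum_ge0.
by move=> c n _ _; rewrite mule_ge0 ?lee_fin ?word_sum_ge0.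
Qed.

Lemma le_word_series N s Phi Psi :
  (forall t, Phi t <= Psi t) -> word_series N s Phi <= word_series N s Psi.
Proof. by move=> h; apply: lee_sum => n _; apply: le_word_sum. Qed.

Lemma word_seriesD N s Phi Psi : (forall t, 0 <= Phi t) -> (forall t, 0 <= Psi t) ->
  word_series N s (fun t => Phi t + Psi t) = word_series N s Phi + word_series N s Psi.
Proof.
move=> h1 h2; rewrite /word_series -big_split/=; apply: eq_bigr => n _.
exact: word_sumD.
Qed.

Lemma word_seriesZ N s (a : R) Phi : (0 <= a)%R -> (forall t, 0 <= Phi t) ->
  word_series N s (fun t => a%:E * Phi t) = a%:E * word_series N s Phi.
Proof.
move=> a0 h; rewrite /word_series ge0_sume_distrr => [|n _]; last exact: word_sum_ge0.
by apply: eq_bigr => n _; rewrite word_sumZ.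
Qed.

Lemma word_series_nil N s (a : R) : (0 <= a)%R ->
  word_series N s (fun t => if t == [::] then a%:E else 0) <= a%:E.
Proof.
move=> a0; case: N => [|N]; first by rewrite /word_series big_geq// lee_fin.
rewrite word_series_rec/= => [|t]; last by case: ifP.
rewrite esum1 ?adde0// => c _.
rewrite (_ : word_series _ _ _ = 0) ?mule0//=.
transitivity (word_series N (next s c) (fun=> 0%:E * 0)).
  by congr word_series; apply/funext => t; rewrite mul0e.
by rewrite word_seriesZ// mul0e.
Qed.

Lemma word_sum_esum n s (Phi : seq C -> \bar R) : (forall t, 0 <= Phi t) ->
  word_sum k next n s Phi =
  \esum_(t in [set t | size t = n]) ((word_weight k next s t)%:E * Phi t).
Proof.
elim: n s Phi => [|n IH] s Phi Phi0.
  rewrite (_ : [set t | _] = [set [::]]); last first.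
    by apply/seteqP; split => [t /size0nil|t ->].
  by rewrite esum_set1/= mul1e.
rewrite [LHS]/=.
have -> : \esum_(t in [set t | size t = n.+1]) ((word_weight k next s t)%:E * Phi t) =
  \esum_(ct in [set: C] `*`` (fun=> [set t | size t = n]))
    ((word_weight k next s (ct.1 :: ct.2))%:E * Phi (ct.1 :: ct.2)).
  apply: (reindex_esum _ _ (fun ct : C * seq C => ct.1 :: ct.2)); split => /=.
  - by move=> [c t] [_ /= tn] /=; rewrite tn.
  - by move=> [c t] [c' t'] _ _ /= [-> ->].
  - by move=> [|c t]//= [tn]; exists (c, t).
rewrite -(esum_esum (a := fun c t => (word_weight k next s (c :: t))%:E * Phi (c :: t))).
  apply: eq_esum => c _; rewrite IH// -esumZl//.
    by apply: eq_esum => t _; rewrite /= EFinM muleA.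
  by move=> t _; rewrite mule_ge0// lee_fin word_weight_ge0.
by move=> c t _ _; rewrite mule_ge0// lee_fin word_weight_ge0.
Qed.

Lemma word_total_le s (Phi : seq C -> \bar R) (B : \bar R) : (forall t, 0 <= Phi t) ->
  (forall N, word_series N s Phi <= B) ->
  \esum_(t in [set: seq C]) ((word_weight k next s t)%:E * Phi t) <= B.
Proof.
move=> Phi0 hB.
rewrite (_ : [set: seq C] = \bigcup_(n in [set: nat]) [set t | size t = n]); last first.
  by apply/seteqP; split => // t _; exists (size t).
rewrite esum_bigcupT; last 2 first.
- by move=> n m _ _ [t [/= <- <-]].
- by move=> t; rewrite mule_ge0// lee_fin word_weight_ge0.
rewrite -nneseries_esumT; last first.
  by move=> n; apply: esum_ge0 => t _; rewrite mule_ge0// lee_fin word_weight_ge0.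
apply: nneseries_le_bound => [n|N].
  by apply: esum_ge0 => t _; rewrite mule_ge0// lee_fin word_weight_ge0.
apply: le_trans (hB N); rewrite /word_series; apply: lee_sum => n _.
by rewrite word_sum_esum.
Qed.

End WordSeries.

Section Blocks.
Context {R : realType} {V : countType} {E : rel V} {i0 : V}
  {pG : V -> V -> R} {pback : V -> R}
  {d : measure_display} {Omega : measurableType d}
  {P : dcover E i0 -> probability Omega R} {X : nat -> Omega -> dcover E i0}
  {eps : R} (H : cover_walk pG pback P X eps).
Local Notation T := (dcover E i0).
Local Notation o := (cover_root E i0).
Local Notation fw := (forward pG pback).
Local Notation MC := (cw_mc H).
Local Notation esc i := (1 - Fback P X i).
Local Notation kernel := (seg_kernel E i0 pG pback P X).
Local Notation next := (@seg_next V).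
Local Notation tp := (tp P X).
Implicit Types (x y z : T) (us : seq (V * nat)).

Variables (r M : R).
Hypotheses (r_gt1 : 1 < r) (rM : forall n, tp o n o * r ^+ n <= M).
Local Notation K := (green_bound r).
Local Notation q := (exit_matrix pG pback P X).

Variables (rho : nat -> V -> R) (Rb : R).
Hypotheses (labels_rep : forall i, exists x : T, x != o /\ cover_label x = i)
  (q_sum : forall i, (\esum_(j in [set: V]) (q i j)%:E = 1)%E)
  (rho_ge0 : forall m i, 0 <= rho m i)
  (rho0 : forall i, rho 0 i = 1)
  (rho_step : forall m i, (\esum_(j in [set j | j <> i0]) (q i j * rho m j)%:E <=
      (rho m.+1 i)%:E)%E)
  (rho_sum : forall N, \sum_(m < N) rho m i0 <= Rb).

Let kernel_ge0 := seg_kernel_ge0 H.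
Let escp := esc_gt0 H q_sum.
Let escg i : 0 <= esc i. Proof. exact: ltW. Qed.

(** The words of a first passage to i: the last letter has label i, and no earlier one does. *)
Fixpoint is_block (i : V) us : bool :=
  if us is u :: us' then (if u.1 == i then us' == [::] else is_block i us') else false.

Local Notation blk := (is_block i0).
Local Notation ser N st Phi := (word_series kernel next N st Phi).

(** The escape probability is superharmonic for the kernel at non-root states, so first passages
    from i to [i0] have total weight at most esc i / esc i0. *)
Lemma block_mass_le N i :
  (ser N (Some i) (fun t => if blk t then 1 else 0) <= (esc i / esc i0)%:E)%E.
Proof.
elim: N i => [|N IH] i.
  by rewrite /word_series big_geq// lee_fin divr_ge0.
rewrite word_series_rec// => [|t]; last by case: ifP.
rewrite add0e.
apply: (@le_trans _ _ (\esum_(u in [set: V * nat])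
    (kernel (Some i) u * (esc u.1 * (esc i0)^-1))%:E)%E).
  apply: le_esum => u _; rewrite EFinM lee_wpmul2l ?lee_fin//=.
  case: eqVneq => [->|_]; last exact: IH.
  by rewrite divff ?gt_eqF//; exact: word_series_nil.
have h := kernel_esc_le H r_gt1 rM labels_rep q_sum (Some i) (phi := fun=> (esc i0)^-1).
apply: le_trans (h _) _ => [_|]; first by rewrite invr_ge0.
rewrite /= mul1r.
have -> : (\esum_(j in [set: V]) (q i j * (esc i0)^-1)%:E =
   ((esc i0)^-1)%:E * \esum_(j in [set: V]) (q i j)%:E)%E.
  rewrite -esumZl ?invr_ge0//; first by apply: eq_esum => j _; rewrite mulrC EFinM.
  by move=> j _; rewrite lee_fin (exit_matrix_ge0 H).
by rewrite q_sum mule1 -EFinM.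
Qed.

(** Read through the h-transform: a letter has mean duration at most of order C1, and rho m i bounds
    the probability that the passage to [i0] takes more than m letters. *)
Lemma block_time_le : exists C1, 0 <= C1 /\ forall N i,
  (ser N (Some i) (fun t => if blk t then ((total_time t)%:R)%:E else 0) <=
   (C1 * (esc i / esc i0) * \sum_(m < N) rho m i)%:E)%E.
Proof.
have [C1 [C10 hC1]] := kernel_time_sum H r_gt1 rM.
exists C1; split => //; elim=> [|N IH] i.
  by rewrite /word_series big_geq// big_ord0 mulr0.
rewrite word_series_rec// => [|t]; last by case: ifP => // _; rewrite lee_fin.
rewrite add0e.
(* [psi] weighs the duration of the first letter by the mass of its continuations; [phi] carries the
   induction bound for the later letters and vanishes at [i0], where the block ends. *)
pose phi j := if j != i0 then C1 / esc i0 * \sum_(m < N) rho m j else 0.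
have phi0 j : 0 <= phi j.
  by rewrite /phi; case: ifP => // _; rewrite mulr_ge0 ?divr_ge0 ?sumr_ge0.
pose psi j := esc j / esc i0.
have psi0 j : 0 <= psi j by rewrite divr_ge0.
apply: (@le_trans _ _ (\esum_(u in [set: V * nat])
   ((kernel (Some i) u * (u.2)%:R * psi u.1)%:E +
    (kernel (Some i) u * (esc u.1 * phi u.1))%:E))%E).
  apply: le_esum => u _.
  rewrite -mulrA -EFinD -mulrDr EFinM lee_wpmul2l ?lee_fin//=.
  rewrite /phi /psi; case: eqVneq => [->|_] /=.
    rewrite divff ?gt_eqF// mulr1 mulr0 addr0.
    apply: le_trans (word_series_nil next kernel_ge0 N (seg_next (Some i) u) (ler0n R u.2)).
    apply: le_word_series => // t; case: eqVneq => // -> .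
    by rewrite /total_time/= addn0.
  apply: (@le_trans _ _ ((u.2%:R)%:E * ser N (Some u.1) (fun t => if blk t then 1 else 0) +
     ser N (Some u.1) (fun t => if blk t then ((total_time t)%:R)%:E else 0))%E).
    rewrite -word_seriesZ//; last by move=> t; case: ifP.
    rewrite -word_seriesD//; last 2 first.
    - by move=> t; rewrite mule_ge0 ?lee_fin//; case: ifP.
    - by move=> t; case: ifP => // _; rewrite lee_fin.
    apply: le_word_series => // t; case: ifP => _; last by rewrite mule0 adde0.
    by rewrite mule1 -EFinD lee_fin -natrD.
  rewrite EFinD; apply: leeD.
    by rewrite EFinM lee_wpmul2l ?lee_fin// block_mass_le.
  apply: le_trans (IH u.1) _; rewrite lee_fin le_eqVlt; apply/orP; left; apply/eqP.
  ring.
rewrite esumD; last 2 first.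
- by move=> u _; rewrite lee_fin; apply: mulr_ge0; [exact: mulr_ge0|exact: psi0].
- by move=> u _; rewrite lee_fin; apply: mulr_ge0 => //; apply: mulr_ge0; [exact: escg|exact: phi0].
have p1 : (\esum_(u in [set: V * nat]) (kernel (Some i) u * (u.2)%:R * psi u.1)%:E <=
    (C1 * (esc i / esc i0))%:E)%E.
  apply: le_trans (hC1 (Some i) psi psi0) _.
  apply: (@le_trans _ _ (\esum_(j in [set: V]) ((C1 * (esc i / esc i0))%:E * (q i j)%:E))%E).
    apply: le_esum => j _; rewrite -EFinM lee_fin /psi /=.
    have -> : C1 * (esc i / esc i0) * q i j = C1 / esc i0 * (esc i * q i j) by ring.
    rewrite (exit_matrixE H q_sum i j).
    have -> : C1 * fw i j * (esc j / esc i0) = C1 / esc i0 * (1 * (fw i j * esc j)) by ring.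
    rewrite -[Gbar _ _ _ * _ * _]mulrA ler_wpM2l ?divr_ge0//.
    apply: ler_wpM2r; first by rewrite mulr_ge0 ?(forward_ge0 H).
    exact: (Gbar_ge1 H r_gt1 rM labels_rep).
  rewrite esumZl; last 2 first.
  - by rewrite mulr_ge0 ?divr_ge0.
  - by move=> j _; rewrite lee_fin (exit_matrix_ge0 H).
  by rewrite q_sum mule1.
have p2 : (\esum_(u in [set: V * nat]) (kernel (Some i) u * (esc u.1 * phi u.1))%:E <=
    (C1 * (esc i / esc i0) * \sum_(m < N) rho m.+1 i)%:E)%E.
  apply: le_trans (kernel_esc_le H r_gt1 rM labels_rep q_sum (Some i) phi0) _.
  rewrite /= mul1r.
  have -> : C1 * (esc i / esc i0) * \sum_(m < N) rho m.+1 i =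
     esc i * ((C1 / esc i0) * \sum_(m < N) rho m.+1 i) by ring.
  rewrite EFinM lee_wpmul2l ?lee_fin// EFinM.
  apply: (@le_trans _ _ (\esum_(j in [set j | j <> i0])
     ((C1 / esc i0)%:E * \sum_(m < N) (q i j * rho m j)%:E))%E).
    rewrite [leRHS]esum_mkcond; apply: le_esum => j _; rewrite /phi.
    case: eqVneq => [->|ji0].
      by rewrite mulr0 memNset//=; apply.
    rewrite mem_set/=; last exact/eqP.
    rewrite sumEFin -EFinM lee_fin -mulr_sumr le_eqVlt; apply/orP; left; apply/eqP.
    ring.
  rewrite esumZl ?divr_ge0//; last first.
    by move=> j _; rewrite sumEFin lee_fin sumr_ge0// => m _; rewrite mulr_ge0 ?(exit_matrix_ge0 H).
  rewrite lee_wpmul2l ?lee_fin ?divr_ge0// esum_sum; last first.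
    by move=> j m _ _; rewrite lee_fin mulr_ge0 ?(exit_matrix_ge0 H).
  rewrite -sumEFin; apply: lee_sum => m _; exact: rho_step.
apply: le_trans (leeD p1 p2) _; rewrite -EFinD lee_fin big_ord_recl rho0.
by rewrite le_eqVlt; apply/orP; left; apply/eqP; rewrite mulrDr mulr1.
Qed.

Definition block_weight us : R :=
  if blk us then word_weight kernel next (Some i0) us else 0.

Lemma block_weight_ge0 us : 0 <= block_weight us.
Proof. by rewrite /block_weight; case: ifP => // _; exact: word_weight_ge0. Qed.

Lemma block_weight_sum : (\esum_(c in [set: seq (V * nat)]) (block_weight c)%:E <= 1)%E.
Proof.
rewrite (eq_esum (b := fun t => (word_weight kernel next (Some i0) t)%:E *
   (if blk t then 1 else 0)))%E; last first.
  by move=> t _; rewrite /block_weight; case: ifP; rewrite ?mule1 ?mule0.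
apply: word_total_le => // [t|N]; first by case: ifP.
by apply: le_trans (block_mass_le N i0) _; rewrite divff// gt_eqF.
Qed.

Lemma block_time_sum :
  (\esum_(c in [set: seq (V * nat)]) (block_weight c * (total_time c)%:R)%:E < +oo)%E.
Proof.
have [C1 [C10 hC1]] := block_time_le.
apply: (@le_lt_trans _ _ (C1 * Rb)%:E); last by rewrite ltry.
rewrite (eq_esum (b := fun t => (word_weight kernel next (Some i0) t)%:E *
   (if blk t then ((total_time t)%:R)%:E else 0)))%E; last first.
  by move=> t _; rewrite /block_weight; case: ifP; rewrite ?mul0r ?mule0 ?EFinM.
apply: word_total_le => // [t|N]; first by case: ifP => // _; rewrite lee_fin.
apply: le_trans (hC1 N i0) _; rewrite divff ?gt_eqF// mulr1 lee_fin.
by rewrite ler_wpM2l.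
Qed.

Definition block_cost us : R := path_cost pG pback P X i0 [seq u.1 | u <- us].

(** Every letter of positive weight lasts at least one step, so the bounded edge costs are
    controlled by the total time. *)
Lemma path_cost_le st us : word_weight kernel next st us != 0 ->
  `|path_cost pG pback P X (state_label i0 st) [seq u.1 | u <- us]| <=
  cost_bound eps r * (total_time us)%:R.
Proof.
have B0 := cost_bound_ge0 H r_gt1.
elim: us st => [|u us IH] st /=; first by rewrite normr0 mulr0.
rewrite mulf_eq0 negb_or => /andP[ku wu].
have [u0 Eu] : (0 < u.2)%N /\ E (state_label i0 st) u.1.
  move: ku; rewrite /seg_kernel; case: ifP => [_|_]; last by rewrite eqxx.
  rewrite mulf_eq0 negb_or => /andP[_ fu]; split => //.
  by rewrite -(forward_gt0 H) lt_def fu (forward_ge0 H).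
have [x [_ xl]] := labels_rep (state_label i0 st).
apply: le_trans (ler_normD _ _) _.
rewrite /total_time/= natrD mulrDr; apply: lerD; last exact: (IH (seg_next st u)).
rewrite -xl; apply: (@le_trans _ _ (cost_bound eps r)).
  by apply: (edge_cost_bound H r_gt1 rM); rewrite xl.
by rewrite ler_peMr// ler1n.
Qed.

Lemma block_cost_sum :
  (\esum_(c in [set: seq (V * nat)]) (block_weight c * `|block_cost c|)%:E < +oo)%E.
Proof.
have B0 := cost_bound_ge0 H r_gt1.
apply: (@le_lt_trans _ _ ((cost_bound eps r)%:E *
  \esum_(c in [set: seq (V * nat)]) (block_weight c * (total_time c)%:R)%:E)%E).
  rewrite -esumZl//; last by move=> c _; rewrite lee_fin mulr_ge0 ?block_weight_ge0.
  apply: le_esum => c _; rewrite -EFinM lee_fin mulrCA.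
  have [->|w0] := eqVneq (block_weight c) 0; first by rewrite !mul0r.
  rewrite ler_wpM2l ?block_weight_ge0//.
  apply: (path_cost_le (st := Some i0)).
  by move: w0; rewrite /block_weight; case: ifP => //; rewrite eqxx.
have h0 : (0 <= \esum_(c in [set: seq (V * nat)]) (block_weight c * (total_time c)%:R)%:E)%E.
  by apply: esum_ge0 => c _; rewrite lee_fin mulr_ge0 ?block_weight_ge0.
rewrite -[X in (_ * X)%E]fineK; last by rewrite ge0_fin_numE// block_time_sum.
by rewrite -EFinM ltry.
Qed.

(** Horizon 0 is enough: the strong law asks for a product bound only, and between two visits of
    [i0] the escape factors cancel. *)
Definition block_event us (cs : seq (seq (V * nat))) : set Omega :=
  if all blk cs then path_ev X (segments 0 o (us ++ flatten cs)) else set0.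

Lemma block_event_measurable us cs : measurable (block_event us cs).
Proof.
rewrite /block_event; case: ifP => // _.
exact: (path_ev_measurable MC (@segments_depends _ _ _ 0 o _)).
Qed.

Lemma block_state us : blk us -> foldl next (Some i0) us = Some i0.
Proof.
have h : forall st, blk us -> foldl next st us = Some i0.
  elim: us => [//|u us IH] st /=; case: eqVneq => [u0 /eqP -> /=|_ b].
    by rewrite /seg_next u0.
  exact: IH.
exact: h.
Qed.

Lemma block_event_prob us cs : foldl next None us = Some i0 ->
  (P o (block_event us cs) <= (word_weight kernel next None us *
     \prod_(c <- cs) block_weight c)%:E)%E.
Proof.
move=> us0; rewrite /block_event; case: ifPn => [ab|_]; last first.
  rewrite measure0 lee_fin mulr_ge0 ?(word_weight_ge0 next kernel_ge0)//.
  by apply: prodr_ge0 => c _; exact: block_weight_ge0.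
apply: le_trans (segments_prob_le H 0 o _) _.
rewrite /vstate eqxx (word_weight_cat kernel next) us0.
have -> : word_weight kernel next (Some i0) (flatten cs) = \prod_(c <- cs) block_weight c.
  elim: cs ab => [|c cs IH] /=; first by rewrite big_nil.
  move=> /andP[bc bcs]; rewrite (word_weight_cat kernel next) big_cons block_state// IH//.
  by rewrite /block_weight bc.
rewrite -[leRHS]mule1; apply: lee_wpmul2l.
  rewrite lee_fin mulr_ge0 ?(word_weight_ge0 next kernel_ge0)//.
  by apply: prodr_ge0 => c _; exact: block_weight_ge0.
apply: probability_le1.
exact: (path_ev_measurable MC (@stay_path_depends _ _ _ _ 0)).
Qed.

End Blocks.

(** * Almost sure convergence of the cost *)

(** The gaps between consecutive times need no separate bound: convergence of sigma J / J already
    makes them negligible compared with n. *)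
Lemma lipschitz_along_times (R : realType) (y : nat -> R) (sigma : nat -> nat)
    (B delta zeta : R) :
  (forall n, `|y n.+1 - y n| <= B) -> (forall J, (sigma J < sigma J.+1)%N) ->
  0 < zeta ->
  (J%:R^-1 * (sigma J)%:R) @[J --> \oo] --> zeta ->
  (J%:R^-1 * y (sigma J)) @[J --> \oo] --> delta ->
  (n%:R^-1 * y n) @[n --> \oo] --> delta / zeta.
Proof.
move=> lip inc z0 cs cy.
have B0 : 0 <= B by apply: le_trans (lip 0%N); exact: normr_ge0.
have lipn m k : `|y (m + k)%N - y m| <= B * k%:R.
  elim: k => [|k IH]; first by rewrite addn0 subrr normr0 mulr0.
  rewrite addnS (_ : y (m + k).+1 - y m =
    (y (m + k).+1 - y (m + k)%N) + (y (m + k)%N - y m)); last by ring.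
  apply: le_trans (ler_normD _ _) _.
  by rewrite -natr1 mulrDr mulr1 addrC; apply: lerD.
have sJ J : (J <= sigma J)%N.
  by elim: J => // J IH; exact: leq_ltn_trans IH (inc J).
have smono J J' : (J <= J')%N -> (sigma J <= sigma J')%N.
  move=> h; rewrite -(subnKC h); elim: (J' - J)%N => [|k IH]; first by rewrite addn0.
  by rewrite addnS; apply: leq_trans IH (ltnW (inc _)).
pose D := `|delta / zeta|.
apply/cvgrPdist_le => e e0.
(* Large enough for all multiples of eta n in the final estimate; the terms that do not grow with n
   are absorbed by n >= N. *)
pose C := 3 * (B + D) + 1 + D.
have D0 : 0 <= D by exact: normr_ge0.
have C0 : 0 < C by rewrite /C; lra.
pose eta := e / (2 * C).
have eta0 : 0 < eta by rewrite divr_gt0// mulr_gt0.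
move/cvgrPdist_le : cs => /(_ eta eta0) [J1 _ hJ1].
move/cvgrPdist_le : cy => /(_ eta eta0) [J2 _ hJ2].
pose J0 := (maxn J1 J2).+1.
have bs J : (J0 <= J)%N -> `|(sigma J)%:R - zeta * J%:R| <= eta * J%:R.
  move=> hJ; have Jp : 0 < J%:R :> R by rewrite ltr0n; apply: leq_trans hJ.
  have := hJ1 J; rewrite /= (leq_trans (leq_maxl J1 J2) (ltnW hJ)) => /(_ isT) h.
  have -> : (sigma J)%:R - zeta * J%:R = - ((zeta - J%:R^-1 * (sigma J)%:R) * J%:R).
    by field; rewrite gt_eqF.
  by rewrite normrN normrM (gtr0_norm Jp) ler_wpM2r// ltW.
have by_ J : (J0 <= J)%N -> `|y (sigma J) - delta * J%:R| <= eta * J%:R.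
  move=> hJ; have Jp : 0 < J%:R :> R by rewrite ltr0n; apply: leq_trans hJ.
  have := hJ2 J; rewrite /= (leq_trans (leq_maxr J1 J2) (ltnW hJ)) => /(_ isT) h.
  have -> : y (sigma J) - delta * J%:R = - ((delta - J%:R^-1 * y (sigma J)) * J%:R).
    by field; rewrite gt_eqF.
  by rewrite normrN normrM (gtr0_norm Jp) ler_wpM2r// ltW.
pose N := Num.bound `|2 * (B + D) * (zeta + eta) / e|.
have hN : 2 * (B + D) * (zeta + eta) / e < N%:R.
  by apply: le_lt_trans (ler_norm _) (archi_boundP _); exact: normr_ge0.
near=> n.
have n1 : (sigma J0 <= n)%N by near: n; exists (sigma J0).
have n2 : (N <= n)%N by near: n; exists N.
have n0 : (0 < n)%N by apply: leq_trans n1; apply: leq_trans (sJ J0).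
have np : 0 < n%:R :> R by rewrite ltr0n.
pose Q J := (sigma J <= n)%N.
have Qex : exists J, Q J by exists J0.
have Qub J : Q J -> (J <= n)%N by exact: leq_trans.
case: (ex_maxnP Qex Qub) => J QJ Jmax.
have JJ0 : (J0 <= J)%N by exact: Jmax.
have nJ1 : (n < sigma J.+1)%N.
  by rewrite ltnNge; apply/negP => h; have := Jmax J.+1 h; rewrite ltnn.
have Jn : J%:R <= n%:R :> R by rewrite ler_nat Qub.
have J0' : 0 <= J%:R :> R by [].
pose k := (n - sigma J)%N.
have nE : n = (sigma J + k)%N by rewrite subnKC.
(* The remainder k is at most the gap after time sigma J, and the estimates at J and J + 1 control
   that gap. *)
have kle : k%:R <= zeta + eta * (2 * n%:R + 1).
  have h1 := bs J JJ0; have h2 := bs J.+1 (leqW JJ0).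
  have h3 : (k + sigma J <= sigma J.+1)%N by rewrite addnC -nE ltnW.
  have : (k%:R + (sigma J)%:R <= (sigma J.+1)%:R :> R) by rewrite -natrD ler_nat.
  move: h1 h2; rewrite -[J.+1%:R]natr1 !ler_norml => /andP[a1 a2] /andP[b1 b2] hk.
  have : eta * J%:R <= eta * n%:R by rewrite ler_pM2l.
  lra.
have k0 : 0 <= k%:R :> R by [].
have main : `|y n - delta / zeta * n%:R| <= e * n%:R.
  have -> : y n - delta / zeta * n%:R = (y (sigma J + k)%N - y (sigma J)) +
     (y (sigma J) - delta * J%:R) + (delta / zeta) * (zeta * J%:R - (sigma J)%:R) -
     (delta / zeta) * k%:R.
    rewrite -nE {2}nE natrD; field; exact: lt0r_neq0.
  apply: le_trans (ler_normB _ _) _.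
  have t1 := lipn (sigma J) k.
  have t2 := by_ J JJ0.
  have t3 : `|(delta / zeta) * (zeta * J%:R - (sigma J)%:R)| <= D * (eta * J%:R).
    by rewrite normrM -/D ler_wpM2l// distrC bs.
  have t4 : `|delta / zeta * k%:R| <= D * k%:R by rewrite normrM -/D ger0_norm.
  have t5 : `|y (sigma J + k)%N - y (sigma J) + (y (sigma J) - delta * J%:R) +
     (delta / zeta) * (zeta * J%:R - (sigma J)%:R)| <= B * k%:R + eta * J%:R + D * (eta * J%:R).
    apply: le_trans (ler_normD _ _) _; apply: lerD t3.
    by apply: le_trans (ler_normD _ _) _; exact: lerD.
  apply: le_trans (lerD t5 t4) _.
  have BD0 : 0 <= B + D by exact: addr_ge0.
  have u1 : (B + D) * k%:R <= (B + D) * (zeta + eta * (2 * n%:R + 1)).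
    by rewrite ler_wpM2l.
  have u2 : eta * J%:R <= eta * n%:R by rewrite ler_pM2l.
  have u3 : D * (eta * J%:R) <= D * (eta * n%:R) by rewrite ler_wpM2l.
  have u4 : (B + D) * (zeta + eta) <= e / 2 * n%:R.
    move: hN; rewrite ltr_pdivrMr// => hN.
    have : N%:R <= n%:R :> R by rewrite ler_nat.
    move=> h; have : N%:R * e <= n%:R * e by rewrite ler_wpM2r// ltW.
    lra.
  have u5 : (2 * (B + D) + 1 + D) * (eta * n%:R) <= e / 2 * n%:R.
    have -> : e / 2 = C * eta by rewrite /eta; field; exact: lt0r_neq0.
    rewrite mulrA ler_wpM2r// ler_wpM2r ?(ltW eta0)// /C; lra.
  lra.
have -> : delta / zeta - n%:R^-1 * y n = - ((y n - delta / zeta * n%:R) / n%:R).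
  by field; rewrite !gt_eqF.
by rewrite normrN normrM (gtr0_norm (x := n%:R^-1)) ?invr_gt0// ler_pdivrMr.
Unshelve. all: by end_near.
Qed.

Section VertexCost.
Context {V : countType} {E : rel V} {i0 : V}.
Local Notation T := (dcover E i0).
Local Notation o := (cover_root E i0).

Lemma segments_end M x us (s : nat -> T) : s 0%N = x -> segments M x us s ->
  s (total_time us) = end_vertex x us.
Proof.
elim: us x s => [//|u us IH] x s s0 [_ _ h2 h3].
rewrite /total_time/= -[s _]/(shift_path u.2 s (total_time us)).
by apply: IH h3; rewrite /shift_path addn0.
Qed.

Lemma sval_end_vertex M x us (s : nat -> T) : segments M x us s ->
  sval (end_vertex x us) = sval x ++ [seq u.1 | u <- us].
Proof.
elim: us x s => [|u us IH] x s; first by rewrite cats0.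
move=> [[_ Eu] _ _ h] /=; rewrite (IH _ _ h) sval_child//.
by rewrite cat_rcons.
Qed.

Lemma total_time_cat (us vs : seq (V * nat)) :
  total_time (us ++ vs) = (total_time us + total_time vs)%N :> nat.
Proof. by rewrite /total_time map_cat sumn_cat. Qed.

Lemma total_time_flatten (cs : seq (seq (V * nat))) :
  total_time (flatten cs) = (\sum_(c <- cs) total_time c)%N.
Proof.
by elim: cs => [|c cs IH]; rewrite ?big_nil// big_cons/= total_time_cat IH.
Qed.

Lemma last_block (i j : V) us : is_block i us -> last j [seq u.1 | u <- us] = i.
Proof.
elim: us j => [//|u us IH] j /=; case: eqVneq => [-> /eqP ->//|_ h].
exact: IH.
Qed.

End VertexCost.

Lemma cvg_const_div (R : realType) (c : R) : (n%:R^-1 * c) @[n --> \oo] --> (0 : R).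
Proof.
have h : (n%:R^-1) @[n --> \oo] --> (0 : R).
  apply/cvgrPdist_lt => e e0; near=> n.
  rewrite sub0r normrN ger0_norm ?invr_ge0//.
  near: n; have [k _ hk] := near_infty_natSinv_lt (PosNum e0).
  exists k.+1 => // -[//|n] /= kn; exact: hk.
by rewrite -(mul0r c); exact: (cvgM h (cvg_cst c)).
Unshelve. all: by end_near.
Qed.

Section AlmostSureCost.
Context {R : realType} {V : countType} {E : rel V} {i0 : V}
  {pG : V -> V -> R} {pback : V -> R}
  {d : measure_display} {Omega : measurableType d}
  {P : dcover E i0 -> probability Omega R} {X : nat -> Omega -> dcover E i0}
  {eps : R} (H : cover_walk pG pback P X eps).
Local Notation T := (dcover E i0).
Local Notation o := (cover_root E i0).
Local Notation fw := (forward pG pback).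
Local Notation MC := (cw_mc H).
Local Notation kernel := (seg_kernel E i0 pG pback P X).
Local Notation next := (@seg_next V).
Local Notation tp := (tp P X).
Implicit Types (x y z : T) (us : seq (V * nat)).

Variables (r M : R).
Hypotheses (r_gt1 : 1 < r) (rM : forall n, tp o n o * r ^+ n <= M).
Local Notation q := (exit_matrix pG pback P X).

Variables (rho : nat -> V -> R) (Rb : R).
Hypotheses (labels_rep : forall i, exists x : T, x != o /\ cover_label x = i)
  (q_sum : forall i, (\esum_(j in [set: V]) (q i j)%:E = 1)%E)
  (rho_ge0 : forall m i, 0 <= rho m i)
  (rho0 : forall i, rho 0 i = 1)
  (rho_step : forall m i, (\esum_(j in [set j | j <> i0]) (q i j * rho m j)%:E <=
      (rho m.+1 i)%:E)%E)
  (rho_sum : forall N, \sum_(m < N) rho m i0 <= Rb).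

Local Notation cost := (green_cost pG pback P X).
Local Notation bcost := (@block_cost R V E i0 pG pback d Omega P X).

(** The empty word receives the label [i0] of the root, so recurrence also applies from the
    start. *)
Definition final_state us : V := state_label i0 (foldl next None us).

Definition good_path (w : Omega) : Prop :=
  [/\ X 0%N w = o, adjacent_path (fun k => X k w),
      forall x, exists n0, forall n, (n0 <= n)%N -> X n w <> x &
      forall us, final_state us = i0 ->
        ~ forall m, word_event (exit_event X) m us (@avoiding V i0) w].

Lemma good_path_ae : {ae P o, forall w, good_path w}.
Proof.
have A1 := start_ae MC o.
have A2 := ae_adjacent H o.
have A3 := negligible_bigcup_count (A := [set: T])
  (fun x _ => finite_visits_ae H r_gt1 rM x).
have A4 := negligible_bigcup_count (A := [set us | final_state us = i0])
  (fun us h => no_later_visit_null H r_gt1 rM labels_rep q_sum rho_ge0 rho0 rho_step rho_sum h).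
apply: negligibleS (negligibleU (negligibleU A1 A2) (negligibleU A3 A4)) => w /= ng.
apply: contrapT => h; apply: ng; split.
- by apply: contrapT => h1; apply: h; left; left.
- by apply: contrapT => h1; apply: h; left; right.
- by move=> x; apply: contrapT => h1; apply: h; right; left; exists x.
- by move=> us us0 h1; apply: h; right; right; exists us.
Qed.

Lemma visits_infinitely_often w (u : nat -> V * nat) : good_path w ->
  (forall k M', segments M' o (mkseq u k) (fun n => X n w)) ->
  forall k, exists k', (k <= k')%N && ((u k').1 == i0).
Proof.
move=> [_ _ _ rec] hu k0; apply: contrapT => no.
have av k : (k0 <= k)%N -> (u k).1 != i0.
  by move=> h; apply/negP => e; apply: no; exists k; rewrite h e.
pose Q k := [forall l : 'I_k0, (k <= l)%N ==> ((u l).1 != i0)].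
have Qex : exists k, Q k.
  by exists k0; apply/forallP => l; apply/implyP; rewrite leqNgt ltn_ord.
(* By minimality the letter before k1, if there is one, has label [i0]; the prefix up to k1 thus
   ends at [i0] and no later letter visits it. *)
case: (ex_minnP Qex) => k1 Qk1 k1min.
have av1 k : (k1 <= k)%N -> (u k).1 != i0.
  move=> h; have [kk0|] := ltnP k k0; last exact: av.
  by have /forallP /(_ (Ordinal kk0)) /implyP := Qk1; apply.
have fs : final_state (mkseq u k1) = i0.
  case: k1 Qk1 k1min av1 => [//|k1] Qk1 k1min av1.
  rewrite /final_state mkseqS foldl_rcons /=.
  apply/eqP; apply: contraT => ui.
  suff : Q k1 by move/k1min; rewrite ltnn.
  apply/forallP => l; apply/implyP; rewrite leq_eqVlt => /orP[/eqP <-//|h].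
  exact: av1.
apply: (rec _ fs) => m; exists [seq u i | i <- iota k1 m].
  split; first by rewrite size_map size_iota.
  rewrite /avoiding/= all_map; apply/allP => i; rewrite mem_iota => /andP[h _].
  exact: av1.
have -> : mkseq u k1 ++ [seq u i | i <- iota k1 m] = mkseq u (k1 + m).
  by rewrite /mkseq iotaD map_cat add0n.
by move=> M'; exact: hu.
Qed.

(** The first block starts after a random prefix. The strong law is therefore applied after each of
    the countably many words ending at [i0], with the weight of that word as p0. *)
Lemma green_cost_slln : exists l : R,
  {ae P o, forall w, (n%:R^-1 * cost (X n w)) @[n --> \oo] --> l}.
Proof.
pose bw := @block_weight R V E i0 pG pback d Omega P X.
have bw0 : forall c, 0 <= bw c := block_weight_ge0 H.
have bw1 := block_weight_sum H r_gt1 rM labels_rep q_sum.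
pose th (c : seq (V * nat)) : R := (total_time c)%:R.
have bth : (\esum_(c in [set: seq (V * nat)]) (bw c * `|th c|)%:E < +oo)%E.
  have := block_time_sum H r_gt1 rM labels_rep q_sum rho_ge0 rho0 rho_step rho_sum.
  by congr (_ < _)%E; apply: eq_esum => c _; rewrite /th ger0_norm.
have bco := block_cost_sum H r_gt1 rM labels_rep q_sum rho_ge0 rho0 rho_step rho_sum.
have [zeta hz] := subprob_slln bw0 bw1 bth.
have [delta hd] := subprob_slln bw0 bw1 bco.
exists (delta / zeta).
pose I := [set us | foldl next None us = Some i0].
have K0 us : 0 <= word_weight kernel next None us.
  exact: (word_weight_ge0 next (seg_kernel_ge0 H)).
have A1 := negligible_bigcup_count (A := I) (fun us h =>
  hz _ _ (P o) (block_event (X := X) us) _ (K0 us) (block_event_measurable H us)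
     (fun cs => block_event_prob H cs h)).
have A2 := negligible_bigcup_count (A := I) (fun us h =>
  hd _ _ (P o) (block_event (X := X) us) _ (K0 us) (block_event_measurable H us)
     (fun cs => block_event_prob H cs h)).
apply: negligibleS (negligibleU good_path_ae (negligibleU A1 A2)) => w /= ng.
apply: contrapT => h; apply: ng.
have gw : good_path w by apply: contrapT => h1; apply: h; left.
have [w0 wadj wfin wrec] := gw.
have [u hu] := exit_sequence w0 wadj wfin.
have io := visits_infinitely_often gw hu.
have nxt k : exists k', [/\ (k <= k')%N, (u k').1 = i0 &
     forall l, (k <= l < k')%N -> (u l).1 != i0].
  case: (ex_minnP (io k)) => k' /andP[kk' /eqP uk'] kmin; exists k'; split => //.
  move=> l /andP[kl lk']; apply/negP => e; have := kmin l; rewrite kl e => /(_ isT).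
  by rewrite leqNgt lk'.
have [g hg] := choice nxt.
(* Indices of the successive exit labels equal to [i0]. Below, [t0] is the prefix through the first
   of them and [c J] the block from one to the next. *)
pose kap J := iter J (fun k => g k.+1) (g 0%N).
have kapS J : kap J.+1 = g (kap J).+1 by [].
have kapP J : (u (kap J)).1 = i0.
  by case: J => [|J]; [have [] := hg 0%N|have [] := hg (kap J).+1].
have kaplt J : (kap J < kap J.+1)%N by rewrite kapS; have [] := hg (kap J).+1.
have kapav J l : (kap J < l < kap J.+1)%N -> (u l).1 != i0.
  by rewrite kapS; have [_ _] := hg (kap J).+1; exact.
pose t0 := mkseq u (kap 0%N).+1.
pose c J := [seq u i | i <- iota (kap J).+1 (kap J.+1 - kap J)].
have t0I : I t0.
  by rewrite -[I t0]/(foldl next None t0 = Some i0) /t0 mkseqS foldl_rcons /seg_next kapP.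
have catE n : t0 ++ flatten (mkseq c n) = mkseq u (kap n).+1.
  elim: n => [|n IH]; first by rewrite cats0.
  rewrite mkseqS flatten_rcons catA IH /c /mkseq -map_cat; congr map.
  rewrite -[(kap n).+1 in X in _ ++ X]add0n -iotaD; congr iota.
  by rewrite addSn subnKC// ltnW.
have cblk J : is_block i0 (c J).
  rewrite /c; have := kaplt J; have := kapav J; have := kapP J.+1.
  set a := kap J; set b := kap J.+1 => ub av ab.
  have : exists n, (b - a)%N = n.+1 by exists (b - a).-1; rewrite prednK// subn_gt0.
  move=> [n nE]; have bE : b = (a + n.+1)%N by rewrite -nE subnKC// ltnW.
  rewrite nE; have {}av l : (a < l < a + n.+1)%N -> (u l).1 != i0 by rewrite -bE; exact: av.
  rewrite bE in ub; move: {nE ab bE b} av ub.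
  elim: n {J} a => [|n IH] a av ub /=.
    by rewrite -addn1 ub eqxx.
  rewrite (negbTE (av a.+1 _)); last by rewrite ltnSn/= addnS ltnS addnS ltnS leq_addr.
  apply: IH => [l /andP[al lb]|]; last by rewrite addSnnS.
  by apply: av; rewrite (ltn_trans _ al)//= -addSnnS.
have br : branch (block_event (X := X) t0) w c.
  move=> n; rewrite /block_event.
  have -> : all (is_block i0) (mkseq c n) by rewrite /mkseq all_map; apply/allP => i _; exact: cblk.
  by rewrite catE; exact: hu.
have cz : avg_cvg (block_event (X := X) t0) th zeta w.
  by apply: contrapT => h1; apply: h; right; left; exists t0.
have cd : avg_cvg (block_event (X := X) t0) bcost delta w.
  by apply: contrapT => h1; apply: h; right; right; exists t0.
have {}cz := cz c br; have {}cd := cd c br.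
pose sigma J := total_time (mkseq u (kap J).+1).
have S (f : seq (V * nat) -> R) n : \sum_(x <- mkseq c n) f x = \sum_(j < n) f (c j).
  by rewrite /mkseq big_map -(big_mkord xpredT (fun j => f (c j))) /index_iota subn0.
have sigE J : (sigma J)%:R = (total_time t0)%:R + \sum_(j < J) th (c j) :> R.
  rewrite /sigma -catE total_time_cat natrD total_time_flatten natr_sum.
  by rewrite -(S th).
have pos k : (0 < (u k).2)%N.
  have : forall (us : seq (V * nat)) x (s : nat -> T), segments 0 x us s ->
      all (fun v => 0 < v.2)%N us.
    elim=> [//|v us IH] x s [[v0 _] _ _ hs] /=; rewrite v0; exact: IH hs.
  move=> /(_ _ _ _ (hu k.+1 0%N)) /allP; apply.
  by rewrite /mkseq; apply: map_f; rewrite mem_iota/= add0n ltnS.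
have th1 J : 1 <= th (c J).
  rewrite /th ler1n /c (_ : (kap J.+1 - kap J)%N = (kap J.+1 - kap J).-1.+1).
    by rewrite /total_time/= addn_gt0 pos.
  by rewrite prednK// subn_gt0.
apply: (@lipschitz_along_times _ _ sigma (cost_bound eps r)).
- by move=> n; exact: (green_cost_lipschitz H r_gt1 rM (wadj n)).
- move=> J; rewrite -(ltr_nat R) (sigE J) (sigE J.+1) big_ord_recr/= addrA ltrDl.
  exact: lt_le_trans ltr01 (th1 J).
(* Every block lasts at least one unit of time, hence zeta >= 1. *)
- apply: lt_le_trans ltr01 _; rewrite -(cvg_lim _ cz)//.
  apply: limr_ge; first by apply/cvg_ex; eexists; exact: cz.
  near=> n; have n0 : (0 < n)%N by near: n; exists 1%N.
  rewrite mulrC ler_pdivlMr ?ltr0n// mul1r.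
  apply: (@le_trans _ _ (\sum_(j < n) 1)); first by rewrite sumr_const card_ord.
  by apply: ler_sum => j _; exact: th1.
- rewrite (_ : (fun J => _) = (fun J => J%:R^-1 * (total_time t0)%:R) \+
     (fun J => J%:R^-1 * \sum_(j < J) th (c j))); last first.
    by apply/funext => J /=; rewrite (sigE J) mulrDr.
  by rewrite -[zeta]add0r; apply: cvgD => //; exact: cvg_const_div.
- pose c0 := path_cost pG pback P X i0 [seq v.1 | v <- t0].
  have costE J : cost (X (sigma J) w) = c0 + \sum_(j < J) bcost (c j).
    have hs := hu (kap J).+1 0%N.
    rewrite /sigma (segments_end w0 hs) /green_cost (sval_end_vertex hs).
    rewrite -catE -[sval o]/([::] : seq V) cat0s map_cat path_cost_cat -/c0 -(S bcost).
    congr (_ + _).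
    have -> : last i0 [seq v.1 | v <- t0] = i0.
      by rewrite /t0 mkseqS map_rcons last_rcons kapP.
    have : forall cs, all (is_block i0) cs ->
        path_cost pG pback P X i0 [seq v.1 | v <- flatten cs] = \sum_(x <- cs) bcost x.
      elim=> [|b cs IH] /=; first by rewrite big_nil.
      move=> /andP[bb bcs]; rewrite map_cat path_cost_cat big_cons; congr (_ + _).
      rewrite (_ : last i0 _ = i0) ?IH//.
      exact: last_block.
    apply; by rewrite /mkseq all_map; apply/allP => i _; exact: cblk.
  rewrite (_ : (fun J => _) = (fun J => J%:R^-1 * c0) \+
     (fun J => J%:R^-1 * \sum_(j < J) bcost (c j))); last first.
    by apply/funext => J /=; rewrite (costE J) mulrDr.
  by rewrite -[delta]add0r; apply: cvgD => //; exact: cvg_const_div.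
Unshelve. all: by end_near.
Qed.

End AlmostSureCost.

(** * Entropy *)

Section DiscreteIntegral.
Context {d : measure_display} {T : measurableType d} {R : realType}.

Lemma measurable_fun_countable (C : countType) (Z : T -> C) (phi : C -> \bar R) :
  (forall c, measurable [set w | Z w = c]) -> measurable_fun setT (phi \o Z).
Proof.
move=> mZ _ B mB; rewrite setTI.
rewrite (_ : _ @^-1` B = \bigcup_(c in [set c | B (phi c)]) [set w | Z w = c]).
  by apply: bigcup_count_measurable => c _; exact: mZ.
by apply/seteqP; split => w /=; [exists (Z w)|move=> [c /= Bc ->]].
Qed.

Lemma integral_countable (C : countType) (Q : probability T R) (Z : T -> C)
    (phi : C -> R) : (forall c, 0 <= phi c) ->
  (forall c, measurable [set w | Z w = c]) ->
  (\int[Q]_w (phi (Z w))%:E =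
   \esum_(c in [set: C]) ((phi c)%:E * Q [set w | Z w = c]))%E.
Proof.
move=> phi0 mZ.
pose F k := [set w | pickle (Z w) = k].
pose g k := (\int[Q]_(w in F k) (phi (Z w))%:E)%E.
have FE c : F (pickle c) = [set w | Z w = c].
  by apply/seteqP; split => w; rewrite /F /=; [move=> /(pcan_inj pickleK)|move=> ->].
have F0 k : ~ range (@pickle C) k -> F k = set0.
  by move=> h; apply/seteqP; split => w //= wk; apply: h; exists (Z w).
have mF k : measurable (F k).
  have [[c _ <-]|/F0 ->//] := pselect (range (@pickle C) k).
  by rewrite FE.
have gE c : g (pickle c) = ((phi c)%:E * Q [set w | Z w = c])%E.
  rewrite /g FE -(integral_cst _ (mZ c)); apply: eq_integral => w.
  by rewrite inE /= => ->.
have FT : \bigcup_k F k = setT.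
  by apply/seteqP; split => w // _; exists (pickle (Z w)).
have tF : trivIset setT F by move=> j k _ _ [w [/= <- <-]].
rewrite -[in LHS]FT ge0_integral_bigcup//; last 2 first.
- by rewrite FT; exact: (measurable_fun_countable (fun c => (phi c)%:E) mZ).
- by move=> w _; rewrite lee_fin.
rewrite nneseries_esumT; last by move=> k; apply: integral_ge0 => w _; rewrite lee_fin.
rewrite (_ : (\esum_(k in [set: nat]) _ = \esum_(k in range (@pickle C)) g k)%E).
  rewrite (reindex_esum [set: C] (range (@pickle C)) pickle).
    by apply: eq_esum => c _; exact: gE.
  split; first by move=> c _; exists c.
    by move=> c c' _ _ /(pcan_inj pickleK).
  by move=> k [c _ <-]; exists c.
rewrite [RHS]esum_mkcond; apply: eq_esum => k _.
case: ifPn => //; rewrite notin_setE => /F0 e.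
by rewrite e integral_set0.
Qed.

Lemma integral_cst_prob (Q : probability T R) (c : \bar R) :
  (\int[Q]_w cst c w = c)%E.
Proof.
rewrite integral_cst// -[RHS]mule1; congr (_ * _)%E.
exact: probability_setT.
Qed.

End DiscreteIntegral.

Section Entropy.
Context {R : realType} {V : countType} {E : rel V} {i0 : V}
  {pG : V -> V -> R} {pback : V -> R}
  {d : measure_display} {Omega : measurableType d}
  {P : dcover E i0 -> probability Omega R} {X : nat -> Omega -> dcover E i0}
  {eps : R} (H : cover_walk pG pback P X eps).
Local Notation T := (dcover E i0).
Local Notation o := (cover_root E i0).
Local Notation MC := (cw_mc H).
Local Notation tp := (tp P X).
Implicit Types (x y z : T).

Variables (r M : R).
Hypotheses (r_gt1 : 1 < r) (rM : forall n, tp o n o * r ^+ n <= M).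
Local Notation K := (green_bound r).
Local Notation F x := (hitting_prob P X o x).

Let r_gt0 : 0 < r. Proof. exact: lt_trans r_gt1. Qed.
Let e_gt0 : 0 < eps := eps_gt0 H.

Lemma tp_le_hitting n x : tp o n x <= F x.
Proof.
rewrite -lee_fin -(tpE H) -(hittingE H); apply: prob_le.
- exact: state_measurable MC _ _.
- exact: (hit_measurable H).
- by move=> w h; exists n.
Qed.

Lemma tp_sum1 n : (\esum_(x in [set: T]) (tp o n x)%:E = 1)%E.
Proof.
rewrite -[RHS](@probability_setT _ _ _ (P o)).
rewrite (_ : setT = \bigcup_(x in [set: T]) [set w | X n w = x]); last first.
  by apply/seteqP; split => w // _; exists (X n w).
rewrite prob_bigcup_count.
- by apply: eq_esum => x _; rewrite (tpE H).
- by move=> x _; exact: state_measurable MC _ _.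
- by move=> x y _ _ [w [/= <- <-]].
Qed.

(* By the spectral gap, visits to [x] after time [k (n + 1)] are negligible
   compared with [F(o, x) >= eps ^ |x|]. *)
Lemma hitting_le_early_visits : exists k : nat, (0 < k)%N /\ forall n x,
  (depth x <= n)%N -> F x <= 2 * \sum_(m < k * n.+1) tp o m x.
Proof.
have K1 := green_bound_ge1 r_gt1.
have B1 : 1 <= 2 * K * eps ^- 2.
  have e2 : 1 <= eps ^- 2.
    rewrite -[leLHS]invr1 lef_pV2 ?posrE ?exprn_gt0//.
    by rewrite exprn_ile1 ?(eps_le1 H)// ltW.
  by rewrite -[leLHS]mulr1; apply: ler_pM => //; lra.
(* Each of n + 1 groups of k steps gains at least 2 K eps^(-2). For |x| <= n this outweighs two
   factors eps^|x|: one from returning to the root, one from F(o, x) >= eps^|x|. *)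
have [k /ltW kB] := expr_unbounded (2 * K * eps ^- 2) r_gt1.
exists k.+1; split => // n x xn; set N := (k.+1 * n.+1)%N.
have ed : 0 < eps ^+ depth x by rewrite exprn_gt0.
have tail : (\esum_(m in [set: nat]) (tp o (m + N) x)%:E <= (F x / 2)%:E)%E.
  apply: (@le_trans _ _ ((eps ^- depth x * r^-1 ^+ N) * K)%:E).
    apply: esum_geometric_le => [||m].
    - by rewrite mulr_ge0 ?invr_ge0 ?exprn_ge0 ?invr_ge0// ltW.
    - by rewrite invr_ge0 (ltW r_gt0) invf_lt1.
    - by rewrite tp_ge0/= -mulrA -exprD addnC (tp_root_le H r_gt1 rM).
  rewrite lee_fin; apply: le_trans (ler_wpM2r _ (hitting_ge H x)); last by rewrite invr_ge0.
  have rN : 2 * K <= r ^+ N * (eps ^+ depth x * eps ^+ depth x).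
    have h1 : 2 * K * (eps ^- 2) ^+ n.+1 <= r ^+ N.
      apply: (@le_trans _ _ ((2 * K * eps ^- 2) ^+ n.+1)).
        rewrite exprMn; apply: ler_wpM2r.
          by rewrite exprn_ge0// invr_ge0 exprn_ge0// ltW.
        by rewrite exprS -[leLHS]mulr1 ler_wpM2l ?exprn_ege1//; lra.
      apply: (@le_trans _ _ ((r ^+ k) ^+ n.+1)).
        by apply: lerXn2r => //; rewrite ?nnegrE ?exprn_ge0 ?(ltW r_gt0)//; apply: le_trans B1.
      by rewrite -exprM ler_weXn2l ?(ltW r_gt1)// /N leq_mul2r leqnSn orbT.
    have h2 : 1 <= (eps ^- 2) ^+ n.+1 * (eps ^+ depth x * eps ^+ depth x).
      rewrite -exprD exprVn -exprM mulrC ler_pdivlMr ?exprn_gt0// mul1r.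
      by apply: ler_wiXn2l; rewrite ?(ltW e_gt0) ?(eps_le1 H)//; lia.
    apply: le_trans (ler_wpM2r _ h1); last by rewrite mulr_ge0// ltW.
    rewrite -[leRHS]mulrA; apply: ler_peMr => //; lra.
  rewrite exprVn ler_pdivlMr//.
  have -> : eps ^- depth x / r ^+ N * K * 2 = 2 * K / (r ^+ N * eps ^+ depth x).
    by rewrite [in RHS]invfM; ring.
  by rewrite ler_pdivrMr ?mulr_gt0 ?exprn_gt0// mulrCA.
have e : green P X x = \sum_(m < N) tp o m x + fine (\esum_(m in [set: nat]) (tp o (m + N) x)%:E)%E.
  have tf : (\esum_(m in [set: nat]) (tp o (m + N) x)%:E)%E \is a fin_num.
    rewrite ge0_fin_numE; first exact: le_lt_trans tail (ltry _).
    by apply: esum_ge0 => m _; rewrite lee_fin tp_ge0.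
  apply: EFin_inj; rewrite -(greenE H r_gt1 rM) EFinD fineK//.
  rewrite -!nneseries_esumT; try by move=> m; rewrite lee_fin tp_ge0.
  rewrite (nneseries_split 0 N); last by move=> m _; rewrite lee_fin tp_ge0.
  rewrite add0n -nneseries_addn; last by move=> m; rewrite lee_fin tp_ge0.
  by rewrite big_mkord sumEFin.
have := hitting_le_green H r_gt1 rM x; rewrite e => h.
have : fine (\esum_(m in [set: nat]) (tp o (m + N) x)%:E)%E <= F x / 2.
  rewrite -lee_fin fineK// ge0_fin_numE; first exact: le_lt_trans tail (ltry _).
  by apply: esum_ge0 => m _; rewrite lee_fin tp_ge0.
lra.
Qed.

Lemma ae_depth_le : {ae P o, forall w, forall n, (depth (X n w) <= n)%N}.
Proof.
apply: filterS2 (ae_adjacent H o) (start_ae MC o) => w adj w0.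
elim=> [|n IH]; first by rewrite w0 depth_root.
by apply: leq_trans (proj1 (adjacent_depth (adj n))) _.
Qed.

Lemma ae_tp_gt0 n : {ae P o, forall w, 0 < tp o n (X n w)}.
Proof.
pose A := [set x | ~ (0 < tp o n x)].
apply: (@negligibleS _ _ _ _ (\bigcup_(x in A) [set w | X n w = x])).
  by move=> w /= h; exists (X n w).
apply: negligible_bigcup_count => x /= /negP; rewrite -leNgt => h.
apply/negligibleP; first exact: state_measurable MC _ _.
apply: etrans (tpE H o n x) _.
by congr (_%:E); apply/eqP; rewrite eq_le h tp_ge0.
Qed.

Local Notation mean_hit n := (\int[P o]_w (- ln (F (X n w)))%:E)%E.
Local Notation mean_ent n := (\int[P o]_w (- ln (tp o n (X n w)))%:E)%E.

Lemma measurable_state_fun n (phi : T -> R) :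
  measurable_fun setT (fun w => (phi (X n w))%:E).
Proof.
apply: (measurable_fun_countable (fun x => (phi x)%:E)) => x.
exact: state_measurable MC _ _.
Qed.

Lemma hit_cost_ge0 x : 0 <= - ln (F x).
Proof. by rewrite oppr_ge0 ln_le0// (hitting_le1 H). Qed.

Lemma ent_cost_ge0 n x : 0 <= - ln (tp o n x).
Proof. by rewrite oppr_ge0 ln_le0// (tp_le1 H). Qed.

Lemma hit_cost_le n x : (depth x <= n)%N -> - ln (F x) <= n%:R * - ln eps.
Proof.
move=> xn; rewrite mulrN lerN2 mulrC mulr_natr -lnXn//.
rewrite ler_ln ?posrE ?exprn_gt0// ?(hitting_gt0 H)//.
by apply: le_trans (hitting_ge H x); rewrite ler_wiXn2l ?(ltW e_gt0) ?(eps_le1 H).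
Qed.

Lemma mean_hit_le n : (mean_hit n <= (n%:R * - ln eps)%:E)%E.
Proof.
apply: (@le_trans _ _ (\int[P o]_w (cst (n%:R * - ln eps)%:E w))%E); last first.
  by rewrite integral_cst_prob.
apply: ae_ge0_le_integral => //.
- by move=> w _; rewrite lee_fin hit_cost_ge0.
- exact: (measurable_state_fun n (fun x => - ln (F x))).
- by move=> w _; rewrite lee_fin mulr_ge0// oppr_ge0 ln_le0// (eps_le1 H).
- by apply: filterS ae_depth_le => w h _; rewrite lee_fin hit_cost_le.
Qed.

Lemma mean_hit_le_ent n : (mean_hit n <= mean_ent n)%E.
Proof.
apply: ae_ge0_le_integral => //.
- by move=> w _; rewrite lee_fin hit_cost_ge0.
- exact: (measurable_state_fun n (fun x => - ln (F x))).
- by move=> w _; rewrite lee_fin ent_cost_ge0.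
- exact: (measurable_state_fun n (fun x => - ln (tp o n x))).
- apply: filterS (ae_tp_gt0 n) => w h _; rewrite lee_fin lerN2.
  by rewrite ler_ln ?posrE ?(hitting_gt0 H)// tp_le_hitting.
Qed.

(* Gibbs' inequality for the law of [X_n] and the average of the laws of
   [X_0, ..., X_(N-1)], which dominates [F / (2 N)] on the support of [X_n]. *)
Lemma mean_ent_le : exists k : nat, (0 < k)%N /\ forall n,
  (mean_ent n <= mean_hit n + (ln (2 * (k * n.+1)%:R))%:E)%E.
Proof.
have [k [k0 hk]] := hitting_le_early_visits.
exists k; split => // n; set N := (k * n.+1)%N.
have N0 : 0 < N%:R :> R by rewrite ltr0n muln_gt0 k0.
have N1 : 1 <= N%:R :> R by rewrite ler1n muln_gt0 k0.
have ln0 : 0 <= ln (2 * N%:R) :> R by rewrite ln_ge0//; lra.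
pose q x := N%:R^-1 * \sum_(m < N) tp o m x.
have q0 x : 0 <= q x.
  by apply: mulr_ge0; [rewrite invr_ge0 ltW|apply: sumr_ge0 => m _; exact: tp_ge0].
have qs : (\esum_(x in [set: T]) (q x)%:E = 1)%E.
  under eq_esum do rewrite /q EFinM -sumEFin.
  rewrite esumZl; last 2 first.
  - by rewrite invr_ge0 ltW.
  - by move=> x _; apply: sume_ge0 => m _; rewrite lee_fin tp_ge0.
  rewrite esum_sum; last by move=> x m _ _; rewrite lee_fin tp_ge0.
  under eq_bigr do rewrite tp_sum1.
  by rewrite sumEFin sumr_const card_ord -EFinM mulVf// gt_eqF.
(* Density of the averaged law with respect to the law of X_n. Division by zero gives 0 off the
   support, so its mean is at most 1 rather than exactly 1. *)
pose f x := q x / tp o n x.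
have f0 x : 0 <= f x by rewrite divr_ge0 ?tp_ge0.
have If : (\int[P o]_w (f (X n w))%:E <= 1)%E.
  rewrite integral_countable//; last by move=> x; exact: state_measurable MC _ _.
  rewrite -qs; apply: le_esum => x _; rewrite (tpE H) -EFinM lee_fin /f.
  have [->|p0] := eqVneq (tp o n x) 0; first by rewrite mulr0.
  by rewrite divfK.
have mh := measurable_state_fun n (fun x => - ln (F x)).
have me := measurable_state_fun n (fun x => - ln (tp o n x)).
have mf := measurable_state_fun n f.
(* This is ln f <= f - 1 with the constant 1 moved to the left, which makes both integrands
   nonnegative. *)
have h : (\int[P o]_w ((- ln (tp o n (X n w)))%:E + cst 1 w) <=
    \int[P o]_w ((- ln (F (X n w)))%:E + ((f (X n w))%:E + cst (ln (2 * N%:R))%:E w)))%E.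
  apply: ae_ge0_le_integral => //.
  - by move=> w _; rewrite -EFinD lee_fin addr_ge0// ent_cost_ge0.
  - exact: emeasurable_funD.
  - move=> w _; rewrite -!EFinD lee_fin; apply: addr_ge0; first exact: hit_cost_ge0.
    exact: addr_ge0.
  - by apply: emeasurable_funD => //; exact: emeasurable_funD.
  - apply: filterS2 ae_depth_le (ae_tp_gt0 n) => w dw tw _.
    rewrite -!EFinD lee_fin; set x := X n w.
    have Fq : F x <= 2 * N%:R * q x.
      by apply: le_trans (hk _ _ (dw n)) _; rewrite /q -mulrA mulVKf// gt_eqF.
    have F0 := hitting_gt0 H x.
    have qx : 0 < q x by have := lt_le_trans F0 Fq; rewrite pmulr_rgt0// mulr_gt0.
    have : ln (F x) <= ln (2 * N%:R) + ln (q x).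
      have c0 : 0 < 2 * N%:R :> R by rewrite mulr_gt0.
      rewrite -[leRHS](@lnM R (2 * N%:R) (q x))//.
      by rewrite ler_ln// posrE mulr_gt0.
    have fx : 0 < f x by rewrite divr_gt0.
    have : ln (f x) <= f x - 1.
      by have := @le_ln1Dx _ (f x - 1); rewrite subrKC; apply; lra.
    rewrite /f ln_div ?posrE// -/(f x); lra.
move: h; rewrite !ge0_integralD//; last 5 first.
- by move=> w _; rewrite lee_fin.
- by move=> w _; rewrite lee_fin hit_cost_ge0.
- by move=> w _; rewrite -EFinD lee_fin addr_ge0.
- exact: emeasurable_funD.
- by move=> w _; rewrite lee_fin ent_cost_ge0.
rewrite !integral_cst_prob => h.
have {h}: (mean_ent n + 1 <= mean_hit n + (1 + (ln (2 * N%:R))%:E))%E.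
  by apply: le_trans h _; apply: leeD => //; apply: leeD.
by rewrite [(1 + _)%E]addeC addeA leeD2rE.
Qed.

Variable l : R.
Hypothesis cost_cvg :
  {ae P o, forall w, (n%:R^-1 * green_cost pG pback P X (X n w)) @[n --> \oo] --> l}.

Lemma hit_cost_cvg :
  {ae P o, forall w, (n%:R^-1 * - ln (F (X n w))) @[n --> \oo] --> l}.
Proof.
have [C hC] := ln_hitting_cost H r_gt1 rM.
apply: filterS cost_cvg => w cw.
have -> : (fun n => n%:R^-1 * - ln (F (X n w))) =
    (fun n => n%:R^-1 * green_cost pG pback P X (X n w)) \+
    (fun n => n%:R^-1 * (- ln (F (X n w)) - green_cost pG pback P X (X n w))).
  by apply/funext => n /=; rewrite -mulrDr addrC subrK.
rewrite -[l]addr0; apply: cvgD => //; apply/norm_cvg0P.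
apply: (@squeeze_cvgr _ _ _ _ (fun=> 0) (fun n => n%:R^-1 * C)).
- near=> n; rewrite normr_ge0 normrM ger0_norm ?invr_ge0// ler_wpM2l ?invr_ge0//.
- exact: cvg_cst.
- exact: cvg_const_div.
Unshelve. all: by end_near.
Qed.

(** The averages are dominated by - ln eps: after n steps the depth is at most n, and F(o, x) >=
    eps^|x|. *)
Lemma mean_hit_cvg : (n%:R^-1 * fine (mean_hit n)) @[n --> \oo] --> l.
Proof.
have le0 : 0 <= - ln eps by rewrite oppr_ge0 ln_le0// (eps_le1 H).
pose f_ n w := (n%:R^-1 * - ln (F (X n w)))%:E.
have mf n : measurable_fun setT (f_ n).
  exact: (measurable_state_fun n (fun x => n%:R^-1 * - ln (F x))).
have [_ _ h] := @dominated_convergence _ _ _ (P o) setT measurableT f_ (cst l%:E)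
  (cst (- ln eps)%:E) mf (measurable_cst _) ltac:(
    by apply: filterS hit_cost_cvg => w cw _; apply: cvg_EFin => //; exact: nearW)
  ltac:(exact: finite_measure_integrable_cst) ltac:(
    by apply: filterS ae_depth_le => w dw n _; rewrite abse_EFin lee_fin normrM
      !ger0_norm ?invr_ge0 ?hit_cost_ge0//; case: n => [|n];
      [rewrite invr0 mul0r|rewrite mulrC ler_pdivrMr ?ltr0n// mulrC hit_cost_le]).
move: h; rewrite integral_cst_prob => /fine_cvg h.
apply: cvg_trans h; apply: near_eq_cvg; near=> n => /=.
rewrite /f_; under eq_integral do rewrite EFinM.
rewrite ge0_integralZl//.
- have fin : mean_hit n \is a fin_num.
    rewrite ge0_fin_numE; first exact: le_lt_trans (mean_hit_le n) (ltry _).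
    by apply: integral_ge0 => w _; rewrite lee_fin hit_cost_ge0.
  by rewrite fineM.
- exact: (measurable_state_fun n (fun x => - ln (F x))).
- by move=> w _; rewrite lee_fin hit_cost_ge0.
Unshelve. all: by end_near.
Qed.

End Entropy.

(** From ln y < y at y = (n + 1) e / 2, which bounds ln (n + 1) by a small multiple of n plus a
    constant. *)
Lemma cvg_ln_succ_div (R : realType) :
  (n%:R^-1 * ln (n.+1%:R : R)) @[n --> \oo] --> 0.
Proof.
apply/cvgrPdist_le => /= e e0.
have e2 : 0 < e / 2 by rewrite divr_gt0.
have /cvgrPdist_le/(_ _ e2)/= small := cvg_const_div (e / 2 - ln (e / 2)).
near=> n.
have n0 : 0 < n%:R :> R by rewrite ltr0n; near: n; exists 1%N.
have h1 : ln (n.+1%:R * (e / 2)) < n.+1%:R * (e / 2) by rewrite ln_sublinear// mulr_gt0.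
rewrite lnM ?posrE// in h1.
have h2 : `|0 - n%:R^-1 * (e / 2 - ln (e / 2))| <= e / 2.
  by near: n.
have l0 : 0 <= ln (n.+1%:R : R) by rewrite ln_ge0// ler1n.
rewrite sub0r normrN in h2 *.
rewrite sub0r normrN ger0_norm ?mulr_ge0 ?invr_ge0//.
apply: (@le_trans _ _ (n%:R^-1 * (n%:R * (e / 2)) + n%:R^-1 * (e / 2 - ln (e / 2)))).
  rewrite -mulrDr ler_wpM2l ?invr_ge0//.
  by move: h1; rewrite -natr1; lra.
rewrite mulKf ?gt_eqF//; have := le_trans (ler_norm _) h2; lra.
Unshelve. all: by end_near.
Qed.

(** Makes [cover_rep] meaningful for every label. An edge out of [i0], which exists because the row
    sums to one, is taken first, so the vertex differs from the root even for the label [i0]. *)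
Lemma cover_label_exists (R : realType) (V : countType) (E : rel V) (i0 : V)
    (pG : V -> V -> R) : strongly_connected E -> stochastic pG ->
  (forall i j, (0 < pG i j) = E i j) ->
  forall i, exists x : dcover E i0, x != cover_root E i0 /\ cover_label x = i.
Proof.
move=> sc [p0 p1] pE i.
have [j Ej] : exists j, E i0 j.
  apply: contrapT => h; have := p1 i0; rewrite esum1.
    by move=> /eqP; rewrite eqe eq_sym oner_eq0.
  move=> j _; congr (_%:E); apply/eqP; rewrite eq_le p0 andbT leNgt pE.
  by apply/negP => Ej; apply: h; exists j.
have [s [ps ls]] := sc j i.
have Hs : path E i0 (j :: s) by rewrite /= Ej.
by exists (exist (path E i0) (j :: s) Hs).
Qed.

(** * Identification of the entropy with the rate of escape *)

Unset Implicit Arguments.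
Set Strict Implicit.
Set Printing Implicit Defensive.

Theorem mainTheorem7 (R : realType) (V : countType) (E : rel V) (i0 : V)
  (pG : V -> V -> R) (pback : V -> R)
  (d : measure_display) (Omega : measurableType d)
  (P : dcover E i0 -> probability Omega R) (X : nat -> Omega -> dcover E i0)
  (E_connected : strongly_connected E)
  (E_bounded : bounded_geometry E)
  (pG_stochastic : stochastic pG)
  (pG_edge : forall i j : V, (0 < pG i j) = E i j)
  (pback_bounded : exists eps : R, 0 < eps < 1 /\
     forall i : V, eps < pback i < 1 - eps)
  (X_walk : markov_chain (cover_trans pG pback) P X)
  (X_transient : transient P X)
  (p_bounded : exists2 eps0 : R, 0 < eps0 &
     forall x y : dcover E i0, 0 < cover_trans pG pback x y ->
       eps0 <= cover_trans pG pback x y)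
  (Q_positive_recurrent : positive_recurrent (exit_matrix pG pback P X))
  (spectral_lt1 : (spectral_radius P X (cover_root E i0) < 1)%E) :
  let o := cover_root E i0 in
  cvgn (mean_entropy P X o) /\
  {ae P o, forall w : Omega,
     (- (n%:R)^-1 * ln (hitting_prob P X o (X n w))) @[n --> \oo] -->
     asymptotic_entropy P X o}.
Proof.
move=> o.
have [e1 [/andP[e1_0 e1_1] he1]] := pback_bounded.
have [e0 e0_0 he0] := p_bounded.
pose eps := Num.min e1 e0.
have H : cover_walk pG pback P X eps.
  split => //.
  - move=> i; have /andP[h1 h2] := he1 i.
    apply/andP; split; first by rewrite ge_min (ltW h1).
    by apply: ltW (lt_trans h2 _); rewrite gtrBl.
  - by rewrite lt_min e1_0 e0_0 /= ge_min (ltW e1_1).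
  - by move=> x y pxy; rewrite ge_min he0// orbT.
  - by move=> i; have /andP[_ h2] := he1 i; apply: lt_trans h2 _; rewrite gtrBl.
have [r [M [r_gt1 rM]]] := spectral_radius_bound spectral_lt1.
have labels_rep := cover_label_exists i0 E_connected pG_stochastic pG_edge.
have [l cost_cvg] : exists l : R, {ae P o, forall w,
    (n%:R^-1 * green_cost pG pback P X (X n w)) @[n --> \oo] --> l}.
  (* The realization of Q provides [rho], the tails of its return time to [i0], whose sum is bounded
     by the mean return time. *)
  have [dY [OY [PY [Y [MCY hY]]]]] := Q_positive_recurrent.
  apply: (@green_cost_slln _ _ _ _ _ _ _ _ _ _ _ H r M r_gt1 rM
    (fun m i => avoid_prob PY Y i0 m i)
    (fine (\int[PY i0]_w return_time Y i0 w)%E) labels_rep).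
  - exact: step_sum MCY.
  - by move=> m i; exact: avoid_prob_ge0.
  - by move=> i; exact: avoid_prob0 MCY _ _.
  - by move=> m i; exact: avoid_prob_step MCY _ _ _.
  - move=> N; rewrite -lee_fin fineK; first exact: avoid_prob_sum MCY _ _.
    rewrite ge0_fin_numE//; apply: integral_ge0 => w _.
    by apply: le_ereal_inf_tmp => _ [n _ <-]; rewrite lee_fin.
pose J n := fine (\int[P o]_w (- ln (hitting_prob P X o (X n w)))%:E)%E.
have Jcvg : (n%:R^-1 * J n) @[n --> \oo] --> l.
  exact (mean_hit_cvg H r_gt1 rM cost_cvg).
have [k [k0 hk]] := mean_ent_le H r_gt1 rM.
(* The expectation is of a nonpositive logarithm; the sign is moved inside so that only nonnegative
   functions are integrated. *)
have entE n : mean_entropy P X o n =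
    n%:R^-1 * fine (\int[P o]_w (- ln (tp P X o n (X n w)))%:E)%E.
  rewrite /mean_entropy unlock mulNr -mulrN -fineN; congr (_ * fine _).
  transitivity (- \int[P o]_w (ln (tp P X o n (X n w)))%:E)%E => //.
  have -> : (\int[P o]_w (ln (tp P X o n (X n w)))%:E =
      - \int[P o]_w (- ln (tp P X o n (X n w)))%:E)%E.
    rewrite -integral_ge0N; last by move=> w _; rewrite lee_fin (ent_cost_ge0 H).
    by apply: eq_integral => w _; rewrite -EFinN opprK.
  by rewrite oppeK.
have Jfin n : (\int[P o]_w (- ln (hitting_prob P X o (X n w)))%:E)%E \is a fin_num.
  rewrite ge0_fin_numE; first exact: le_lt_trans (mean_hit_le H n) (ltry _).
  by apply: integral_ge0 => w _; rewrite lee_fin (hit_cost_ge0 H).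
have entJ n : n%:R^-1 * J n <= mean_entropy P X o n <=
    n%:R^-1 * J n + (n%:R^-1 * ln (2 * k%:R) + n%:R^-1 * ln n.+1%:R).
  have fin : (\int[P o]_w (- ln (tp P X o n (X n w)))%:E)%E \is a fin_num.
    rewrite ge0_fin_numE.
      by apply: le_lt_trans (hk n) _; rewrite -(fineK (Jfin n)) -EFinD ltry.
    by apply: integral_ge0 => w _; rewrite lee_fin (ent_cost_ge0 H).
  rewrite entE -!mulrDr; apply/andP; split.
    rewrite ler_wpM2l ?invr_ge0// -lee_fin /J !fineK//.
    exact: mean_hit_le_ent H n.
  rewrite ler_wpM2l ?invr_ge0// -lnM ?posrE ?mulr_gt0 ?ltr0n//.
  rewrite -mulrA -natrM -lee_fin EFinD /J !fineK//.
have ent_cvg : mean_entropy P X o n @[n --> \oo] --> l.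
  apply: squeeze_cvgr; [exact: nearW entJ|exact: Jcvg|].
  rewrite -[l]addr0; apply: cvgD => //; rewrite -[X in _ --> X]addr0.
  by apply: cvgD; [exact: cvg_const_div|exact: cvg_ln_succ_div].
split; first by apply/cvg_ex; exists l.
rewrite /asymptotic_entropy (cvg_lim _ ent_cvg)//.
apply: filterS (hit_cost_cvg H r_gt1 rM cost_cvg) => w.
by under eq_fun do rewrite mulrN -mulNr.
Qed.
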